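(* Let $a,b_1,b_2,c_1,c_2\in\mathbb C$ and $$M=\begin{bmatrix}a&b_1&0\\c_1&a&b_2\\0&c_2&a\end{bmatrix}.$$ Then for every matrix-valued polynomial $p$, $$\|p(M)\|\le 2\max_{z\in W(M)}\|p(z)\|.$$ Equivalently, the same inequality holds for all matrix-valued polynomials $p$ and all $M\in\mathbb C^{3\times3}$ whose numerical range is an ellipse with one eigenvalue of $M$ at the center of the ellipse.
   Context: For a square complex matrix $M$, $W(M)=\{x^*Mx : x^*x=1\}$ is the numerical range, and $\|\cdot\|$ is the operator 2-norm. A matrix-valued polynomial is $p(z)=\sum_{k=0}^N C_k z^k$ with $C_k\in\mathbb C^{m\times n}$ for some $m,n\ge1$, $N\ge 0$; $p(M):=\sum_{k=0}^N C_k\otimes M^k$ (Kronecker product). ''Ellipse'' means the closed filled region $\{z\in\mathbb C: |z-f_1|+|z-f_2|\le L\}$ with $f_1,f_2\in\mathbb C$, $L\ge |f_1-f_2|$ (degenerate cases allowed); its center is $(f_1+f_2)/2$. *)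

(* Defs.v *)
From mathcomp Require Import all_boot all_order all_algebra.
From mathcomp Require Import classical_sets reals.
From mathcomp Require Import complex mxtens.

Set Implicit Arguments.
Unset Strict Implicit.
Unset Printing Implicit Defensive.

Import Order.TTheory GRing.Theory Num.Theory.

Local Open Scope classical_set_scope.
Local Open Scope complex_scope.
Local Open Scope ring_scope.

(* Complex numbers are R[i] for R : realType.  The modulus Normc.normc takes
   values in R, unlike `|z|, which lives in R[i]; having R-valued norms gives
   access to the total order and to sup. *)

Definition adjointmx (R : realType) (m n : nat) (A : 'M[R[i]]_(m, n)) :
    'M[R[i]]_(n, m) :=
  map_mx Num.conj A^T.

Definition norm2 (R : realType) (n : nat) (x : 'cV[R[i]]_n) : R :=
  Num.sqrt (\sum_(i < n) Normc.normc (x i 0) ^+ 2).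

Definition opnorm2 (R : realType) (m n : nat) (A : 'M[R[i]]_(m, n)) : R :=
  sup [set norm2 (A *m x) | x in [set x : 'cV[R[i]]_n | norm2 x <= 1]].

Definition numerical_range (R : realType) (n : nat) (M : 'M[R[i]]_n) :
    set R[i] :=
  [set (adjointmx x *m M *m x) 0 0
    | x in [set x : 'cV[R[i]]_n | (adjointmx x *m x) 0 0 = 1]].

(* A matrix-valued polynomial \sum_k C_k z^k of formal degree at most N is given
   by its coefficients C : 'I_N.+1 -> 'M_(m, n). *)
Definition mvpoly_eval (R : realType) (m n N : nat)
    (C : 'I_N.+1 -> 'M[R[i]]_(m, n)) (z : R[i]) : 'M[R[i]]_(m, n) :=
  \sum_(k < N.+1) z ^+ k *: C k.

Definition mvpoly_evalmx (R : realType) (m n N d : nat)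
    (C : 'I_N.+1 -> 'M[R[i]]_(m, n)) (M : 'M[R[i]]_d.+1) :
    'M[R[i]]_(m * d.+1, n * d.+1) :=
  \sum_(k < N.+1) C k *t (M ^+ k).

Definition is_max (R : realType) (A : set R) (x : R) : Prop :=
  A x /\ ubound A x.

(* The maximum is required to exist; it is then unique. *)
Definition mvpoly_bound2 (R : realType) (d : nat) (M : 'M[R[i]]_d.+1) : Prop :=
  forall (m n N : nat) (C : 'I_N.+1 -> 'M[R[i]]_(m, n)),
    (0 < m)%N -> (0 < n)%N ->
    exists mu : R,
      is_max [set opnorm2 (mvpoly_eval C z) | z in numerical_range M] mu /\
      opnorm2 (mvpoly_evalmx C M) <= 2 * mu.

Definition tridiag3 (R : realType) (a b1 b2 c1 c2 : R[i]) : 'M[R[i]]_3 :=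
  \matrix_(i < 3, j < 3)
    nth 0 (nth [::] [:: [:: a;  b1; 0 ];
                        [:: c1; a;  b2];
                        [:: 0;  c2; a ]] i) j.

Definition ellipse (R : realType) (f1 f2 : R[i]) (L : R) : set R[i] :=
  [set z | Normc.normc (z - f1) + Normc.normc (z - f2) <= L].

(* Main.v *)
Require Import Defs.
From mathcomp Require Import all_boot all_order all_algebra.
From mathcomp Require Import cyclotomic cyclic.
From mathcomp Require Import classical_sets functions reals topology normedtype derive.
From mathcomp Require Import complex mxtens.
From mathcomp Require Import ring lra zify.

Set Implicit Arguments.
Unset Strict Implicit.
Unset Printing Implicit Defensive.

Import Order.TTheory GRing.Theory Num.Theory.
Import numFieldNormedType.Exports.

Local Open Scope complex_scope.
Local Open Scope ring_scope.

(* A bound ||p(M)|| <= 2 max ||p|| over W(M) follows from a factorization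
   M = L^-1 t(T) L with T a contraction, L positive diagonal of condition number
   at most 2, and t a polynomial mapping the unit circle into W(M): apply von
   Neumann's inequality for matrix-valued polynomials to p o t.

   A tridiagonal M with zero diagonal is, up to scaling and unitary similarity,
   of the form [[0,u,0],[1/u,0,1/w],[0,w,0]] with u, w > 0, or nilpotent with a
   disc as numerical range.  In the first case W(M) is an ellipse with foci
   +-sqrt 2.  If it is elongated, M is diagonally similar to a Hermitian matrix.
   Otherwise L M L^-1 = sqrt K T with T^3 = y T for suitable K, y and L, so that
   t(z) = c z q(z^2) satisfies t(T) = L M L^-1 as soon as c q(y) = sqrt K, and one
   needs a real polynomial q, large at y, such that z q(z^2) maps the circle into
   the ellipse.  By Landen's transformation this is a statement on chi q(chi)^2,
   and q is a polynomial approximation of the square root of an explicit function.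

   If W(M) is an ellipse centred at the eigenvalue 0 with semi-axis p and focal
   distance f, each Hermitian part Re(d M), |d| = 1, has extremal eigenvalues
   +-h(d), with h the support function.  The characteristic polynomials for
   d = 1, -i, 1 - i, 1 + i determine those invariants of M that matter: for
   f > 0 they give a unitary similarity to a tridiagonal matrix with zero
   diagonal, and for f = 0 to [[0,a,b],[0,mu,c],[0,0,0]] with rows or columns
   that become orthogonal after a diagonal similarity, a scaled contraction. *)

(** * Squared norms and adjoints *)

(** The condition number of [L] already uses up the factor 2, so the map of the circle into W(M)
    must be nearly optimal. Put a = 2 r, with 1 + r and 1 - r proportional to the semi-axes of W(M),
    and K = a + 1/a. Scaling by 1/sqrt K gives y = 2/K, and c q(y) = sqrt K is affordable as soon as
    y q(y)^2 >= 2 a. For chi q(chi)^2, confined to an ellipse with foci 0 and 2 a, this means that 0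
    goes to one focus and [y] at least as far as the other. A Blaschke factor carries 0 and [y] to
    -a and a, so an odd map of the disc into the ellipse with foci -a and a that fixes both foci is
    enough. The Riemann map of an ellipse is not elementary; an explicit quintic serves instead, and
    it stays strictly inside, a margin that pays for the polynomial square root. The elongated case
    is split off at r = 1/2, where a = 1.

    For elliptic ranges the invariants yield the characteristic polynomial (x^2 - f^2)(x - tr M). If
    f > 0, the eigenvalue 0 forces trace 0. If f = 0, the trace [mu] may be nonzero, and then no
    tridiagonal form with constant diagonal exists; hence the separate contraction. *)

Section SquaredNorm.
Variable R : realType.
Implicit Types (z w : R[i]) (x y : R).

Definition sqn z : R := complex.Re z ^+ 2 + complex.Im z ^+ 2.

Lemma conjE z : Num.conj z = conjc z.
Proof. by []. Qed.

Lemma conjcD z w : conjc (z + w) = conjc z + conjc w.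
Proof. exact: rmorphD. Qed.
Lemma conjcB z w : conjc (z - w) = conjc z - conjc w.
Proof. exact: rmorphB. Qed.
Lemma conjcN z : conjc (- z) = - conjc z.
Proof. exact: rmorphN. Qed.
Lemma conjcM z w : conjc (z * w) = conjc z * conjc w.
Proof. exact: rmorphM. Qed.
Lemma realCD x y : (x + y)%:C = x%:C + y%:C :> R[i].
Proof. exact: rmorphD. Qed.
Lemma realCB x y : (x - y)%:C = x%:C - y%:C :> R[i].
Proof. exact: rmorphB. Qed.
Lemma realCN x : (- x)%:C = - x%:C :> R[i].
Proof. exact: rmorphN. Qed.
Lemma realCM x y : (x * y)%:C = x%:C * y%:C :> R[i].
Proof. exact: rmorphM. Qed.
Lemma realCX x n : (x ^+ n)%:C = x%:C ^+ n :> R[i].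
Proof. exact: rmorphXn. Qed.
Lemma realCV x : (x^-1)%:C = (x%:C)^-1 :> R[i].
Proof. exact: fmorphV. Qed.

Definition conjcE := (conjcD, conjcB, conjcN, conjcM, @conjcK, @conjc_real R,
  @conjc0 R, @conjc1 R).
Definition realCE := (realCD, realCB, realCN, realCM, realCX, realCV).

Lemma sqn_ge0 z : 0 <= sqn z.
Proof. by rewrite addr_ge0 ?sqr_ge0. Qed.

Lemma sqnM z w : sqn (z * w) = sqn z * sqn w.
Proof. case: z => a b; case: w => c d; rewrite /sqn /=; ring. Qed.

Lemma sqnN z : sqn (- z) = sqn z.
Proof. by case: z => a b; rewrite /sqn /= !sqrrN. Qed.

Lemma sqn_conj z : sqn (conjc z) = sqn z.
Proof. by case: z => a b; rewrite /sqn /= sqrrN. Qed.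

Lemma sqn0 : sqn 0 = 0.
Proof. by rewrite /sqn /= expr0n addr0. Qed.

Lemma sqn1 : sqn 1 = 1.
Proof. by rewrite /sqn /= expr0n addr0 expr1n. Qed.

Lemma sqn_real x : sqn x%:C = x ^+ 2.
Proof. by rewrite /sqn /= expr0n addr0. Qed.

Lemma sqn_eq0 z : (sqn z == 0) = (z == 0).
Proof.
case: z => a b; rewrite /sqn /= paddr_eq0 ?sqr_ge0 // !sqrf_eq0.
by rewrite eq_complex.
Qed.

Lemma sqnX z n : sqn (z ^+ n) = sqn z ^+ n.
Proof. by elim: n => [|n IH]; rewrite ?sqn1 // !exprS sqnM IH. Qed.

Lemma sqnV z : sqn z^-1 = (sqn z)^-1.
Proof.
have [->|z0] := eqVneq z 0; first by rewrite invr0 sqn0 invr0.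
by apply: (mulfI (_ : sqn z != 0)); rewrite ?sqn_eq0 // -sqnM !mulfV ?sqn1 ?sqn_eq0.
Qed.

Lemma sqnE z : (sqn z)%:C = z * conjc z.
Proof.
by case: z => a b; apply/eqP; rewrite eq_complex /=; apply/andP; split;
  apply/eqP; rewrite /sqn /=; ring.
Qed.

Lemma normc_sqrt z : Normc.normc z = Num.sqrt (sqn z).
Proof. by case: z. Qed.

Lemma normc_sqr z : Normc.normc z ^+ 2 = sqn z.
Proof. by rewrite normc_sqrt sqr_sqrtr ?sqn_ge0. Qed.

(** The difference of the two sides is [e] times a sum of squares. A small [e] keeps the first
    factor close to 1, which is how small perturbations are absorbed without square roots. *)
Lemma sqnD_le (e : R) z w : 0 < e ->
  sqn (z + w) <= (1 + e) * sqn z + (1 + e^-1) * sqn w.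
Proof.
move=> e0; case: z => a b; case: w => c d; rewrite /sqn /=.
rewrite -subr_ge0.
have -> : (1 + e) * (a ^+ 2 + b ^+ 2) + (1 + e^-1) * (c ^+ 2 + d ^+ 2) -
  ((a + c) ^+ 2 + (b + d) ^+ 2) = e * ((a - e^-1 * c) ^+ 2 + (b - e^-1 * d) ^+ 2).
  by field; lra.
by rewrite mulr_ge0 ?addr_ge0 ?sqr_ge0 ?ltW.
Qed.

End SquaredNorm.

Section Frobenius.
Variable R : realType.
Local Notation C := R[i].

Definition frob2 m n (X : 'M[C]_(m, n)) : R := \sum_i \sum_j sqn (X i j).

Lemma frob2_ge0 m n (X : 'M[C]_(m, n)) : 0 <= frob2 X.
Proof. by apply: sumr_ge0 => i _; apply: sumr_ge0 => j _; apply: sqn_ge0. Qed.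

Lemma frob2_0 m n : frob2 (0 : 'M[C]_(m, n)) = 0.
Proof. by rewrite /frob2 big1 // => i _; rewrite big1 // => j _; rewrite mxE sqn0. Qed.

Lemma frob2_eq0 m n (X : 'M[C]_(m, n)) : frob2 X = 0 -> X = 0.
Proof.
move=> X0; apply/matrixP => i j; rewrite mxE; apply/eqP; rewrite -sqn_eq0.
have := psumr_eq0P (fun i _ => sumr_ge0 _ (fun j _ => sqn_ge0 (X i j))) X0.
move=> /(_ i isT) /(psumr_eq0P (fun j _ => sqn_ge0 (X i j))) /(_ j isT) ->.
by [].
Qed.

Lemma frob2Z m n (a : C) (X : 'M[C]_(m, n)) : frob2 (a *: X) = sqn a * frob2 X.
Proof.
rewrite /frob2 mulr_sumr; apply: eq_bigr => i _; rewrite mulr_sumr.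
by apply: eq_bigr => j _; rewrite mxE sqnM.
Qed.

Lemma frob2_tr m n (X : 'M[C]_(m, n)) : frob2 X^T = frob2 X.
Proof.
rewrite /frob2 exchange_big; apply: eq_bigr => i _; apply: eq_bigr => j _.
by rewrite mxE.
Qed.

Lemma frob2_adj m n (X : 'M[C]_(m, n)) : frob2 (adjointmx X) = frob2 X.
Proof.
rewrite -[RHS]frob2_tr /frob2; apply: eq_bigr => i _; apply: eq_bigr => j _.
by rewrite !mxE conjE sqn_conj.
Qed.

Lemma frob2_col m n (X : 'M[C]_(m, n)) : frob2 X = \sum_j frob2 (col j X).
Proof.
rewrite /frob2 exchange_big; apply: eq_bigr => j _; apply: eq_bigr => i _.
by rewrite big_ord1 mxE.
Qed.

Lemma norm2_sqr n (x : 'cV[C]_n) : norm2 x ^+ 2 = frob2 x.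
Proof.
rewrite /norm2 sqr_sqrtr; last by apply: sumr_ge0 => i _; apply: sqr_ge0.
by rewrite /frob2; apply: eq_bigr => i _; rewrite big_ord1 normc_sqr.
Qed.

Lemma norm2_ge0 n (x : 'cV[C]_n) : 0 <= norm2 x.
Proof. exact: sqrtr_ge0. Qed.

Lemma frob2D_le m n (e : R) (X Y : 'M[C]_(m, n)) : 0 < e ->
  frob2 (X + Y) <= (1 + e) * frob2 X + (1 + e^-1) * frob2 Y.
Proof.
move=> e0; rewrite /frob2 !mulr_sumr -big_split; apply: ler_sum => i _ /=.
rewrite !mulr_sumr -big_split; apply: ler_sum => j _ /=.
by rewrite mxE sqnD_le.
Qed.

Lemma trace_frob2 m n (X : 'M[C]_(m, n)) : \tr (X *m adjointmx X) = (frob2 X)%:C.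
Proof.
rewrite /mxtrace /frob2 rmorph_sum; apply: eq_bigr => i _.
rewrite mxE rmorph_sum; apply: eq_bigr => j _ /=.
by rewrite sqnE !mxE conjE.
Qed.

Lemma adjointmxM m n p (A : 'M[C]_(m, n)) (B : 'M[C]_(n, p)) :
  adjointmx (A *m B) = adjointmx B *m adjointmx A.
Proof. by rewrite /adjointmx trmx_mul map_mxM. Qed.

Lemma adjointmxK m n (A : 'M[C]_(m, n)) : adjointmx (adjointmx A) = A.
Proof. by apply/matrixP => i j; rewrite !mxE conjCK. Qed.

Lemma adjointmxD m n (A B : 'M[C]_(m, n)) :
  adjointmx (A + B) = adjointmx A + adjointmx B.
Proof. by apply/matrixP => i j; rewrite !mxE rmorphD. Qed.

Lemma adjointmxZ m n a (A : 'M[C]_(m, n)) :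
  adjointmx (a *: A) = conjc a *: adjointmx A.
Proof. by apply/matrixP => i j; rewrite !mxE rmorphM. Qed.

Lemma adjointmx1 n : adjointmx (1%:M : 'M[C]_n) = 1%:M.
Proof. by rewrite /adjointmx trmx1 map_mx1. Qed.

(** Here [c] bounds the square of the operator norm. Applied column by column, the same constant
    bounds the action on matrices, that is, on tensors. *)
Definition bdd2 m n (A : 'M[C]_(m, n)) (c : R) :=
  forall x : 'cV[C]_n, frob2 (A *m x) <= c * frob2 x.

Lemma bdd2_mul m n p (A : 'M[C]_(m, n)) c (X : 'M[C]_(n, p)) :
  bdd2 A c -> frob2 (A *m X) <= c * frob2 X.
Proof.
move=> Ac; rewrite !frob2_col mulr_sumr; apply: ler_sum => j _.
by rewrite colE -mulmxA -colE Ac.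
Qed.

Lemma bdd2_mulr m n p (A : 'M[C]_(m, n)) c (X : 'M[C]_(p, n)) :
  bdd2 A c -> frob2 (X *m A^T) <= c * frob2 X.
Proof. by move=> Ac; rewrite -frob2_tr trmx_mul trmxK -[frob2 X]frob2_tr bdd2_mul. Qed.

Lemma cauchy_schwarz (I : finType) (f g : I -> C) :
  sqn (\sum_i f i * g i) <= (\sum_i sqn (f i)) * (\sum_i sqn (g i)).
Proof.
set F := \sum_i sqn (f i); set S := \sum_i f i * g i.
have F0 : 0 <= F by apply: sumr_ge0 => i _; apply: sqn_ge0.
have := F0; rewrite le_eqVlt => /predU1P[F0'|Fp].
  suff -> : S = 0 by rewrite sqn0 -F0' mul0r.
  rewrite /S big1 // => i _.
  have /(_ i isT)/eqP := psumr_eq0P (fun i _ => sqn_ge0 (f i)) (esym F0').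
  by rewrite sqn_eq0 => /eqP ->; rewrite mul0r.
(* Up to the factor [F], this sum is the Gram determinant of [g] and the conjugate of [f]. *)
have : 0 <= \sum_i sqn (F%:C * g i - S * conjc (f i)).
  by apply: sumr_ge0 => i _; apply: sqn_ge0.
set G := \sum_i sqn (g i).
suff -> : \sum_i sqn (F%:C * g i - S * conjc (f i)) = F * (F * G - sqn S).
  by rewrite pmulr_rge0 // subr_ge0.
apply: complexI; rewrite (rmorph_sum (real_complex R)) /=.
under eq_bigr => i _.
  have -> : (sqn (F%:C * g i - S * conjc (f i)))%:C =
    (F%:C ^+ 2 * (sqn (g i))%:C) - F%:C * conjc S * (f i * g i)
      - F%:C * S * conjc (f i * g i) + ((sqn S)%:C * (sqn (f i))%:C).
    by rewrite !(realCE, sqnE, conjcE); ring.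
  over.
rewrite !big_split /= !sumrN -!mulr_sumr -/S.
rewrite -(rmorph_sum (@conjc R)) -!(rmorph_sum (real_complex R)) -/F -/S -/G.
rewrite !(realCM, realCB) !sqnE; ring.
Qed.

Lemma bdd2_frob2 m n (A : 'M[C]_(m, n)) : bdd2 A (frob2 A).
Proof.
move=> x; rewrite /frob2 mulr_suml; apply: ler_sum => i _.
rewrite big_ord1 mxE; apply: le_trans (cauchy_schwarz _ _) _.
rewrite ler_wpM2l //; first by apply: sumr_ge0 => j _; apply: sqn_ge0.
by apply: ler_sum => j _; rewrite big_ord1.
Qed.

Lemma frob2_dot n (x : 'cV[C]_n) : (adjointmx x *m x) 0 0 = (frob2 x)%:C.
Proof.
rewrite mxE /frob2 rmorph_sum; apply: eq_bigr => i _.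
by rewrite big_ord1 /= sqnE !mxE mulrC.
Qed.

(* ||A^* y||^2 = <y, A A^* y> <= ||y|| ||A A^* y||, by Cauchy-Schwarz. *)
Lemma bdd2_adjoint m n (A : 'M[C]_(m, n)) : bdd2 A 1 -> bdd2 (adjointmx A) 1.
Proof.
move=> A1 y; set z := adjointmx A *m y; rewrite mul1r.
have zz : (frob2 z)%:C = \sum_i conjc (y i 0) * ((A *m z) i 0).
  rewrite -frob2_dot {1}/z adjointmxM adjointmxK -mulmxA [LHS]mxE.
  by apply: eq_bigr => i _; rewrite !mxE.
have h : frob2 z ^+ 2 <= frob2 y * frob2 z.
  rewrite -sqn_real zz; apply: le_trans (cauchy_schwarz _ _) _.
  apply: ler_pM; first by apply: sumr_ge0 => i _; apply: sqn_ge0.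
  - by apply: sumr_ge0 => i _; apply: sqn_ge0.
  - by rewrite /frob2; apply: ler_sum => i _; rewrite big_ord1 sqn_conj.
  - have := A1 z; rewrite mul1r; apply: le_trans.
    by rewrite /frob2; apply: ler_sum => i _; rewrite big_ord1.
have := frob2_ge0 z; rewrite le_eqVlt => /predU1P[<-|zp]; first exact: frob2_ge0.
by move: h; rewrite expr2 ler_pM2r.
Qed.

End Frobenius.

(** * Von Neumann's inequality for matrix-valued polynomials *)

Section VonNeumann.
Variable R : realType.
Local Notation C := R[i].

Lemma exists_primitive_root n : (0 < n)%N -> exists z : C, n.-primitive_root z.
Proof.
pose p : {poly C} := 'X^n - 1; have [r Dp] := closed_field_poly_normal p.
move=> n_gt0; rewrite (monicP _) ?monicXnsubC // scale1r in Dp.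
have rn1: all n.-unity_root r by apply/allP=> z; rewrite -root_prod_XsubC -Dp.
have sz_r: (n < (size r).+1)%N.
  by rewrite -(size_prod_XsubC r id) -Dp size_XnsubC.
have [|z] := hasP (has_prim_root n_gt0 rn1 _ sz_r); last by exists z.
by rewrite -separable.separable_prod_XsubC -Dp separable_Xn_sub_1 // pnatr_eq0 -lt0n.
Qed.

Lemma sqn_unity_root n (z : C) : (0 < n)%N -> z ^+ n = 1 -> sqn z = 1.
Proof.
move=> n0 zn; apply/eqP; rewrite -(pexpr_eq1 n0) ?sqn_ge0 // -sqnX zn.
by rewrite sqn1.
Qed.

Lemma sqn1_conj (z : C) : sqn z = 1 -> conjc z = z^-1.
Proof.
move=> z1; have z0 : z != 0 by rewrite -sqn_eq0 z1 oner_eq0.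
by apply: (mulfI z0); rewrite -sqnE z1 mulfV.
Qed.

(** [D] is a defect operator: [1 - S S^*] is positive semidefinite, and the spectral theorem
    provides a root [D] with [D D^* = 1 - S S^*]. Operators act from the right on tensors stored as
    matrices, hence the transpose in the hypothesis. *)
Lemma psd_factor n (S : 'M[C]_n) : bdd2 S^T 1 ->
  exists D : 'M[C]_n, forall p (X : 'M[C]_(p, n)),
    frob2 (X *m D) = frob2 X - frob2 (X *m S).
Proof.
move=> S1; pose G := 1%:M - S *m adjointmx S.
have Gnormal : G \is normalmx.
  apply/normalmxP; suff -> : map_mx Num.conj G^T = G by [].
  change (adjointmx G = G); rewrite /G adjointmxD -scaleN1r adjointmxZ adjointmxM.
  by rewrite adjointmxK adjointmx1 conjcN conjc1 scaleN1r.
have := Gnormal => /orthomx_spectralP.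
set P := spectralmx G; set sp := spectral_diag G.
have Pu : P \is unitarymx by apply: spectral_unitarymx.
rewrite invmx_unitary // => Geq0.
have {Geq0} Geq : G = adjointmx P *m diag_mx sp *m P := Geq0.
have PP : P *m adjointmx P = 1%:M by apply/unitarymxP.
have Gform p (X : 'M[C]_(p, n)) :
    \tr (X *m G *m adjointmx X) = (frob2 X - frob2 (X *m S))%:C.
  rewrite realCB -!trace_frob2 /G mulmxBr mulmx1 mulmxBl raddfB /=.
  by rewrite adjointmxM !mulmxA.
have sp0 i : 0 <= sp 0 i.
  have := Gform _ (row i P).
  have -> : \tr (row i P *m G *m adjointmx (row i P)) = sp 0 i.
    have e1 : row i P *m adjointmx P = delta_mx 0 i by rewrite -row_mul PP row1.
    have e2 : P *m adjointmx (row i P) = delta_mx i 0.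
      rewrite -{1}[P]adjointmxK -adjointmxM e1.
      by apply/matrixP => k l; rewrite !mxE andbC; case: (_ && _); rewrite ?rmorph1 ?rmorph0.
    rewrite /mxtrace big_ord1 Geq !mulmxA. rewrite e1 -mulmxA e2 -rowE -colE !mxE eqxx.
    by rewrite mulr1n.
  move=> ->; rewrite ler0c subr_ge0 -frob2_tr trmx_mul.
  by apply: le_trans (S1 _) _; rewrite mul1r frob2_tr.
pose D := adjointmx P *m diag_mx (map_mx sqrtC sp).
have DD : D *m adjointmx D = G.
  rewrite /D adjointmxM adjointmxK Geq !mulmxA; congr (_ *m _).
  rewrite -mulmxA; congr (_ *m _).
  rewrite /adjointmx tr_diag_mx map_diag_mx mulmx_diag; congr diag_mx.
  apply/rowP => i; rewrite !mxE; transitivity (sqrtC (sp 0 i) * sqrtC (sp 0 i)).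
    by congr (_ * _); apply: conj_Creal; rewrite ger0_real // sqrtC_ge0.
  by rewrite -expr2 sqrtCK.
exists D => p X; apply: complexI.
by rewrite -trace_frob2 adjointmxM mulmxA -(mulmxA X D) DD Gform.
Qed.

(** Orthogonality of the characters of the cyclic group of order [K]; finite sums over roots of
    unity stand in for integrals over the circle. *)
Lemma parseval K (w : C) (b : 'I_K -> C) : (0 < K)%N -> K.-primitive_root w ->
  \sum_(l < K) sqn (\sum_(j < K) w ^+ (l * j) * b j) = K%:R * \sum_j sqn (b j).
Proof.
move=> K0 wp; have wK := prim_expr_order wp.
have w1 := sqn_unity_root K0 wK.
have w0 : w != 0 by rewrite -sqn_eq0 w1 oner_eq0.
apply: complexI; rewrite realCM !(rmorph_sum (real_complex R)) /=.
transitivity (\sum_(i < K) \sum_(j < K) b i * conjc (b j) *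
    \sum_(l < K) (w ^+ i / w ^+ j) ^+ l).
  under eq_bigr => l _.
    rewrite sqnE (rmorph_sum (@conjc R)) mulr_suml.
    under eq_bigr => i _ do rewrite mulr_sumr.
    over.
  rewrite exchange_big; apply: eq_bigr => i _ /=.
  rewrite exchange_big; apply: eq_bigr => j _ /=.
  rewrite mulr_sumr; apply: eq_bigr => l _.
  rewrite conjcM [conjc (w ^+ _)](rmorphXn (@conjc R)) /= (sqn1_conj w1).
  rewrite expr_div_n -!exprM ![(l * _)%N]mulnC exprVn; ring.
rewrite mulr_sumr; apply: eq_bigr => i _.
rewrite (bigD1 i) //= [X in _ + X]big1 ?addr0 => [|j ji].
  under eq_bigr => l _ do rewrite divff ?expf_neq0 // expr1n.
  by rewrite sumr_const card_ord sqnE mulrC rmorph_nat.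
suff -> : \sum_(l < K) (w ^+ i / w ^+ j) ^+ l = 0 by rewrite mulr0.
apply: (mulfI (_ : w ^+ i / w ^+ j - 1 != 0)).
  rewrite subr_eq0; apply: contra ji => /eqP e.
  have /eqP : w ^+ i = w ^+ j by rewrite -[LHS](divfK (expf_neq0 j w0)) e mul1r.
  by rewrite (eq_prim_root_expr wp) !modn_small // eq_sym.
rewrite -subrX1 mulr0 expr_div_n -!exprM ![(_ * K)%N]mulnC !exprM wK !expr1n.
by rewrite divr1 subrr.
Qed.

Lemma parseval_frob2 K m n (w : C) (b : 'I_K -> 'M[C]_(m, n)) :
  (0 < K)%N -> K.-primitive_root w ->
  \sum_(l < K) frob2 (\sum_(j < K) w ^+ (l * j) *: b j) = K%:R * \sum_j frob2 (b j).
Proof.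
move=> K0 wp; rewrite /frob2 exchange_big [in RHS]exchange_big mulr_sumr /=.
apply: eq_bigr => p _; rewrite exchange_big [in RHS]exchange_big mulr_sumr /=.
apply: eq_bigr => q _; rewrite -(parseval _ K0 wp); apply: eq_bigr => l _.
by congr sqn; rewrite summxE; apply: eq_bigr => j _; rewrite mxE.
Qed.

(* Cyclic convolution by the coefficients of a matrix polynomial: the discrete
   Fourier transform turns it into pointwise multiplication by values of the
   polynomial on the unit circle. *)
Lemma cyclic_convolution K m n p N (Cf : 'I_N.+1 -> 'M[C]_(m, n)) (c : R)
    (b : 'I_K.+1 -> 'M[C]_(n, p)) :
  (forall z, sqn z = 1 -> bdd2 (mvpoly_eval Cf z) c) ->
  \sum_j frob2 (\sum_k Cf k *m b (j + inZp k)) <= c * \sum_j frob2 (b j).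
Proof.
move=> Cc; have [w wp] := exists_primitive_root (ltn0Sn K).
have wK := prim_expr_order wp; have w1 := sqn_unity_root (ltn0Sn K) wK.
have w0 : w != 0 by rewrite -sqn_eq0 w1 oner_eq0.
rewrite -(ler_pM2l (_ : 0 < K.+1%:R)) ?ltr0n // mulrCA -!(parseval_frob2 _ _ wp) //.
rewrite mulr_sumr; apply: ler_sum => l _.
set bh := \sum_(j < K.+1) w ^+ (l * j) *: b j.
suff -> : \sum_(j < K.+1) w ^+ (l * j) *: \sum_k Cf k *m b (j + inZp k) =
    mvpoly_eval Cf (w ^- l) *m bh.
  apply: bdd2_mul; apply: Cc; rewrite sqnV sqnX w1 expr1n; exact: invr1.
under eq_bigr => j _ do rewrite scaler_sumr.
rewrite exchange_big /mvpoly_eval mulmx_suml; apply: eq_bigr => k _ /=.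
rewrite -scalemxAl scalemxAr /bh; under eq_bigr => j _ do rewrite scalemxAr.
rewrite -mulmx_sumr; congr (_ *m _).
rewrite scaler_sumr [RHS](reindex_inj (addIr (inZp k : 'I_K.+1))) /=.
apply: eq_bigr => j _; rewrite scalerA; congr (_ *: _).
have wmod a : w ^+ (a %% K.+1)%N = w ^+ a by rewrite (prim_expr_mod wp).
have -> : w ^+ (l * (j + inZp k)%R) = w ^+ (l * k) * w ^+ (l * j).
  rewrite -exprD -[LHS]wmod -[RHS]wmod /= modnMmr -modnMmr modnDmr modnMmr.
  by rewrite mulnDr addnC.
by rewrite exprVn -exprM mulrA mulVf ?mul1r ?expf_neq0.
Qed.

End VonNeumann.

(** * Von Neumann's inequality for contractions, in tensor form *)

Section SpectralBound.
Variable R : realType.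
Local Notation C := R[i].

Definition papp m n N d (Cf : 'I_N.+1 -> 'M[C]_(m, n)) (X : 'M[C]_(n, d.+1))
  (M : 'M[C]_d.+1) := \sum_k Cf k *m X *m (M ^+ k)^T.

(* Identifying a tensor in C^n (x) C^d with an n x d matrix X, the operator
   \sum_k C_k (x) M^k becomes [papp C ^~ M].  The constants are squares of
   operator norms. *)
Definition specb d (Om : set C) (M : 'M[C]_d.+1) (K : R) :=
  forall m n N (Cf : 'I_N.+1 -> 'M[C]_(m, n)) c, 0 <= c ->
    (forall z, Om z -> bdd2 (mvpoly_eval Cf z) c) ->
    forall X : 'M[C]_(n, d.+1), frob2 (papp Cf X M) <= K * c * frob2 X.

Lemma exists_expr_lt (s e : R) : 0 <= s < 1 -> 0 < e -> exists n, s ^+ n < e.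
Proof.
move=> /andP[]; rewrite le_eqVlt => /predU1P[<-|s0] s1 e0.
  by exists 1%N; rewrite expr1.
have h0 : 0 < s^-1 - 1 by rewrite subr_gt0 invf_gt1.
have [n hn] : exists n, e^-1 < (1 + (s^-1 - 1)) ^+ n.
  have bern n : 1 + n%:R * (s^-1 - 1) <= (1 + (s^-1 - 1)) ^+ n.
    elim: n => [|n IH]; first by rewrite mul0r addr0 expr0.
    rewrite exprS; apply: le_trans (ler_wpM2l _ IH); last by lra.
    have : 0 <= n%:R * (s^-1 - 1) * (s^-1 - 1).
      by rewrite mulr_ge0 ?mulr_ge0 ?ler0n ?ltW.
    by rewrite -natr1; set x := n%:R; nra.
  have ep : 0 <= e^-1 / (s^-1 - 1) by rewrite divr_ge0 ?invr_ge0 ?ltW.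
  exists (Num.bound (e^-1 / (s^-1 - 1))).
  apply: lt_le_trans (bern _).
  have := archi_boundP ep; rewrite ltr_pdivrMr // => h.
  by apply: lt_trans h _; rewrite ltrDr.
exists n; rewrite -ltf_pV2 ?posrE ?exprn_gt0 // -exprVn.
by move: hn; rewrite addrC subrK.
Qed.

Lemma frob2_lincomb m n K (a : 'I_K -> C) (Y : 'I_K -> 'M[C]_(m, n)) :
  frob2 (\sum_k a k *: Y k) <= (\sum_k sqn (a k)) * \sum_k frob2 (Y k).
Proof.
rewrite /frob2 [X in _ * X]exchange_big mulr_sumr; apply: ler_sum => i _ /=.
rewrite [X in _ * X]exchange_big mulr_sumr; apply: ler_sum => j _ /=.
rewrite summxE; under [X in sqn X]eq_bigr do rewrite mxE.
exact: cauchy_schwarz.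
Qed.

Lemma bdd2Z m n (A : 'M[C]_(m, n)) a c : bdd2 A c -> bdd2 (a *: A) (sqn a * c).
Proof.
by move=> Ac x; rewrite -scalemxAl frob2Z -mulrA ler_wpM2l ?sqn_ge0.
Qed.

Lemma bdd2W m n (A : 'M[C]_(m, n)) c c' : bdd2 A c -> c <= c' -> bdd2 A c'.
Proof. by move=> Ac cc' x; apply: le_trans (Ac x) _; rewrite ler_wpM2r ?frob2_ge0. Qed.

Section StrictContraction.
Variables (d : nat) (M : 'M[C]_d.+1) (s : R).
Hypothesis s01 : 0 <= s < 1.
Hypothesis Ms : bdd2 M (s ^+ 2).

Lemma frob2_exp_le p (Y : 'M[C]_(p, d.+1)) n :
  frob2 (Y *m (M ^+ n)^T) <= s ^+ 2 ^+ n * frob2 Y.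
Proof.
elim: n Y => [|n IH] Y; first by rewrite expr0 trmx1 mulmx1 mul1r.
rewrite exprSr trmx_mul mulmxA; apply: le_trans (IH _) _.
rewrite (exprSr (s ^+ 2)) -mulrA; apply: ler_wpM2l; last exact: bdd2_mulr.
by rewrite exprn_ge0 ?sqr_ge0.
Qed.

(** A dilation cut to finite length: the defect operator embeds [X] as the sequence [X (M^j)^T D],
    whose squared norms telescope, and on such sequences powers of [M] act as shifts. A finite block
    is treated as periodic, so that [cyclic_convolution] applies. *)
Lemma von_neumann_strict m n N (Cf : 'I_N.+1 -> 'M[C]_(m, n)) c (X : 'M[C]_(n, d.+1)) :
  0 <= c -> (forall z, sqn z = 1 -> bdd2 (mvpoly_eval Cf z) c) ->
  frob2 (papp Cf X M) <= c * frob2 X.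
Proof.
move=> c0 Cc.
have M1 : bdd2 M^T^T 1.
  rewrite trmxK; apply: bdd2W Ms _.
  by case/andP: s01 => s0 s1; rewrite expr_le1 ?(ltW s1).
have [D DE] := psd_factor M1.
have telescope p (Y : 'M[C]_(p, d.+1)) L :
    \sum_(j < L) frob2 (Y *m (M ^+ j)^T *m D) = frob2 Y - frob2 (Y *m (M ^+ L)^T).
  elim: L => [|L IH]; first by rewrite big_ord0 trmx1 mulmx1 subrr.
  by rewrite big_ord_recr /= IH DE exprS trmx_mul mulmxA addrA subrK.
set w := papp Cf X M.
have main L : frob2 w - frob2 (w *m (M ^+ L)^T) <= c * frob2 X.
  rewrite -telescope.
  (* For [j < L] and [k <= N] the index [j + k] stays below the period [L + N + 1], so the first [L]
     terms of the cyclic convolution see no wrap-around; the other terms are only dropped. *)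
  pose b (j : 'I_(L + N).+1) := X *m (M ^+ j)^T *m D.
  apply: le_trans (_ : c * \sum_j frob2 (b j) <= _); last first.
    by rewrite ler_wpM2l // /b telescope lerBlDr lerDl frob2_ge0.
  apply: le_trans (cyclic_convolution b Cc).
  rewrite (big_ord_widen (L + N).+1 (fun j => frob2 (w *m (M ^+ j)^T *m D))); last first.
    by rewrite leqW // leq_addr.
  rewrite [leRHS](bigID (fun j : 'I_(L + N).+1 => (j < L)%N)) /= -[leLHS]addr0.
  apply: lerD; last by apply: sumr_ge0 => j _; apply: frob2_ge0.
  apply: ler_sum => j jL; rewrite le_eqVlt; apply/orP; left; apply/eqP.
  congr frob2; rewrite /w /papp !mulmx_suml; apply: eq_bigr => k _.
  rewrite /b -!mulmxA; congr (_ *m (_ *m _)); rewrite mulmxA; congr (_ *m _).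
  rewrite -trmx_mul; congr (_^T).
  change (M ^+ j * M ^+ k = M ^+ (j + inZp k)%R); rewrite -exprD; congr (_ ^+ _).
  have kN := ltn_ord k.
  by rewrite /= (@modn_small k) ?modn_small //; lia.
(* The remaining tail [w (M^L)^T] tends to 0 because [s < 1]. *)
apply/ler_addgt0Pr => e e0.
have := frob2_ge0 w; rewrite le_eqVlt => /predU1P[<-|w0].
  by rewrite addr_ge0 ?mulr_ge0 ?frob2_ge0 // ltW.
have s2 : 0 <= s ^+ 2 < 1 by case/andP: s01 => s0 s1; rewrite sqr_ge0 expr_lt1.
have [L hL] := exists_expr_lt s2 (divr_gt0 e0 w0).
have := main L; rewrite lerBlDr => /le_trans; apply; rewrite lerD2l.
apply: le_trans (frob2_exp_le _ _) _; rewrite -ler_pdivlMr //.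
exact: ltW.
Qed.

End StrictContraction.

(** Limit of the strict case for [s M] as [s] tends to 1. By [frob2D_le] with parameter [1 - s] and
    [1 - s^k <= k (1 - s)], the error is [1 - s] times a quantity bounded independently of [s]. *)
Lemma von_neumann d (M : 'M[C]_d.+1) :
  bdd2 M 1 -> specb [set z | sqn z = 1] M 1.
Proof.
move=> M1 m n N Cf c c0 Cc X; rewrite mul1r.
pose V := \sum_k frob2 (Cf k *m X *m (M ^+ k)^T).
have V0 : 0 <= V by apply: sumr_ge0 => k _; apply: frob2_ge0.
have est s : 0 < s -> s < 1 ->
    frob2 (papp Cf X M) <= (1 + (1 - s)) * (c * frob2 X) +
      (1 - s) * (2 * (N%:R ^+ 2 * N.+1%:R * V)).
  move=> s0 s1.
  have strict := @von_neumann_strict d (s%:C *: M) s _ _ m n N Cf c X c0 Cc.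
  have {strict} h : frob2 (papp Cf X (s%:C *: M)) <= c * frob2 X.
    apply: strict; first by rewrite ltW.
    by have := bdd2Z s%:C M1; rewrite sqn_real mulr1.
  rewrite -[papp Cf X M](subrK (papp Cf X (s%:C *: M))) addrC.
  apply: le_trans (frob2D_le _ _ (_ : 0 < 1 - s)) _; first by rewrite subr_gt0.
  apply: lerD; first by rewrite ler_wpM2l //; lra.
  have -> : papp Cf X M - papp Cf X (s%:C *: M) =
      \sum_(k < N.+1) (1 - s ^+ k)%:C *: (Cf k *m X *m (M ^+ k)^T).
    rewrite /papp -sumrB; apply: eq_bigr => k _.
    rewrite exprZn linearZ /= -scalemxAr realCB realCX scalerBl scale1r.
    by [].
  have hk : \sum_(k < N.+1) sqn (1 - s ^+ k)%:C <= N.+1%:R * (N%:R * (1 - s)) ^+ 2.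
    rewrite -[N.+1 in leRHS]card_ord mulr_natl -sumr_const; apply: ler_sum => k _.
    rewrite sqn_real; have sk1 : s ^+ k <= 1 by rewrite exprn_ile1 // ltW.
    rewrite ler_sqr ?nnegrE ?subr_ge0 //; last first.
      by rewrite mulr_ge0 ?ler0n // subr_ge0 ltW.
    apply: le_trans (_ : k%:R * (1 - s) <= _); last first.
      by rewrite ler_wpM2r ?ler_nat ?subr_ge0 ?ltW // -ltnS.
    elim: (nat_of_ord k) => [|j IH]; first by rewrite expr0 subrr mul0r.
    rewrite exprS -natr1 mulrDl mul1r.
    have : (1 - s) * s ^+ j <= 1 - s.
      by rewrite ler_piMr ?subr_ge0 ?exprn_ile1 // ltW.
    by move: IH; set a := s ^+ j; set x := j%:R; nra.
  apply: le_trans (ler_wpM2l _ (frob2_lincomb _ _)) _.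
    by rewrite addr_ge0 // invr_ge0 subr_ge0 ltW.
  rewrite -/V; apply: le_trans (_ : (1 + (1 - s)^-1) *
      (N.+1%:R * (N%:R * (1 - s)) ^+ 2 * V) <= _).
    apply: ler_wpM2l; last exact: ler_wpM2r.
    by rewrite addr_ge0 // invr_ge0 subr_ge0 ltW.
  have -> : (1 + (1 - s)^-1) * (N.+1%:R * (N%:R * (1 - s)) ^+ 2 * V) =
     (1 - s) * ((2 - s) * (N%:R ^+ 2 * N.+1%:R * V)) by field; lra.
  apply: ler_wpM2l; first by rewrite subr_ge0 ltW.
  apply: ler_wpM2r; last by lra.
  by rewrite mulr_ge0 // mulr_ge0 ?sqr_ge0 ?ler0n.
set W := c * frob2 X + 2 * (N%:R ^+ 2 * N.+1%:R * V).
have W0 : 0 <= W.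
  by rewrite addr_ge0 // mulr_ge0 ?frob2_ge0 // mulr_ge0 // mulr_ge0 ?sqr_ge0 ?ler0n.
apply/ler_addgt0Pr => e e0.
pose h := Num.min (1 / 2) (e / (W + 1)).
have W1 : 0 < W + 1 by lra.
have h0 : 0 < h by rewrite lt_min divr_gt0 // divr_gt0.
have h1 : h <= 1 / 2 by rewrite ge_min lexx.
have h2 : h * W <= e.
  have : h <= e / (W + 1) by rewrite ge_min lexx orbT.
  rewrite ler_pdivlMr // => hh.
  by apply: le_trans hh; rewrite ler_wpM2l //; lra.
apply: le_trans (est (1 - h) _ _) _; [lra|lra|].
have -> : 1 - (1 - h) = h by ring.
by move: h2; rewrite /W; set a := c * _; set b := 2 * _; lra.
Qed.

End SpectralBound.

(** * Composition, similarity and affine changes of variable *)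

Section Transfer.
Variable R : realType.
Local Notation C := R[i].

Lemma horner_mx_coef_wide d (T : 'M[C]_d.+1) (p : {poly C}) n : (size p <= n)%N ->
  horner_mx T p = \sum_(i < n) p`_i *: T ^+ i.
Proof.
move=> pn.
have -> : p = \sum_(i < n) p`_i *: 'X^i.
  rewrite -poly_def; apply/polyP => i; rewrite coef_poly.
  by case: ltnP => // /(leq_trans pn) ?; rewrite nth_default.
rewrite linear_sum /=; apply: eq_bigr => i _.
rewrite linearZ /= rmorphXn /= horner_mx_X; congr (_ *: _).
rewrite -poly_def coef_poly; case: i => i /= -> //.
Qed.

(** The composite of a matrix polynomial with [t] is again a matrix polynomial; its coefficients
    [Cf'] collect those of the powers of [t], all padded to the common length [L + 1]. *)
Lemma specb_comp d (Om Om' : set C) (T : 'M[C]_d.+1) (t : {poly C}) K :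
  specb Om T K -> (forall z, Om z -> Om' t.[z]) -> specb Om' (horner_mx T t) K.
Proof.
move=> spT tO m n N Cf c c0 Cc X.
pose L := (\max_(k < N.+1) size (t ^+ k))%N.
have tL (k : 'I_N.+1) : (size (t ^+ k) <= L.+1)%N by rewrite leqW // leq_bigmax.
pose Cf' (l : 'I_L.+1) := \sum_(k < N.+1) (t ^+ k)`_l *: Cf k.
have -> : papp Cf X (horner_mx T t) = papp Cf' X T.
  rewrite /papp; under [RHS]eq_bigr => l _ do rewrite !mulmx_suml.
  rewrite exchange_big; apply: eq_bigr => k _ /=.
  rewrite -rmorphXn /= (horner_mx_coef_wide T (tL k)) linear_sum mulmx_sumr.
  by apply: eq_bigr => l _; rewrite linearZ /= -scalemxAr -!scalemxAl.
apply: spT => // z /tO Oz; have := Cc _ Oz.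
suff -> : mvpoly_eval Cf t.[z] = mvpoly_eval Cf' z by [].
rewrite /mvpoly_eval; under [RHS]eq_bigr => l _ do rewrite scaler_sumr.
rewrite exchange_big; apply: eq_bigr => k _ /=.
rewrite -horner_exp (horner_coef_wide z (tL k)) scaler_suml.
by apply: eq_bigr => l _; rewrite scalerA mulrC.
Qed.

Lemma specb_sub d (Om Om' : set C) (T : 'M[C]_d.+1) K :
  specb Om T K -> (forall z, Om z -> Om' z) -> specb Om' T K.
Proof. by move=> spT OO m n N Cf c c0 Cc X; apply: spT => // z /OO /Cc. Qed.

(** The similarity pulls out of every power, so it acts on tensors by [Q^T] before and [P^T] after.
    As [p] and [q] are squared norms, a condition number 2 costs the factor 4. *)
Lemma specb_sim d Om (T P Q : 'M[C]_d.+1) K p q : 0 <= p -> 0 <= K ->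
  Q *m P = 1%:M -> bdd2 P p -> bdd2 Q q -> specb Om T K ->
  specb Om (P *m T *m Q) (p * K * q).
Proof.
move=> p0 K0 QP Pp Qq spT m n N Cf c c0 Cc X.
have Me k : (P *m T *m Q) ^+ k *m P = P *m T ^+ k.
  elim: k => [|k IH]; first by rewrite !expr0 mul1mx mulmx1.
  rewrite (_ : (P *m T *m Q) ^+ k.+1 = P *m T *m Q *m (P *m T *m Q) ^+ k) ?exprS //.
  rewrite -mulmxA IH mulmxA -(mulmxA _ Q) QP mulmx1 -mulmxA.
  by congr (_ *m _); rewrite exprS.
have PQ : P *m Q = 1%:M by apply: mulmx1C.
have -> : papp Cf X (P *m T *m Q) = papp Cf (X *m Q^T) T *m P^T.
  rewrite /papp mulmx_suml; apply: eq_bigr => k _.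
  have -> : (P *m T *m Q) ^+ k = P *m T ^+ k *m Q by rewrite -Me -[RHS]mulmxA PQ mulmx1.
  by rewrite !trmx_mul !mulmxA.
apply: le_trans (bdd2_mulr _ Pp) _; rewrite -!mulrA ler_wpM2l //.
apply: le_trans (spT _ _ _ _ _ c0 Cc _) _; rewrite -mulrA ler_wpM2l //.
by rewrite mulrCA ler_wpM2l // bdd2_mulr.
Qed.

Lemma frob2_isometry m n p (U : 'M[C]_(m, n)) (X : 'M[C]_(n, p)) :
  adjointmx U *m U = 1%:M -> frob2 (U *m X) = frob2 X.
Proof.
move=> UU; apply: complexI; rewrite -!trace_frob2 -(mxtrace_mulC (adjointmx _)).
by rewrite adjointmxM -mulmxA (mulmxA _ U) UU mul1mx mxtrace_mulC.
Qed.

Lemma specb_unitary d Om (T U : 'M[C]_d.+1) K : 0 <= K ->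
  adjointmx U *m U = 1%:M -> specb Om T K ->
  specb Om (U *m T *m adjointmx U) K.
Proof.
move=> K0 UU spT.
have b V : adjointmx V *m V = 1%:M -> bdd2 (V : 'M[C]_d.+1) 1.
  by move=> VV x; rewrite frob2_isometry // mul1r.
have := specb_sim ler01 K0 UU (b _ UU) (b (adjointmx U) _) spT.
by rewrite mul1r mulr1; apply; rewrite adjointmxK mulmx1C.
Qed.

Lemma specb_affine d (Om Om' : set C) (T : 'M[C]_d.+1) a s K :
  specb Om T K -> (forall z, Om z -> Om' (a + s * z)) ->
  specb Om' (a%:M + s *: T) K.
Proof.
move=> spT OO.
have -> : a%:M + s *: T = horner_mx T (a%:P + s *: 'X).
  by rewrite linearD /= horner_mx_C linearZ /= horner_mx_X.
by apply: specb_comp spT _ => z /OO; rewrite !hornerE.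
Qed.

Lemma numerical_range_unitary d (T U : 'M[C]_d.+1) :
  adjointmx U *m U = 1%:M ->
  (numerical_range T `<=` numerical_range (U *m T *m adjointmx U))%classic.
Proof.
move=> UU z [x /= x1 <-]; exists (U *m x) => /=.
  by rewrite adjointmxM -mulmxA (mulmxA _ U) UU mul1mx.
rewrite adjointmxM !mulmxA -(mulmxA (adjointmx x)) UU mulmx1.
by rewrite -!mulmxA (mulmxA _ U) UU mul1mx.
Qed.

Lemma numerical_range_affine d (T : 'M[C]_d.+1) a s z :
  numerical_range T z -> numerical_range (a%:M + s *: T) (a + s * z).
Proof.
move=> [x /= x1 <-]; exists x => //=.
have -> : adjointmx x *m (a%:M + s *: T) *m x =
    a *: (adjointmx x *m x) + s *: (adjointmx x *m T *m x).
  by rewrite mulmxDr mulmxDl mul_mx_scalar -scalemxAr -!scalemxAl.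
by rewrite mxE [X in X + _]mxE [X in _ + X]mxE x1 mulr1.
Qed.

End Transfer.

(** * From the tensor form to operator norms *)

Section OperatorNorm.
Variable R : realType.
Local Notation C := R[i].

Lemma norm2_le n (x : 'cV[C]_n) (c : R) : 0 <= c -> (norm2 x <= c) = (frob2 x <= c ^+ 2).
Proof. by move=> c0; rewrite -norm2_sqr ler_sqr // nnegrE norm2_ge0. Qed.

Lemma opnorm2_has_sup m n (A : 'M[C]_(m, n)) :
  has_sup [set norm2 (A *m x) | x in [set x : 'cV[C]_n | norm2 x <= 1]]%classic.
Proof.
split.
  exists (norm2 (A *m 0)); exists 0 => //=.
  by rewrite norm2_le // frob2_0 expr1n ler01.
exists (Num.sqrt (frob2 A)) => _ [x /= x1 <-].
rewrite norm2_le ?sqrtr_ge0 // sqr_sqrtr ?frob2_ge0 //.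
apply: le_trans (bdd2_frob2 _ _) _; rewrite ler_piMr ?frob2_ge0 //.
by move: x1; rewrite norm2_le // expr1n.
Qed.

Lemma opnorm2_ub m n (A : 'M[C]_(m, n)) x : norm2 x <= 1 -> norm2 (A *m x) <= opnorm2 A.
Proof.
move=> x1; apply: sup_upper_bound; first exact: opnorm2_has_sup.
by exists x.
Qed.

Lemma opnorm2_ge0 m n (A : 'M[C]_(m, n)) : 0 <= opnorm2 A.
Proof.
apply: le_trans (norm2_ge0 (A *m 0)) (opnorm2_ub _ _).
by rewrite norm2_le // frob2_0 expr1n ler01.
Qed.

Lemma opnorm2_le m n (A : 'M[C]_(m, n)) (c : R) :
  (forall x, norm2 x <= 1 -> norm2 (A *m x) <= c) -> opnorm2 A <= c.
Proof.
move=> Ac; apply: ge_sup; first by case: (opnorm2_has_sup A).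
by move=> _ [x /= x1 <-]; apply: Ac.
Qed.

Lemma bdd2_opnorm2 m n (A : 'M[C]_(m, n)) : bdd2 A (opnorm2 A ^+ 2).
Proof.
move=> x; have := norm2_ge0 x; rewrite le_eqVlt => /predU1P[x0|x0].
  have -> : x = 0 by apply: frob2_eq0; rewrite -norm2_sqr -x0 expr0n.
  by rewrite mulmx0 !frob2_0 mulr0.
have u1 : norm2 ((norm2 x)^-1%:C *: x) <= 1.
  rewrite norm2_le // frob2Z sqn_real -norm2_sqr -exprMn mulVf ?gt_eqF //.
have := opnorm2_ub A u1.
rewrite -scalemxAr norm2_le ?opnorm2_ge0 // frob2Z sqn_real.
by rewrite exprVn norm2_sqr mulrC ler_pdivrMr // -norm2_sqr exprn_gt0.
Qed.

Lemma big_mxtens (V : nmodType) k l (F : 'I_(k * l) -> V) :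
  \sum_i F i = \sum_i \sum_j F (mxtens_index (i, j)).
Proof.
rewrite pair_bigA (reindex (@mxtens_index k l)) /=; first by apply: eq_bigr => -[].
by exists (@mxtens_unindex k l) => ? _; rewrite ?mxtens_indexK ?mxtens_unindexK.
Qed.

Lemma mvpoly_evalmx_papp m n N d (Cf : 'I_N.+1 -> 'M[C]_(m, n)) (M : 'M[C]_d.+1)
    (x : 'cV[C]_(n * d.+1)) :
  frob2 (mvpoly_evalmx Cf M *m x) =
  frob2 (papp Cf (\matrix_(i, j) x (mxtens_index (i, j)) 0) M).
Proof.
rewrite /frob2 big_mxtens; apply: eq_bigr => i _; apply: eq_bigr => j _.
rewrite big_ord1; congr sqn.
rewrite /mvpoly_evalmx /papp mulmx_suml !summxE; apply: eq_bigr => k _.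
rewrite mxE big_mxtens -mulmxA mxE; apply: eq_bigr => p _.
rewrite mxE mulr_sumr; apply: eq_bigr => q _.
by rewrite tensmxE !mxE -mulrA [X in _ * X]mulrC.
Qed.

Lemma opnorm2_evalmx_le m n N d (Cf : 'I_N.+1 -> 'M[C]_(m, n)) (M : 'M[C]_d.+1) mu :
  0 <= mu -> specb (numerical_range M) M 4 ->
  (forall z, numerical_range M z -> opnorm2 (mvpoly_eval Cf z) <= mu) ->
  opnorm2 (mvpoly_evalmx Cf M) <= 2 * mu.
Proof.
move=> mu0 spM bnd; apply: opnorm2_le => x; rewrite !norm2_le ?mulr_ge0 //.
rewrite expr1n => x1; rewrite mvpoly_evalmx_papp.
set X := \matrix_(_, _) _.
have Xx : frob2 X = frob2 x.
  rewrite /frob2 [RHS]big_mxtens; apply: eq_bigr => i _; apply: eq_bigr => j _.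
  by rewrite big_ord1 mxE.
apply: le_trans (spM _ _ _ _ (mu ^+ 2) _ _ X) _; first exact: sqr_ge0.
  move=> z /bnd h; apply: bdd2W (bdd2_opnorm2 _) _.
  by rewrite ler_sqr // nnegrE // opnorm2_ge0.
rewrite Xx exprMn -natrX ler_piMr // mulr_ge0 ?sqr_ge0 //.
Qed.

End OperatorNorm.

(** * Attainment of the maximum over the numerical range *)

Section MaximumExists.
Variable R : realType.
Local Notation C := R[i].

Section ComplexContinuity.
Variable T : topologicalType.
Implicit Types f g : T -> C.

Definition ccont f :=
  continuous (fun v => complex.Re (f v)) /\ continuous (fun v => complex.Im (f v)).

Definition mcont m n (A : T -> 'M[C]_(m, n)) := forall i j, ccont (fun v => A v i j).

Lemma ccont_cst c : ccont (fun=> c).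
Proof. by split; apply: cst_continuous. Qed.

Lemma ccontD f g : ccont f -> ccont g -> ccont (fun v => f v + g v).
Proof.
move=> [f1 f2] [g1 g2]; split.
  have -> : (fun v => complex.Re (f v + g v)) =
      (fun v => complex.Re (f v)) + (fun v => complex.Re (g v)).
    by apply: boolp.funext => u /=; rewrite fctE; case: (f u); case: (g u).
  by move=> v; apply: cvgD; (apply: f1 || apply: f2 || apply: g1 || apply: g2).
have -> : (fun v => complex.Im (f v + g v)) =
    (fun v => complex.Im (f v)) + (fun v => complex.Im (g v)).
  by apply: boolp.funext => u /=; rewrite fctE; case: (f u); case: (g u).
by move=> v; apply: cvgD; (apply: f1 || apply: f2 || apply: g1 || apply: g2).
Qed.

Lemma ccontM f g : ccont f -> ccont g -> ccont (fun v => f v * g v).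
Proof.
move=> [f1 f2] [g1 g2]; split.
  have -> : (fun v => complex.Re (f v * g v)) =
      (fun v => complex.Re (f v)) * (fun v => complex.Re (g v)) -
      (fun v => complex.Im (f v)) * (fun v => complex.Im (g v)).
    by apply: boolp.funext => u /=; rewrite !fctE; case: (f u); case: (g u).
  by move=> v; apply: cvgB; apply: cvgM; (apply: f1 || apply: f2 || apply: g1 || apply: g2).
have -> : (fun v => complex.Im (f v * g v)) =
    (fun v => complex.Re (f v)) * (fun v => complex.Im (g v)) +
    (fun v => complex.Im (f v)) * (fun v => complex.Re (g v)).
  by apply: boolp.funext => u /=; rewrite !fctE; case: (f u); case: (g u).
by move=> v; apply: cvgD; apply: cvgM; (apply: f1 || apply: f2 || apply: g1 || apply: g2).
Qed.

Lemma ccont_conj f : ccont f -> ccont (fun v => conjc (f v)).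
Proof.
move=> [f1 f2]; split.
  have -> // : (fun v => complex.Re (conjc (f v))) = (fun v => complex.Re (f v)).
  by apply: boolp.funext => u; case: (f u).
have -> : (fun v => complex.Im (conjc (f v))) = - (fun v => complex.Im (f v)).
  by apply: boolp.funext => u /=; rewrite fctE; case: (f u).
by move=> v; apply: cvgN; apply: f2.
Qed.

Lemma ccont_sum (I : Type) (r : seq I) (F : I -> T -> C) :
  (forall i, ccont (F i)) -> ccont (fun v => \sum_(i <- r) F i v).
Proof.
move=> Fc; elim: r => [|i r IH].
  by under [fun v => _]boolp.funext do rewrite big_nil; apply: ccont_cst.
by under [fun v => _]boolp.funext do rewrite big_cons; apply: ccontD.
Qed.

Lemma ccontX f n : ccont f -> ccont (fun v => f v ^+ n).
Proof.
move=> fc; elim: n => [|n IH].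
  by under [fun v => _]boolp.funext do rewrite expr0; apply: ccont_cst.
by under [fun v => _]boolp.funext do rewrite exprS; apply: ccontM.
Qed.

Lemma mcont_cst m n (A : 'M[C]_(m, n)) : mcont (fun=> A).
Proof. by move=> i j; apply: ccont_cst. Qed.

Lemma mcontM m n p (A : T -> 'M[C]_(m, n)) (B : T -> 'M[C]_(n, p)) :
  mcont A -> mcont B -> mcont (fun v => A v *m B v).
Proof.
move=> Ac Bc i j; under [fun v => _]boolp.funext do rewrite mxE.
by apply: ccont_sum => k; apply: ccontM.
Qed.

Lemma mcont_adj m n (A : T -> 'M[C]_(m, n)) : mcont A -> mcont (fun v => adjointmx (A v)).
Proof.
move=> Ac i j; under [fun v => _]boolp.funext do rewrite !mxE.
exact: ccont_conj.
Qed.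

Lemma mcont_eval m n N (Cf : 'I_N.+1 -> 'M[C]_(m, n)) f :
  ccont f -> mcont (fun v => mvpoly_eval Cf (f v)).
Proof.
move=> fc i j; under [fun v => _]boolp.funext do rewrite summxE.
apply: ccont_sum => k; under [fun v => _]boolp.funext do rewrite mxE.
by apply: ccontM; [apply: ccontX | apply: ccont_cst].
Qed.

Lemma continuous_frob2 m n (A : T -> 'M[C]_(m, n)) :
  mcont A -> continuous (fun v => frob2 (A v)).
Proof.
move=> Ac.
have [+ _] : ccont (fun v => \tr (A v *m adjointmx (A v))).
  by apply: ccont_sum => i; apply: mcontM => //; apply: mcont_adj.
by under [fun v => _]boolp.funext do rewrite trace_frob2 /=.
Qed.

End ComplexContinuity.

(** The squared norm of [p(x^* M x) y] is maximised jointly over unit vectors [x] and [y] in the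
    unit ball: one compactness argument in real coordinates handles the point of the range and the
    operator norm together. *)
Lemma max_opnorm2_exists m n N d (Cf : 'I_N.+1 -> 'M[C]_(m, n)) (M : 'M[C]_d.+1) :
  exists mu, is_max
    [set opnorm2 (mvpoly_eval Cf z) | z in numerical_range M]%classic mu.
Proof.
pose T : topologicalType := 'rV[R]_((d.+1 + d.+1) + (n + n)).
pose x (v : T) : 'cV[C]_d.+1 :=
  \col_i Complex (v 0 (lshift _ (lshift _ i))) (v 0 (lshift _ (rshift _ i))).
pose y (v : T) : 'cV[C]_n :=
  \col_i Complex (v 0 (rshift _ (lshift _ i))) (v 0 (rshift _ (rshift _ i))).
have xc : mcont x.
  move=> i j; under [fun v => _]boolp.funext do rewrite mxE.
  by split=> /=; apply: coord_continuous.
have yc : mcont y.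
  move=> i j; under [fun v => _]boolp.funext do rewrite mxE.
  by split=> /=; apply: coord_continuous.
pose z v := (adjointmx (x v) *m M *m x v) 0 0.
pose F v := frob2 (mvpoly_eval Cf (z v) *m y v).
have Fc : continuous F.
  apply: continuous_frob2; apply: mcontM => //; apply: mcont_eval.
  by apply: mcontM => //; apply: mcontM; [apply: mcont_adj | apply: mcont_cst].
have surj (a : 'cV[C]_d.+1) (b : 'cV[C]_n) : exists v, x v = a /\ y v = b.
  exists (row_mx (row_mx (\row_i complex.Re (a i 0)) (\row_i complex.Im (a i 0)))
                 (row_mx (\row_i complex.Re (b i 0)) (\row_i complex.Im (b i 0)))).
  split; apply/colP => i; rewrite mxE ?row_mxEl ?row_mxEr ?row_mxEl ?row_mxEr !mxE.
    by case: (a i 0).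
  by case: (b i 0).
pose K : set T := [set v | frob2 (x v) = 1 /\ frob2 (y v) <= 1]%classic.
have K0 : (K !=set0)%classic.
  have [v [xv yv]] := surj (delta_mx 0 0) 0; exists v; rewrite /K /= xv yv frob2_0.
  split; last exact: ler01.
  rewrite /frob2 (bigD1 0) //= big_ord1 mxE sqn1 big1 ?addr0 // => i i0.
  by rewrite big_ord1 mxE (negbTE i0) sqn0.
have Kcl : closed K.
  have -> : K = ((fun v => frob2 (x v)) @^-1` [set t : R | t = 1] `&`
                 (fun v => frob2 (y v)) @^-1` [set t : R | t <= 1])%classic by [].
  apply: closedI; apply: preimage_closed.
  - by move=> v _; apply: continuous_frob2.
  - exact: closed_eq.
  - by move=> v _; apply: continuous_frob2.
  - exact: closed_le.
have Kc : compact K.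
  have box := @rV_compact R ((d.+1 + d.+1) + (n + n))
    (fun=> `[(-1 : R), 1]%classic) (fun=> @segment_compact _ _ _).
  apply: subclosed_compact Kcl box _ => v [xv yv] i.
  have bnd (t u w : R) : t ^+ 2 + u ^+ 2 <= w -> w <= 1 ->
      (t \in `[(-1 : R), 1]) * (u \in `[(-1 : R), 1]).
    by move=> h1 h2; rewrite !in_itv /=; split; apply/andP; split; nra.
  have entry k (a : 'cV[C]_k) j : sqn (a j 0) <= frob2 a.
    rewrite /frob2 (bigD1 j) //= big_ord1 lerDl; apply: sumr_ge0 => l _.
    by rewrite big_ord1 sqn_ge0.
  have x1 : frob2 (x v) <= 1 by rewrite xv.
  case: (split_ordP i) => j ->.
    have := entry _ (x v); case: (split_ordP j) => k -> /(_ k);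
      by rewrite mxE /sqn /= => /bnd/(_ x1) [].
  have := entry _ (y v); case: (split_ordP j) => k -> /(_ k);
    by rewrite mxE /sqn /= => /bnd/(_ yv) [].
have Fw : ({within K, continuous F})%classic by apply: continuous_subspaceT.
have [v0] := EVT_max_rV K0 Kc Fw; rewrite inE => -[xv0 yv0] max0.
have Wz v : frob2 (x v) = 1 -> numerical_range M (z v).
  by move=> xv; exists (x v) => //=; rewrite frob2_dot xv.
have ub w : numerical_range M w -> opnorm2 (mvpoly_eval Cf w) <= Num.sqrt (F v0).
  move=> [a /= a1 <-]; apply: opnorm2_le => b b1.
  rewrite norm2_le ?sqrtr_ge0 // sqr_sqrtr ?frob2_ge0 //.
  have [v [xv yv]] := surj a b.
  have := max0 v; rewrite /F /z xv yv; apply; rewrite inE; split; rewrite ?xv ?yv.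
    by apply: complexI; rewrite -frob2_dot a1.
  by move: b1; rewrite norm2_le // expr1n.
exists (opnorm2 (mvpoly_eval Cf (z v0))); split; first by exists (z v0) => //; apply: Wz.
move=> _ [w /= /ub h <-]; apply: le_trans h _.
rewrite -[leRHS]ger0_norm ?opnorm2_ge0 // -sqrtr_sqr ler_sqrt ?sqr_ge0 //.
apply: le_trans (bdd2_opnorm2 _ _) _.
by rewrite ler_piMr ?sqr_ge0.
Qed.

Lemma mvpoly_bound2_specb d (M : 'M[C]_d.+1) :
  specb (numerical_range M) M 4 -> mvpoly_bound2 M.
Proof.
move=> spM m n N Cf m0 n0.
have [mu [[z Wz muz] ub]] := max_opnorm2_exists Cf M.
exists mu; split; first by split=> //; exists z.
apply: opnorm2_evalmx_le => // [|w Ww]; first by rewrite -muz opnorm2_ge0.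
by apply: ub; exists w.
Qed.

End MaximumExists.

(** * The polynomial mapping the circle into an ellipse *)

Section QuinticInequality.
(** With [be] on the unit circle, [x] its real part and W = 1 + s be + s^2 be^2, the left side is (1
    + s^2) |W|^2 - 2 s Re(be W^2), written in Chebyshev polynomials of [x]. The right side has one
    factor 1 - s^2 more than membership in the ellipse demands; this factor is the margin exploited
    later. *)
Lemma quint_circle_ineq (R : realType) (s x : R) : 0 < s -> s <= 4^-1 -> -1 <= x -> x <= 1 ->
 (1 + s ^+ 2) * (1 + s ^+ 2 + s ^+ 4 + 2 * (s + s ^+ 3) * x + 2 * s ^+ 2 * (2 * x ^+ 2 - 1))
  - 2 * s * (x + 2 * s * (2 * x ^+ 2 - 1) + 3 * s ^+ 2 * (4 * x ^+ 3 - 3 * x)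
     + 2 * s ^+ 3 * (8 * x ^+ 4 - 8 * x ^+ 2 + 1)
     + s ^+ 4 * (16 * x ^+ 5 - 20 * x ^+ 3 + 5 * x))
  <= (1 - s ^+ 2) ^+ 3 * (1 + 4 * s ^+ 2 + 16 * s ^+ 4) ^+ 2.
Proof.
move=> s0 s1 x0 x1; rewrite -subr_ge0.
pose R1 := 1+4*x^+2-22*s*x+31*s^+2+24*s*x^+3-36*s^+2*x^+2.
pose R2 := 8*s^+3*(x*(1-x^+2)*(1-4*x^+2)).
pose R3 := 6*s^+4*(1 - 72 * s^+4) + 8*s^+6 + 128*s^+10*(5 - 2*s^+2).
set F := (X in 0 <= X).
(* [R1] holds the dominant terms and has room 1/4, enough to absorb the sign-changing cubic term
   [R2]; [R3] gathers the terms free of [x]. *)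
have -> : F = s^+2 * (R1 + 32*s^+2*x^+4 + R2 + R3) by rewrite /F /R1 /R2 /R3; ring.
have h1 : 4^-1 <= R1.
  rewrite /R1; case: (lerP 0 x) => hx; last first.
    have q1 : 0 <= s * (- x) * (1 - x ^+ 2) by rewrite !mulr_ge0 //; nra.
    have q2 : 0 <= (16^-1 - s ^+ 2) * x ^+ 2 by rewrite mulr_ge0 ?sqr_ge0 //; nra.
    have q3 : 0 <= s * (1 + x) by rewrite mulr_ge0 //; lra.
    have := sqr_ge0 s; have := sqr_ge0 x; lra.
  have q1 : 0 <= s * ((24 * x + 303 / 25) * (x - 11 / 25) ^+ 2).
    by rewrite mulr_ge0 ?(ltW s0) // mulr_ge0 ?sqr_ge0 //; lra.
  have q2 : 0 <= s * (4^-1 - s) * x ^+ 2 by rewrite mulr_ge0 ?sqr_ge0 // mulr_ge0 //; lra.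
  have q3 := sqr_ge0 (x - 2 * s); have q4 := sqr_ge0 (s - 12^-1).
  have q5 : 0 <= s * x by rewrite mulr_ge0 // ltW.
  lra.
have h2 : - 4^-1 <= R2.
  have a1 : `|x * (1 - x^+2)| <= 2^-1.
    (* 29/50 is close to 1/sqrt 3, where [x (1 - x^2)] is largest on [0, 1]; the cubic with this
       double root has no quadratic term. *)
    have q1 : 0 <= (x + 29 / 25) * (x - 29 / 50) ^+ 2 by rewrite mulr_ge0 ?sqr_ge0 //; lra.
    have q2 : 0 <= (29 / 25 - x) * (x + 29 / 50) ^+ 2 by rewrite mulr_ge0 ?sqr_ge0 //; lra.
    rewrite ler_norml; apply/andP; split; nra.
  have a2 : `|1 - 4 * x^+2| <= 3 by rewrite ler_norml; apply/andP; split; nra.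
  have a3 : `|x * (1 - x^+2) * (1 - 4*x^+2)| <= 2^-1 * 3 by rewrite normrM ler_pM.
  have s3 : s^+3 <= 64^-1.
    have -> : (64^-1 : R) = 4^-1 ^+3 by field.
    by rewrite lerXn2r ?nnegrE ?(ltW s0) //; lra.
  have s30 : 0 <= s^+3 by rewrite exprn_ge0 // ltW.
  by move: a3; rewrite ler_norml => /andP[a3 a4]; rewrite /R2; nra.
have h3 : 0 <= R3.
  have s2 : s^+2 <= 16^-1 by nra.
  have s4 : s^+4 <= 256^-1 by rewrite (exprM s 2 2); have := sqr_ge0 s; nra.
  have p n : 0 <= s ^+ n by rewrite exprn_ge0 // ltW.
  have q1 : 0 <= s ^+ 4 * (1 - 72 * s ^+ 4) by rewrite mulr_ge0 ?p //; lra.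
  have q2 : 0 <= s ^+ 10 * (5 - 2 * s ^+ 2) by rewrite mulr_ge0 ?p //; lra.
  have q3 := p 6%N; rewrite /R3; lra.
rewrite mulr_ge0 ?sqr_ge0 //.
have : 0 <= s ^+ 2 * x ^+ 4 by rewrite mulr_ge0 ?sqr_ge0 // exprn_even_ge0.
by lra.
Qed.

End QuinticInequality.

(** * Uniform approximation by real polynomials *)

Section Modulus.
Variable R : realType.
Local Notation C := R[i].
Local Notation nc := (@Normc.normc R).
Implicit Types (z w : C).

Lemma ncD z w : nc (z + w) <= nc z + nc w.
Proof. exact: le_normcD. Qed.
Lemma ncM z w : nc (z * w) = nc z * nc w.
Proof. exact: Normc.normcM. Qed.
Lemma ncN z : nc (- z) = nc z.
Proof. exact: normcN. Qed.
Lemma nc_ge0 z : 0 <= nc z.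
Proof. by rewrite normc_sqrt sqrtr_ge0. Qed.
Lemma ncV z : nc z^-1 = (nc z)^-1.
Proof. exact: Normc.normcV. Qed.
Lemma ncX z n : nc (z ^+ n) = nc z ^+ n.
Proof.
elim: n => [|n IH]; first by rewrite !expr0; exact: Normc.normc1.
by rewrite !exprS ncM IH.
Qed.
Lemma nc_real (x : R) : nc x%:C = `|x|.
Proof. by rewrite normc_sqrt sqn_real sqrtr_sqr. Qed.
Lemma nc_pos (x : R) : 0 <= x -> nc x%:C = x.
Proof. by move=> x0; rewrite nc_real ger0_norm. Qed.
Lemma nc0 : nc 0 = 0.
Proof. exact: Normc.normc0. Qed.
Lemma nc1 : nc 1 = 1.
Proof. exact: Normc.normc1. Qed.
Lemma ncB z w : nc (z - w) <= nc z + nc w.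
Proof. by apply: le_trans (ncD _ _) _; rewrite ncN. Qed.
Lemma nc_distC z w : nc (z - w) = nc (w - z).
Proof. by rewrite -ncN opprB. Qed.
Lemma sqn_nc1 z : sqn z = 1 -> nc z = 1.
Proof. by rewrite normc_sqrt => ->; rewrite sqrtr1. Qed.
Lemma nc_le z (c : R) : 0 <= c -> (nc z <= c) = (sqn z <= c ^+ 2).
Proof. by move=> c0; rewrite -normc_sqr ler_sqr // nnegrE nc_ge0. Qed.

Definition evc (p : {poly R}) (z : C) : C := (map_poly (real_complex R) p).[z].

Lemma evcD p q z : evc (p + q) z = evc p z + evc q z.
Proof. by rewrite /evc rmorphD hornerD. Qed.
Lemma evcB p q z : evc (p - q) z = evc p z - evc q z.
Proof. by rewrite /evc rmorphB hornerD hornerN. Qed.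
Lemma evcM p q z : evc (p * q) z = evc p z * evc q z.
Proof. by rewrite /evc rmorphM hornerM. Qed.
Lemma evcC (x : R) z : evc x%:P z = x%:C.
Proof. by rewrite /evc map_polyC hornerC. Qed.
Lemma evcX z : evc 'X z = z.
Proof. by rewrite /evc map_polyX hornerX. Qed.
Lemma evcXn p n z : evc (p ^+ n) z = evc p z ^+ n.
Proof. by rewrite /evc rmorphXn horner_exp. Qed.
Lemma evc_real p (x : R) : evc p x%:C = (p.[x])%:C.
Proof. exact: (horner_map (real_complex R)). Qed.
Definition evcE := (evcB, evcD, evcM, evcC, evcX, evcXn).

Lemma evc_bounded p : exists2 B, 0 <= B & forall z, nc z <= 1 -> nc (evc p z) <= B.
Proof.
elim/poly_ind: p => [|p c [B B0 IH]].
  by exists 0 => // z _; rewrite (_ : 0 = 0%:P) // evcC nc_real normr0.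
exists (B + `|c|) => [|z z1]; first by rewrite addr_ge0.
rewrite !evcE; apply: le_trans (ncD _ _) _; rewrite nc_real lerD2r ncM.
by rewrite -[leRHS]mulr1 ler_pM ?nc_ge0 // IH.
Qed.

Section Approximation.
Variables (Om : set C) (y : R).
Hypothesis Om1 : forall z, Om z -> nc z <= 1.
Hypothesis Omy : Om y%:C.
Hypothesis y0 : 0 < y.

Definition approx (h : C -> C) := forall e, 0 < e ->
  exists p, forall z, Om z -> nc (h z - evc p z) <= e.

Lemma approx_bounded h : approx h -> exists2 B, 0 <= B & forall z, Om z -> nc (h z) <= B.
Proof.
move=> /(_ 1 ltr01) [p hp]; have [B B0 pB] := evc_bounded p.
exists (1 + B) => [|z Oz]; first by rewrite addr_ge0.
rewrite -[h z](subrK (evc p z)); apply: le_trans (ncD _ _) _.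
by apply: lerD; [exact: hp | exact/pB/Om1].
Qed.

Lemma approx_poly p : approx (evc p).
Proof. by move=> e e0; exists p => z _; rewrite subrr nc0 ltW. Qed.

Lemma approxD h k : approx h -> approx k -> approx (fun z => h z + k z).
Proof.
move=> ha ka e e0; have e2 : 0 < e / 2 by rewrite divr_gt0.
have [p hp] := ha _ e2; have [q kq] := ka _ e2; exists (p + q) => z Oz.
rewrite evcD opprD addrACA; apply: le_trans (ncD _ _) _.
by rewrite [leRHS](splitr e) lerD ?hp ?kq.
Qed.

Lemma approxM h k : approx h -> approx k -> approx (fun z => h z * k z).
Proof.
move=> ha ka e e0; have [B B0 hB] := approx_bounded ha.
have [q kq] := ka (e / 2 / (B + 1)) ltac:(by rewrite !divr_gt0 // ltr_wpDl).
have [D D0 qD] := evc_bounded q.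
have [p hp] := ha (e / 2 / (D + 1)) ltac:(by rewrite !divr_gt0 // ltr_wpDl).
exists (p * q) => z Oz.
have -> : h z * k z - evc (p * q) z = h z * (k z - evc q z) + (h z - evc p z) * evc q z.
  by rewrite evcM; ring.
apply: le_trans (ncD _ _) _; rewrite !ncM [leRHS](splitr e); apply: lerD.
  apply: le_trans (_ : (B + 1) * (e / 2 / (B + 1)) <= _).
    by rewrite ler_pM ?nc_ge0 ?kq // (le_trans (hB _ Oz)) // lerDl.
  by rewrite mulrC divfK // gt_eqF // ltr_wpDl.
apply: le_trans (_ : (e / 2 / (D + 1)) * (D + 1) <= _).
  by rewrite ler_pM ?nc_ge0 ?hp // (le_trans (qD _ (Om1 Oz))) // lerDl.
by rewrite divfK // gt_eqF // ltr_wpDl.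
Qed.

Lemma approxX h n : approx h -> approx (fun z => h z ^+ n).
Proof.
move=> ha; elim: n => [|n IH].
  by move=> e e0; exists 1%:P => z _; rewrite expr0 evcC subrr nc0 ltW.
move=> e e0; have [p hp] := approxM ha IH e0; exists p => z Oz.
by rewrite exprS hp.
Qed.

Lemma eq_approx h k : (forall z, Om z -> h z = k z) -> approx h -> approx k.
Proof. by move=> hk ha e /ha[p hp]; exists p => z Oz; rewrite -hk ?hp. Qed.

Lemma approx_geometric a : 0 <= a < 1 ->
  forall e, 0 < e -> exists p : {poly R}, 0 < p.[y] /\
    forall z, Om z -> nc ((1 - a%:C * z)^-1 - evc p z) <= e.
Proof.
move=> /andP[a0 a1] e e0.
have [n hn] := exists_expr_lt (introT andP (conj a0 a1))
  (mulr_gt0 e0 (ltac:(by rewrite subr_gt0) : 0 < 1 - a)).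
exists (\sum_(i < n.+1) (a%:P * 'X) ^+ i); split.
  rewrite horner_sum big_ord_recl /= !hornerE.
  apply: ltr_pwDl => //; apply: sumr_ge0 => i _.
  by rewrite !hornerE ?horner_exp ?hornerE exprn_ge0 // mulr_ge0 // ltW.
move=> z Oz; set w := a%:C * z.
have w1 : nc w <= a by rewrite ncM nc_pos // -[leRHS]mulr1 ler_wpM2l // Om1.
have w1' : 1 - a <= nc (1 - w).
  rewrite lerBlDr -[leLHS]nc1 -{1}[1](subrK w); apply: le_trans (ncD _ _) _.
  by rewrite lerD2l.
have wn0 : 1 - w != 0.
  by apply/eqP => w0; move: w1'; rewrite w0 nc0; lra.
have -> : evc (\sum_(i < n.+1) (a%:P * 'X) ^+ i) z = \sum_(i < n.+1) w ^+ i.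
  rewrite /evc rmorph_sum horner_sum; apply: eq_bigr => i _.
  by have := evcXn (a%:P * 'X) i z; rewrite /evc => ->; rewrite -/(evc _ _) !evcE.
have -> : (1 - w)^-1 - \sum_(i < n.+1) w ^+ i = w ^+ n.+1 / (1 - w).
  have := subrX1 w n.+1; rewrite -opprB -[w - 1]opprB mulNr => /oppr_inj h.
  apply: (mulIf wn0); rewrite mulrBl mulVf // divfK // [_ * (1 - w)]mulrC -h.
  by rewrite opprB addrC subrK.
rewrite ncM ncV ncX ler_pdivrMr; last by apply: lt_le_trans w1'; rewrite subr_gt0.
apply: le_trans (_ : a ^+ n <= _).
  apply: le_trans (_ : a ^+ n.+1 <= _); first by rewrite lerXn2r ?nnegrE ?nc_ge0.
  by rewrite exprS ler_piMl ?exprn_ge0 // ltW.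
by apply: le_trans (ltW hn) _; rewrite ler_wpM2l // ltW.
Qed.

Lemma approx_inv a : 0 <= a < 1 -> approx (fun z => (1 - a%:C * z)^-1).
Proof. by move=> a01 e e0; have [p [_ hp]] := approx_geometric a01 e0; exists p. Qed.

(** An approximate polynomial square root of [v]. Positivity at [y] is carried along, and is
    inherited by products, because the final construction divides by the value there. *)
Definition sqrt_approx (v : C -> C) := forall e, 0 < e ->
  exists p : {poly R}, 0 < p.[y] /\ forall z, Om z -> nc (evc p z ^+ 2 - v z) <= e.

(* The iteration d |-> (h + d^2)/2 converges geometrically, and
   (1 - d_n)^2 - (1 - h) = 2 (d_(n+1) - d_n). *)
Lemma sqrt_approx_one_minus h th : 0 <= th < 1 -> approx h ->
  (forall z, Om z -> nc (h z) <= th) -> sqrt_approx (fun z => 1 - h z).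
Proof.
move=> /andP[th0 th1] ha hth e e0.
pose t := (1 + th) / 2.
have t01 : 0 <= t < 1 by rewrite /t; apply/andP; split; lra.
have [t0 t1] := andP t01.
have e10 : 0 < Num.min (e / 2) ((1 - th) / 2) by rewrite lt_min; apply/andP; split; lra.
have [p hp] := ha _ e10.
have pt z : Om z -> nc (evc p z) <= t.
  move=> Oz; rewrite -[evc p z](subrK (h z)); apply: le_trans (ncD _ _) _.
  rewrite nc_distC; have := hp _ Oz; rewrite le_min => /andP[_ h2].
  by apply: le_trans (lerD h2 (hth _ Oz)) _; rewrite /t; lra.
pose d := fix d n : {poly R} := if n is n'.+1 then 2^-1%:P * (p + d n' ^+ 2) else 0.
have half : nc (2^-1)%:C = 2^-1 by rewrite nc_pos // invr_ge0.
have d0 z : evc (d 0) z = 0 by rewrite /= (_ : 0 = 0%:P) // evcC.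
have dS n z : evc (d n.+1) z = (2^-1)%:C * (evc p z + evc (d n) z ^+ 2).
  by rewrite /= !evcE.
have dt n z : Om z -> nc (evc (d n) z) <= t.
  move=> Oz; elim: n => [|n IH]; first by rewrite d0 nc0.
  rewrite dS ncM half; have := ncD (evc p z) (evc (d n) z ^+ 2).
  rewrite ncX; have := pt _ Oz; have := nc_ge0 (evc (d n) z).
  move: IH; set u := nc (evc (d n) z); set v := nc (_ + _); nra.
have dd n z : Om z -> nc (evc (d n.+1) z - evc (d n) z) <= t ^+ n.
  move=> Oz; elim: n => [|n IH].
    by rewrite d0 subr0 expr0; apply: le_trans (dt _ _ Oz) (ltW t1).
  have -> : evc (d n.+2) z - evc (d n.+1) z = (2^-1)%:C *
      ((evc (d n.+1) z - evc (d n) z) * (evc (d n.+1) z + evc (d n) z)).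
    have e1 := dS n z; have e2 := dS n.+1 z; rewrite e2.
    by rewrite [X in _ * (_ + _) - X]e1; ring.
  rewrite !ncM half exprSr; have := ncD (evc (d n.+1) z) (evc (d n) z).
  have := dt n _ Oz; have := dt n.+1 _ Oz.
  set u := nc (_ - _) in IH *; set v := nc (_ + _) => h1 h2 h3.
  rewrite mulrCA ler_pM ?nc_ge0 // ?mulr_ge0 ?nc_ge0 ?invr_ge0 //; lra.
have [n hn] := exists_expr_lt t01 (ltac:(lra) : 0 < e / 4).
exists (1 - d n); split.
  rewrite !hornerE subr_gt0; have := dt n _ Omy; rewrite evc_real nc_real => h1.
  exact: le_lt_trans (ler_norm _) (le_lt_trans h1 t1).
move=> z Oz; have -> : evc (1 - d n) z ^+ 2 - (1 - h z) =
    2%:C * (evc (d n.+1) z - evc (d n) z) + (h z - evc p z).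
  by rewrite evcB (_ : 1 = 1%:P) // evcC dS; field.
apply: le_trans (ncD _ _) _; rewrite ncM nc_pos //.
have := dd n _ Oz; have := hp _ Oz; rewrite le_min => /andP[h1 _] h2; lra.
Qed.

Lemma sqrt_approxM (v w : C -> C) : sqrt_approx v -> sqrt_approx w ->
  sqrt_approx (fun z => v z * w z).
Proof.
move=> va wa e e0.
have bounded u : sqrt_approx u -> approx u.
  move=> ua d d0; have [p [_ hp]] := ua _ d0; exists (p ^+ 2) => z Oz.
  by rewrite nc_distC evcXn hp.
have [B B0 wB] := approx_bounded (bounded _ wa).
have [p [py hp]] := va (e / 2 / (B + 1)) ltac:(by rewrite !divr_gt0 // ltr_wpDl).
have [D D0 pD] := evc_bounded (p ^+ 2).
have [q [qy hq]] := wa (e / 2 / (D + 1)) ltac:(by rewrite !divr_gt0 // ltr_wpDl).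
exists (p * q); split; first by rewrite hornerM mulr_gt0.
move=> z Oz; have -> : evc (p * q) z ^+ 2 - v z * w z =
    evc (p ^+ 2) z * (evc q z ^+ 2 - w z) + (evc p z ^+ 2 - v z) * w z.
  by rewrite !evcE; ring.
apply: le_trans (ncD _ _) _; rewrite !ncM [leRHS](splitr e); apply: lerD.
  apply: le_trans (_ : (D + 1) * (e / 2 / (D + 1)) <= _).
    by rewrite ler_pM ?nc_ge0 ?hq // (le_trans (pD _ (Om1 Oz))) // lerDl.
  by rewrite mulrC divfK // gt_eqF // ltr_wpDl.
apply: le_trans (_ : (e / 2 / (B + 1)) * (B + 1) <= _).
  by rewrite ler_pM ?nc_ge0 ?hp // (le_trans (wB _ Oz)) // lerDl.
by rewrite divfK // gt_eqF // ltr_wpDl.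
Qed.

Lemma sqrt_approx_sqr_inv a : 0 <= a < 1 -> sqrt_approx (fun z => (1 - a%:C * z)^-1 ^+ 2).
Proof.
move=> a01 e e0; have [B B0 wB] := approx_bounded (approx_inv a01).
have B1 : 0 < 2 * B + 1 by lra.
have m0 : 0 < Num.min 1 (e / (2 * B + 1)) by rewrite lt_min ltr01 divr_gt0.
have [p [py hp]] := approx_geometric a01 m0; exists p; split => // z Oz.
set w := (1 - a%:C * z)^-1 in hp *; have := hp _ Oz; rewrite -/w nc_distC.
set u := evc p z - w; rewrite le_min => /andP[u1 u2].
have -> : evc p z ^+ 2 - w ^+ 2 = u * (2%:C * w + u) by rewrite /u; ring.
rewrite ncM; have : nc (2%:C * w + u) <= 2 * B + 1.
  apply: le_trans (ncD _ _) _; rewrite ncM nc_pos // lerD // ler_wpM2l //.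
  exact: wB.
move=> h; apply: le_trans (ler_pM (nc_ge0 _) (nc_ge0 _) u2 h) _.
by rewrite divfK // gt_eqF.
Qed.

Lemma sqrt_approx_cst (c : R) : 0 < c -> sqrt_approx (fun=> c%:C).
Proof.
move=> c0 e e0; exists (Num.sqrt c)%:P; split; first by rewrite hornerC sqrtr_gt0.
by move=> z _; rewrite evcC -realCX sqr_sqrtr ?(ltW c0) // subrr nc0 (ltW e0).
Qed.

End Approximation.

End Modulus.

(** * A map of the disc into an ellipse *)

Section SquareRootPolynomial.
Variable R : realType.
Local Notation C := R[i].
Local Notation nc := (@Normc.normc R).

Lemma nc_add_le (z w : C) (p m : R) : 0 <= p -> 0 <= m ->
  sqn z * sqn w <= m ^+ 2 -> sqn z + sqn w + 2 * m <= (2 * p) ^+ 2 ->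
  nc z + nc w <= 2 * p.
Proof.
move=> p0 m0; rewrite -!normc_sqr -exprMn ler_sqr ?nnegrE ?mulr_ge0 ?nc_ge0 // => h1 h2.
rewrite -ler_sqr ?nnegrE ?addr_ge0 ?mulr_ge0 ?nc_ge0 //; apply: le_trans h2.
by rewrite sqrrD; lra.
Qed.

(* The foci of this ellipse are +-2 sqrt s = +-a, its semi-axes 1 +- s. *)
Lemma focal_sum_le (a : R) (w : C) (s := a ^+ 2 / 4) : 0 < a -> a < 1 ->
  (1 - s) ^+ 2 * complex.Re w ^+ 2 + (1 + s) ^+ 2 * complex.Im w ^+ 2 <= (1 - s ^+ 2) ^+ 2 ->
  nc (w + a%:C) + nc (w - a%:C) <= 2 * (1 + s).
Proof.
move=> a0 a1 h; pose X := complex.Re w; pose Y := complex.Im w.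
rewrite -/X -/Y in h.
have s0 : 0 < s by rewrite /s; nra.
have s1 : s < 4^-1 by rewrite /s; nra.
have as4 : a ^+ 2 = 4 * s by rewrite /s; field.
have xy : X ^+ 2 + Y ^+ 2 <= (1 + s) ^+ 2.
  have := sqr_ge0 X; have := sqr_ge0 Y.
  set u := X ^+ 2 in h *; set v := Y ^+ 2 in h * => v0 u0.
  have : (1 - s) ^+ 2 * (u + v) <= (1 - s) ^+ 2 * (1 + s) ^+ 2.
    have -> : (1 - s) ^+ 2 * (1 + s) ^+ 2 = (1 - s ^+ 2) ^+ 2 by ring.
    have : 0 <= s * v by rewrite mulr_ge0 // ltW.
    by nra.
  by rewrite ler_pM2l // exprn_gt0 //; lra.
have -> : w = Complex X Y by rewrite /X /Y; case: (w).
apply: (@nc_add_le _ _ _ (2 + 2 * s ^+ 2 - (X ^+ 2 + Y ^+ 2))); rewrite /sqn /=.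
- by lra.
- by nra.
- have -> : ((X + a) ^+ 2 + (Y + 0) ^+ 2) * ((X - a) ^+ 2 + (Y - 0) ^+ 2) =
     (X ^+ 2 + Y ^+ 2 + a ^+ 2) ^+ 2 - 4 * a ^+ 2 * X ^+ 2 by ring.
  by rewrite as4; move: h; set u := X ^+ 2; set v := Y ^+ 2; nra.
- have -> : (X + a) ^+ 2 + (Y + 0) ^+ 2 + ((X - a) ^+ 2 + (Y - 0) ^+ 2) =
     2 * (X ^+ 2 + Y ^+ 2) + 2 * a ^+ 2 by ring.
  by rewrite as4; nra.
Qed.

(** Convexity of the focal sum along the ray from the centre, where it equals [2 a]. The gain over
    [2 (1 + s)] is (1 - th)(2 (1 + s) - 2 a). *)
Lemma focal_sum_scaled_le (a th : R) (w : C) (s := a ^+ 2 / 4) : 0 < a -> a < 1 ->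
  0 < th -> th <= 1 ->
  (1 - s) ^+ 2 * complex.Re w ^+ 2 + (1 + s) ^+ 2 * complex.Im w ^+ 2 <=
    th ^+ 2 * (1 - s ^+ 2) ^+ 2 ->
  nc (w + a%:C) + nc (w - a%:C) <= th * (2 * (1 + s)) + 2 * ((1 - th) * a).
Proof.
move=> a0 a1 th0 th1 h; pose w0 := th^-1%:C * w.
have th0' : th%:C != 0 :> C by rewrite -sqn_eq0 sqn_real expf_neq0 // gt_eqF.
have ww0 : w = th%:C * w0 by rewrite /w0 mulrA -realCM mulfV ?mul1r // gt_eqF.
have h0 : nc (w0 + a%:C) + nc (w0 - a%:C) <= 2 * (1 + s).
  apply: focal_sum_le => //; rewrite -/s.
  rewrite -(ler_pM2l (exprn_gt0 2 th0)); apply: le_trans h.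
  rewrite ww0; case: w0 {ww0} => X Y /=; rewrite le_eqVlt; apply/orP; left.
  by apply/eqP; ring.
have e1 : nc (w + a%:C) <= th * nc (w0 + a%:C) + (1 - th) * a.
  have -> : w + a%:C = th%:C * (w0 + a%:C) + ((1 - th) * a)%:C.
    by rewrite ww0 !(realCM, realCB); ring.
  apply: le_trans (ncD _ _) _; rewrite ncM nc_pos ?(ltW th0) // nc_pos //.
  by rewrite mulr_ge0 ?(ltW a0) // subr_ge0.
have e2 : nc (w - a%:C) <= th * nc (w0 - a%:C) + (1 - th) * a.
  have -> : w - a%:C = th%:C * (w0 - a%:C) - ((1 - th) * a)%:C.
    by rewrite ww0 !(realCM, realCB); ring.
  apply: le_trans (ncB _ _) _; rewrite ncM nc_pos ?(ltW th0) // nc_pos //.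
  by rewrite mulr_ge0 ?(ltW a0) // subr_ge0.
by nra.
Qed.

(** The quadratic form equals (1 + s^2) |g|^2 - 2 s Re(g^2), which for |b| = 1 depends on [b^2]
    alone; that is [quint_circle_ineq]. The constant [c0] normalises the quintic so that it fixes
    [a] and [-a], since a^2 = 4 s. To first order in [s], the factor 1 + s b^2 reproduces the radius
    of the ellipse. *)
Lemma quintic_in_ellipse (a : R) (b : C) (s := a ^+ 2 / 4)
    (c0 := 1 + 4 * s ^+ 2 + 16 * s ^+ 4)
    (g := c0^-1%:C * (b * (1 + s%:C * b ^+ 2 + s%:C ^+ 2 * b ^+ 4))) :
  0 < a -> a < 1 -> sqn b = 1 ->
  (1 - s) ^+ 2 * complex.Re g ^+ 2 + (1 + s) ^+ 2 * complex.Im g ^+ 2 <=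
    (1 - s ^+ 2) * (1 - s ^+ 2) ^+ 2.
Proof.
move=> a0 a1 b1.
have s0 : 0 < s by rewrite /s; nra.
have s1 : s <= 4^-1 by rewrite /s; nra.
have c00 : 0 < c0.
  have := sqr_ge0 s; have : 0 <= s ^+ 4 by rewrite exprn_even_ge0.
  by rewrite /c0; lra.
have -> : (1 - s) ^+ 2 * complex.Re g ^+ 2 + (1 + s) ^+ 2 * complex.Im g ^+ 2 =
    (1 + s ^+ 2) * sqn g - 2 * s * complex.Re (g ^+ 2).
  by case: g => X Y; rewrite /sqn /=; ring.
pose be := b ^+ 2; pose W := 1 + s%:C * be + s%:C ^+ 2 * be ^+ 2.
have be1 : sqn be = 1 by rewrite /be sqnX b1 expr1n.
have gW : g = c0^-1%:C * (b * W) by rewrite /g /W /be -exprM.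
have -> : sqn g = c0^-1 ^+ 2 * sqn W by rewrite gW !sqnM sqn_real b1 mul1r.
have -> : complex.Re (g ^+ 2) = c0^-1 ^+ 2 * complex.Re (be * W ^+ 2).
  have -> : g ^+ 2 = (c0^-1 ^+ 2)%:C * (be * W ^+ 2) by rewrite gW /be realCX; ring.
  by case: (be * W ^+ 2) => X Y /=; ring.
have -> : (1 + s ^+ 2) * (c0^-1 ^+ 2 * sqn W) -
    2 * s * (c0^-1 ^+ 2 * complex.Re (be * W ^+ 2)) =
    c0^-1 ^+ 2 * ((1 + s ^+ 2) * sqn W - 2 * s * complex.Re (be * W ^+ 2)) by ring.
rewrite exprVn mulrC ler_pdivrMr ?exprn_gt0 //.
clear gW; move: be1; rewrite /W; case: {W} be => x y; rewrite /sqn /= => xy1.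
have yy : y ^+ 2 = 1 - x ^+ 2 by rewrite -xy1; ring.
have x1 : x ^+ 2 <= 1 by rewrite -xy1 lerDl sqr_ge0.
have := @quint_circle_ineq R s x s0 s1; rewrite -/c0.
have -> : (1 - s ^+ 2) * (1 - s ^+ 2) ^+ 2 * c0 ^+ 2 = (1 - s ^+ 2) ^+ 3 * c0 ^+ 2 by ring.
move=> /(_ ltac:(nra) ltac:(nra)); apply: le_trans; rewrite le_eqVlt; apply/orP; left.
apply/eqP; pose A := 1 + s * x + s ^+ 2 * (x ^+ 2 - y ^+ 2); pose B := s + 2 * s ^+ 2 * x.
transitivity ((1 + s ^+ 2) * (A ^+ 2 + y ^+ 2 * B ^+ 2) -
   2 * s * (x * (A ^+ 2 - y ^+ 2 * B ^+ 2) - 2 * y ^+ 2 * A * B)).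
  by rewrite /A /B /=; ring.
by rewrite /A /B yy; ring.
Qed.

(** The quintic of a Blaschke factor, shifted by [a], is a function [u] with [u(0) = 0] and
    [u(y) = 2 a] that maps the circle into the ellipse with foci 0 and [2 a]. The quotient
    [u(z) / z] is a product of factors with approximable square roots, and [q] approximates a root
    of a slight enlargement of it. *)
Lemma exists_square_root_poly (a : R) (y := 2 * a / (1 + a ^+ 2)) : 0 < a -> a < 1 ->
  exists q : {poly R}, [/\ 0 < q.[y], 2 * a <= y * q.[y] ^+ 2 &
    forall z, sqn z = 1 ->
      nc (z * evc q z ^+ 2) + nc (z * evc q z ^+ 2 - (2 * a)%:C) <= 2 + a ^+ 2 / 2].
Proof.
move=> a0 a1.
pose s := a ^+ 2 / 4; pose c0 := 1 + 4 * s ^+ 2 + 16 * s ^+ 4.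
have s0 : 0 < s by rewrite /s; nra.
have s1 : s <= 4^-1 by rewrite /s; nra.
have as4 : a ^+ 2 = 4 * s by rewrite /s; field.
have c01 : 1 <= c0.
  have := sqr_ge0 s; have : 0 <= s ^+ 4 by rewrite exprn_even_ge0.
  by rewrite /c0; lra.
have a21 : 0 < 1 + a ^+ 2 by rewrite ltr_pwDl // sqr_ge0.
have y0 : 0 < y by rewrite /y divr_gt0 // mulr_gt0.
have y1 : y < 1 by rewrite /y ltr_pdivrMr // mul1r; nra.
(* The point [y] joins the circle because the lower bound on [q] is taken there. *)
pose Om : set C := [set z | sqn z = 1 \/ z = y%:C]%classic.
have Om1 z : Om z -> nc z <= 1.
  by case=> [/sqn_nc1 -> //|->]; rewrite nc_pos ltW.
have Omy : Om y%:C by right.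
have a01 : 0 <= a < 1 by rewrite (ltW a0) a1.
(* The Blaschke factor with b(0) = -a; [y] is the point that it sends to [a]. *)
pose b z := (z - a%:C) * (1 - a%:C * z)^-1.
have den z : Om z -> 1 - a%:C * z != 0.
  move=> /Om1 z1; apply/eqP => e; have : nc (a%:C * z) = 1.
    by rewrite -nc1; congr nc; apply/eqP; rewrite eq_sym -subr_eq0 e.
  by rewrite ncM nc_pos ?ltW // => e2; have := nc_ge0 z; nra.
have b1 z : sqn z = 1 -> sqn (b z) = 1.
  move=> z1; rewrite sqnM sqnV; suff -> : sqn (z - a%:C) = sqn (1 - a%:C * z).
    by rewrite mulfV // sqn_eq0 den //; left.
  case: z z1 => u v; rewrite /sqn /= => uv.
  transitivity ((u ^+ 2 + v ^+ 2) - 2 * a * u + a ^+ 2); first by ring.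
  transitivity (1 - 2 * a * u + a ^+ 2 * (u ^+ 2 + v ^+ 2)); last by ring.
  by rewrite uv; ring.
have by_ : b y%:C = a%:C.
  have d0 : (1 + a ^+ 2)%:C != 0 :> C by rewrite -sqn_eq0 sqn_real expf_neq0 // gt_eqF.
  have d1 : (1 - a ^+ 2)%:C != 0 :> C.
    by rewrite -sqn_eq0 sqn_real expf_neq0 // gt_eqF // subr_gt0 expr_lt1 // ltW.
  rewrite /b; apply: (canLR (mulfK _)); first exact: den.
  have e : y - a = a * (1 - a * y) by rewrite /y; field; rewrite gt_eqF.
  by rewrite -realCB e realCM realCB realCM.
have bn z : Om z -> nc (b z) <= 1.
  by case=> [/b1/sqn_nc1 -> //|->]; rewrite by_ nc_pos ltW.
have b_approx : approx Om b.
  apply: approxM => //; last exact: approx_inv.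
  by apply: (eq_approx _ (@approx_poly _ _ ('X - a%:P))) => z _; rewrite !evcE.
(* [c0 + rest x] is the quotient of [a c0 + x + s x^3 + s^2 x^5] by its factor [x + a]. The
   smallness of [rest] keeps this quotient away from 0, as the square root requires. *)
pose rest x : C := s%:C * (x ^+ 2 - a%:C * x) +
  s%:C ^+ 2 * (x ^+ 4 - a%:C * x ^+ 3 + a%:C ^+ 2 * x ^+ 2 - a%:C ^+ 3 * x).
have rest_bound x : nc x <= 1 -> nc (rest x) <= 3 / 4.
  move=> x1; have xn n : nc (x ^+ n) <= 1 by rewrite ncX exprn_ile1 // nc_ge0.
  have an n m : nc (a%:C ^+ n * x ^+ m) <= 1.
    rewrite ncM ncX (nc_pos (ltW a0)) mulr_ile1 ?exprn_ge0 ?nc_ge0 ?xn //; first exact: ltW.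
    by rewrite exprn_ile1 // ltW.
  have h1 : nc (x ^+ 2 - a%:C * x) <= 2.
    apply: le_trans (ncB _ _) _; have := xn 2%N; have := an 1%N 1%N; rewrite !expr1; lra.
  have h2 : nc (x ^+ 4 - a%:C * x ^+ 3 + a%:C ^+ 2 * x ^+ 2 - a%:C ^+ 3 * x) <= 4.
    apply: le_trans (ncB _ _) _; apply: le_trans (lerD (ncD _ _) (lexx _)) _.
    apply: le_trans (lerD (lerD (ncB _ _) (lexx _)) (lexx _)) _.
    have := xn 4%N; have := an 1%N 3%N; have := an 2%N 2%N; have := an 3%N 1%N.
    by rewrite !expr1; lra.
  apply: le_trans (ncD _ _) _; rewrite (ncM s%:C) (ncM (s%:C ^+ 2)) ncX (nc_pos (ltW s0)).
  have := nc_ge0 (x ^+ 2 - a%:C * x); have := nc_ge0 (x ^+ 4 - a%:C * x ^+ 3 + a%:C ^+ 2 * x ^+ 2 - a%:C ^+ 3 * x).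
  have s2 : s ^+ 2 <= 16^-1 by nra.
  have s20 : 0 <= s ^+ 2 by apply: sqr_ge0.
  by nra.
have cst_approx (c : R) : approx Om (fun=> c%:C).
  by apply: (eq_approx _ (@approx_poly _ _ c%:P)) => z _; rewrite evcC.
pose h z := (- c0^-1)%:C * rest (b z).
have h_approx : approx Om h.
  apply: approxM => //; apply: approxD.
    apply: approxM => //; apply: approxD; first exact: approxX.
    apply: (@eq_approx _ _ (fun z => (- a)%:C * b z)); last exact: approxM.
    by move=> z _; rewrite realCN mulNr.
  apply: (@eq_approx _ _ (fun z => (s ^+ 2)%:C * (b z ^+ 4 + (- a)%:C * b z ^+ 3
      + (a ^+ 2)%:C * b z ^+ 2 + (- a ^+ 3)%:C * b z))).
    by move=> z _; rewrite !(realCN, realCX) !mulNr.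
  apply: approxM => //; apply: approxD; last exact: approxM.
  apply: approxD; last by apply: approxM => //; apply: approxX.
  apply: approxD; first exact: approxX.
  by apply: approxM => //; apply: approxX.
have h_bound z : Om z -> nc (h z) <= 3 / 4.
  move=> /bn/rest_bound hr; rewrite ncM realCN ncN nc_pos ?invr_ge0 ?(le_trans ler01) //.
  rewrite -[leRHS]mul1r ler_pM ?nc_ge0 ?invr_ge0 ?(le_trans ler01) //.
  by rewrite invf_le1 // (lt_le_trans ltr01).
(* The spare factor [1 - s^2] is [th^2]: the quintic lands in the ellipse shrunk by [th], which
   leaves the slack [eta] in the focal sum. *)
pose th := Num.sqrt (1 - s ^+ 2).
have s2 : s ^+ 2 < 1 by nra.
have th2 : th ^+ 2 = 1 - s ^+ 2 by rewrite sqr_sqrtr // subr_ge0 ltW.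
have th0 : 0 < th by rewrite sqrtr_gt0 subr_gt0.
have th1 : th < 1.
  by rewrite -(ltr_sqr (ltW th0) ler01) th2 expr1n ltrBlDr ltrDl exprn_gt0.
pose eta := (1 - th) * (2 * (1 + s) - 2 * a).
have D0 : 0 < 2 * (1 + s) - 2 * a.
  have : 0 < (2 - a) ^+ 2 by rewrite exprn_gt0 //; lra.
  by rewrite /s; nra.
have eta0 : 0 < eta by apply: mulr_gt0 => //; rewrite subr_gt0.
have eta1 : eta <= 4.
  by have := mulr_gt0 th0 D0; rewrite /eta mulrBl; lra.
(* Enlarging the target by [1 + de] covers the approximation error at [y]. On the circle each of the
   two distances then loses at most [eta / 4 + 4 de = eta / 2], in total exactly the slack. *)
pose de := eta / 16.
have de0 : 0 < de by rewrite divr_gt0.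
pose u z := a%:C + c0^-1%:C * (b z * (1 + s%:C * b z ^+ 2 + s%:C ^+ 2 * b z ^+ 4)).
have u_bound z : sqn z = 1 -> nc (u z) + nc (u z - (2 * a)%:C) <= 2 * (1 + s) - eta.
  move=> z1; have := quintic_in_ellipse a0 a1 (b1 _ z1); rewrite -/s -/c0 -[X in _ <= X * _]th2.
  set g := c0^-1%:C * _ => hg0.
  have {hg0} := focal_sum_scaled_le a0 a1 th0 (ltW th1) hg0; rewrite -/s => hg.
  have -> : u z = g + a%:C by rewrite addrC.
  have -> : g + a%:C - (2 * a)%:C = g - a%:C by rewrite realCM (_ : 2%:C = 1 + 1) //; ring.
  by apply: le_trans hg _; rewrite /eta; lra.
(* The factor [1 / (1 - a z)] is written as [1 - a z] times an exact square, so that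
   [sqrt_approx_one_minus] covers what is not a square. *)
pose v z := ((1 + de) * (1 - a ^+ 2))%:C * ((1 - a%:C * z) * (1 - a%:C * z)^-1 ^+ 2 * (1 - h z)).
have c0C : c0%:C != 0 :> C.
  by rewrite -sqn_eq0 sqn_real expf_neq0 // gt_eqF // (lt_le_trans ltr01).
have vu z : Om z -> z * v z = (1 + de)%:C * u z.
  move=> /den dz; rewrite /v /u /h.
  have -> : (1 - a%:C * z) * (1 - a%:C * z)^-1 ^+ 2 = (1 - a%:C * z)^-1.
    by rewrite [_^-1 ^+ 2]expr2 mulrA mulfV // mul1r.
  have bz : b z * (1 - a%:C * z) = z - a%:C by rewrite /b divfK.
  have ba : z * ((1 - a ^+ 2)%:C * (1 - a%:C * z)^-1) = b z + a%:C.
    apply: (mulIf dz); rewrite mulrDl bz mulrA divfK // realCB realCX; ring.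
  have -> : z * (((1 + de) * (1 - a ^+ 2))%:C * ((1 - a%:C * z)^-1 * (1 - (- c0^-1)%:C * rest (b z)))) =
     (1 + de)%:C * ((z * ((1 - a ^+ 2)%:C * (1 - a%:C * z)^-1)) * (1 - (- c0^-1)%:C * rest (b z))).
    by rewrite realCM; ring.
  rewrite ba; congr (_ * _); rewrite realCN realCV; apply: (mulIf c0C).
  have cc : c0%:C = 1 + s%:C * a%:C ^+ 2 + s%:C ^+ 2 * a%:C ^+ 4.
    rewrite -!realCX -!realCM -(realCD 1) -realCD; congr (_%:C).
    by rewrite /c0 (exprM a 2 2) as4; ring.
  transitivity ((b z + a%:C) * (c0%:C + rest (b z))); first by field.
  transitivity (a%:C * c0%:C + b z * (1 + s%:C * b z ^+ 2 + s%:C ^+ 2 * b z ^+ 4)).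
    by rewrite cc /rest; ring.
  by field.
have v_approx : sqrt_approx Om y v.
  apply: sqrt_approxM => //.
    apply: sqrt_approx_cst; apply: mulr_gt0; first by rewrite addr_gt0.
    by rewrite subr_gt0 expr_lt1 // ltW.
  apply: sqrt_approxM => //; first apply: sqrt_approxM => //.
  - apply: (@sqrt_approx_one_minus _ _ _ _ _ a) => //.
      by apply: approxM => //; apply: (eq_approx _ (@approx_poly _ _ 'X)) => z _; rewrite evcX.
    by move=> z /Om1 z1; rewrite ncM (nc_pos (ltW a0)) ler_piMr // ltW.
  - exact: sqrt_approx_sqr_inv.
  - apply: (@sqrt_approx_one_minus _ _ _ _ _ (3 / 4)) => //.
    by apply/andP; split; lra.
have e0 : 0 < Num.min (eta / 4) (2 * a * de).
  by rewrite lt_min divr_gt0 //= mulr_gt0 // mulr_gt0.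
have [q [qy hq]] := v_approx _ e0; exists q; split => //.
  have := hq _ Omy; rewrite le_min => /andP[_].
  have vy := vu _ Omy.
  have uy : u y%:C = (2 * a)%:C.
    rewrite /u by_; have -> : 1 + s%:C * a%:C ^+ 2 + s%:C ^+ 2 * a%:C ^+ 4 = c0%:C.
      rewrite -!realCX -!realCM -(realCD 1) -realCD; congr (_%:C).
      by rewrite /c0 (exprM a 2 2) as4; ring.
    by rewrite realCV mulrCA mulVf // mulr1 -realCD; congr (_%:C); ring.
  move=> hv; have : nc ((y * q.[y] ^+ 2 - (1 + de) * (2 * a))%:C) <= 2 * a * de.
    have -> : (y * q.[y] ^+ 2 - (1 + de) * (2 * a))%:C =
        y%:C * (evc q y%:C ^+ 2 - v y%:C).
      by rewrite mulrBr vy uy evc_real !(realCB, realCM, realCX).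
    by rewrite ncM (nc_pos (ltW y0)) -[leRHS]mul1r ler_pM ?nc_ge0 ?(ltW y0) ?(ltW y1).
  by rewrite nc_real ler_norml => /andP[+ _]; lra.
move=> z z1; have Oz : Om z by left.
have := hq _ Oz; rewrite le_min => /andP[hz _].
set Z := z * _.
have Zu : nc (Z - (1 + de)%:C * u z) <= eta / 4.
  by rewrite /Z -vu // -mulrBr ncM sqn_nc1 // mul1r.
have ub := u_bound _ z1.
have u3 : nc (u z) <= 4.
  have := nc_ge0 (u z - (2 * a)%:C); lra.
have d1 : nc (Z - u z) <= eta / 4 + de * 4.
  have -> : Z - u z = (Z - (1 + de)%:C * u z) + de%:C * u z by rewrite realCD; ring.
  apply: le_trans (ncD _ _) _; apply: lerD => //.
  by rewrite ncM (nc_pos (ltW de0)) ler_wpM2l // ltW.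
have d2 : nc Z <= nc (Z - u z) + nc (u z) by rewrite -{1}[Z](subrK (u z)) ncD.
have d3 : nc (Z - (2 * a)%:C) <= nc (Z - u z) + nc (u z - (2 * a)%:C).
  have -> : Z - (2 * a)%:C = (Z - u z) + (u z - (2 * a)%:C) by ring.
  exact: ncD.
have -> : 2 + a ^+ 2 / 2 = 2 * (1 + s) by rewrite /s; field.
by move: d1; rewrite /de; lra.
Qed.

End SquareRootPolynomial.

(** * Canonical tridiagonal matrices *)

Section ThreeByThree.
Variable R : realType.
Local Notation C := R[i].

Definition mx3 (a b c d e f g h k : C) : 'M[C]_3 :=
  \matrix_(i < 3, j < 3)
    nth 0 (nth [::] [:: [:: a; b; c]; [:: d; e; f]; [:: g; h; k]] i) j.

Definition cv3 (x y z : C) : 'cV[C]_3 := \col_(i < 3) nth 0 [:: x; y; z] i.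

Lemma ord3P (P : 'I_3 -> Prop) : P 0 -> P 1 -> P 2%:R -> forall i, P i.
Proof.
move=> P0 P1 P2 [[|[|[|//]]] Hi].
- by rewrite (_ : Ordinal Hi = 0) //; apply: val_inj.
- by rewrite (_ : Ordinal Hi = 1) //; apply: val_inj.
- by rewrite (_ : Ordinal Hi = 2%:R) //; apply: val_inj.
Qed.

Lemma sum3 (V : nmodType) (F : 'I_3 -> V) : \sum_i F i = F 0 + F 1 + F 2%:R.
Proof.
rewrite !big_ord_recr big_ord0 /= add0r; congr (F _ + F _ + F _); exact: val_inj.
Qed.

Lemma mx3P (M : 'M[C]_3) : M = mx3 (M 0 0) (M 0 1) (M 0 2%:R)
  (M 1 0) (M 1 1) (M 1 2%:R) (M 2%:R 0) (M 2%:R 1) (M 2%:R 2%:R).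
Proof. by apply/matrixP; elim/ord3P; elim/ord3P; rewrite !mxE. Qed.

Lemma cv3P (x : 'cV[C]_3) : x = cv3 (x 0 0) (x 1 0) (x 2%:R 0).
Proof. by apply/colP; elim/ord3P; rewrite !mxE. Qed.

Lemma mul_mx3 a b c d e f g h k a' b' c' d' e' f' g' h' k' :
  mx3 a b c d e f g h k *m mx3 a' b' c' d' e' f' g' h' k' =
  mx3 (a * a' + b * d' + c * g') (a * b' + b * e' + c * h') (a * c' + b * f' + c * k')
      (d * a' + e * d' + f * g') (d * b' + e * e' + f * h') (d * c' + e * f' + f * k')
      (g * a' + h * d' + k * g') (g * b' + h * e' + k * h') (g * c' + h * f' + k * k').
Proof. by apply/matrixP; elim/ord3P; elim/ord3P; rewrite !mxE sum3 !mxE. Qed.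

Lemma mul_mx3_cv3 a b c d e f g h k x y z :
  mx3 a b c d e f g h k *m cv3 x y z =
  cv3 (a * x + b * y + c * z) (d * x + e * y + f * z) (g * x + h * y + k * z).
Proof. by apply/colP; elim/ord3P; rewrite !mxE sum3 !mxE. Qed.

Lemma adjoint_mx3 a b c d e f g h k :
  adjointmx (mx3 a b c d e f g h k) =
  mx3 (conjc a) (conjc d) (conjc g) (conjc b) (conjc e) (conjc h) (conjc c) (conjc f) (conjc k).
Proof. by apply/matrixP; elim/ord3P; elim/ord3P; rewrite !mxE. Qed.

Lemma scalar_mx3 (a : C) : a%:M = mx3 a 0 0 0 a 0 0 0 a.
Proof. by apply/matrixP; elim/ord3P; elim/ord3P; rewrite !mxE /= ?mulr1n ?mulr0n. Qed.

Lemma scale_mx3 s a b c d e f g h k :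
  s *: mx3 a b c d e f g h k = mx3 (s * a) (s * b) (s * c) (s * d) (s * e) (s * f)
    (s * g) (s * h) (s * k).
Proof. by apply/matrixP; elim/ord3P; elim/ord3P; rewrite !mxE. Qed.

Lemma add_mx3 a b c d e f g h k a' b' c' d' e' f' g' h' k' :
  mx3 a b c d e f g h k + mx3 a' b' c' d' e' f' g' h' k' =
  mx3 (a + a') (b + b') (c + c') (d + d') (e + e') (f + f') (g + g') (h + h') (k + k').
Proof. by apply/matrixP; elim/ord3P; elim/ord3P; rewrite !mxE. Qed.

Lemma frob2_cv3 x y z : frob2 (cv3 x y z) = sqn x + sqn y + sqn z.
Proof. by rewrite /frob2 sum3 !big_ord1 !mxE /=. Qed.

Lemma dot_cv3 x y z x' y' z' : (adjointmx (cv3 x y z) *m cv3 x' y' z') 0 0 =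
  conjc x * x' + conjc y * y' + conjc z * z'.
Proof. by rewrite mxE sum3 !mxE. Qed.

Lemma bdd2_mx3 a b c d e f g h k K :
  (forall x y z, sqn (a * x + b * y + c * z) + sqn (d * x + e * y + f * z) +
     sqn (g * x + h * y + k * z) <= K * (sqn x + sqn y + sqn z)) ->
  bdd2 (mx3 a b c d e f g h k) K.
Proof. by move=> H x; rewrite (cv3P x) mul_mx3_cv3 !frob2_cv3. Qed.

Lemma tridiag3_mx3 a b1 b2 c1 c2 : tridiag3 a b1 b2 c1 c2 = mx3 a b1 0 c1 a b2 0 c2 a.
Proof. by []. Qed.

Lemma numerical_range_mx3 (M : 'M[C]_3) x y z :
  sqn x + sqn y + sqn z = 1 ->
  numerical_range M ((adjointmx (cv3 x y z) *m (M *m cv3 x y z)) 0 0).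
Proof.
move=> n1; exists (cv3 x y z) => /=; last by rewrite mulmxA.
by rewrite frob2_dot frob2_cv3 n1.
Qed.

Definition dg3 (x y z : R) := mx3 x%:C 0 0 0 y%:C 0 0 0 z%:C.

Lemma bdd2_dg3 x y z K : x ^+ 2 <= K -> y ^+ 2 <= K -> z ^+ 2 <= K -> bdd2 (dg3 x y z) K.
Proof.
move=> hx hy hz; apply: bdd2_mx3 => u v w; rewrite !mul0r !addr0 !add0r !sqnM !sqn_real.
by rewrite [leRHS]mulrDr [X in _ <= X + _]mulrDr; (apply: lerD; first apply: lerD); apply: ler_wpM2r => //; apply: sqn_ge0.
Qed.

(** All entries lie between their minimum [lo] and [2 lo], so the squared norms of the diagonal
    matrix and of its inverse multiply to at most 4. *)
Lemma specb_dg3 (Om : set C) T x y z : 0 < x -> 0 < y -> 0 < z ->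
  x <= 2 * y -> x <= 2 * z -> y <= 2 * x -> y <= 2 * z -> z <= 2 * x -> z <= 2 * y ->
  specb Om T 1 -> specb Om (dg3 x^-1 y^-1 z^-1 *m T *m dg3 x y z) 4.
Proof.
move=> x0 y0 z0 xy xz yx yz zx zy spT.
pose lo := Num.min x (Num.min y z).
have lo0 : 0 < lo by rewrite !lt_min x0 y0.
have [lx ly lz] : [/\ lo <= x, lo <= y & lo <= z].
  by rewrite /lo; split; rewrite !ge_min lexx ?orbT.
have [hx hy hz] : [/\ x <= 2 * lo, y <= 2 * lo & z <= 2 * lo].
  have two : 2 * lo = Num.min (2 * x) (Num.min (2 * y) (2 * z)) by rewrite -!minr_pMr.
  by rewrite two; split; rewrite !le_min; apply/and3P; split => //; lra.
have -> : 4 = lo^-1 ^+ 2 * 1 * (2 * lo) ^+ 2 by field; rewrite gt_eqF.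
apply: specb_sim => //; first exact: sqr_ge0.
- rewrite /dg3 mul_mx3 scalar_mx3 -!realCM !mulfV ?gt_eqF //.
  by rewrite !(mul0r, mulr0, addr0, add0r).
- by apply: bdd2_dg3; rewrite ler_sqr ?nnegrE ?invr_ge0 ?(ltW lo0, ltW x0, ltW y0, ltW z0) //
    lef_pV2.
- by apply: bdd2_dg3; rewrite ler_sqr ?nnegrE ?mulr_ge0 ?(ltW lo0, ltW x0, ltW y0, ltW z0).
Qed.

Lemma specb_diag_mx d (Om : set C) (l : 'rV[C]_d.+1) :
  (forall j, Om (l 0 j)) -> specb Om (diag_mx l) 1.
Proof.
move=> lO m n N Cf c c0 Cc X; rewrite mul1r !frob2_col mulr_sumr.
apply: ler_sum => j _; have := Cc _ (lO j) (col j X).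
suff -> : mvpoly_eval Cf (l 0 j) *m col j X = col j (papp Cf X (diag_mx l)) by [].
rewrite /mvpoly_eval /papp mulmx_suml; apply/colP => i; rewrite !mxE !summxE.
apply: eq_bigr => k _; rewrite [RHS]mxE.
have e p : (diag_mx l ^+ k)^T p j = (l 0 j ^+ k) *+ (p == j).
  rewrite mxE; elim: (nat_of_ord k) p => [|q IH] p.
    by rewrite !expr0 mxE eq_sym.
  rewrite (_ : diag_mx l ^+ q.+1 = diag_mx l *m diag_mx l ^+ q); last by rewrite exprS.
  rewrite mul_diag_mx mxE IH exprS; case: eqVneq => // _.
  by rewrite !mulr0n mulr0.
rewrite (bigD1 j) //= big1 ?addr0 => [|p pj]; last by rewrite e (negbTE pj) mulr0.
rewrite e eqxx mulr1n -scalemxAl !mxE mulrC; congr (_ * _).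
by apply: eq_bigr => p _; rewrite !mxE.
Qed.

End ThreeByThree.

Section OddCanonicalForm.
Variable R : realType.
Local Notation C := R[i].

(** Opposite off-diagonal entries have product 1, so the eigenvalues are 0 and +-sqrt 2 for all
    nonzero [u], [v], and diagonal similarities only rescale [u] and [v]. *)
Definition odd3 (u v : R) : 'M[C]_3 :=
  tridiag3 0 u%:C (v^-1)%:C (u^-1)%:C v%:C.

Lemma odd3_similar (u v x y : R) : x != 0 -> y != 0 ->
  dg3 x^-1 1^-1 y^-1 *m odd3 (x * u) (y * v) *m dg3 x 1 y = odd3 u v.
Proof.
move=> x0 y0; rewrite /odd3 !tridiag3_mx3 /dg3 !mul_mx3 invr1.
rewrite !(mul0r, mulr0, addr0, add0r) -!realCM !mulr1 !mul1r.
have -> : x^-1 * (x * u) = u by rewrite mulKf.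
have -> : y^-1 * (y * v) = v by rewrite mulKf.
have -> : (x * u)^-1 * x = u^-1 by rewrite invfM mulrAC mulVf ?mul1r.
by have -> : (y * v)^-1 * y = v^-1 by rewrite invfM mulrAC mulVf ?mul1r.
Qed.

Lemma odd3_cube (u v : R) : u != 0 -> v != 0 ->
  odd3 u v *m (odd3 u v *m odd3 u v) = 2%:C *: odd3 u v.
Proof.
move=> u0 v0; rewrite /odd3 !tridiag3_mx3 !mul_mx3 scale_mx3.
rewrite !(mul0r, mulr0, addr0, add0r) -!realCM -!realCD -!realCM.
by congr mx3; rewrite ?mulr0 //; congr (_%:C); field; rewrite ?u0 ?v0.
Qed.

Lemma horner_mx_cube d (T : 'M[C]_d.+1) (y : R) (q : {poly R}) :
  T *m (T *m T) = y%:C *: T ->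
  horner_mx T ('X * (map_poly (real_complex R) q \Po 'X^2)) = q.[y]%:C *: T.
Proof.
move=> T3; rewrite rmorphM /= horner_mx_X.
elim/poly_ind: q => [|q c IH].
  by rewrite rmorph0 comp_poly0 rmorph0 mulr0 horner0 scale0r.
rewrite rmorphD rmorphM /= map_polyX map_polyC /= comp_polyD comp_polyM comp_polyX comp_polyC.
rewrite rmorphD rmorphM /= horner_mx_C rmorphXn /= horner_mx_X mulrDr mulrA IH.
rewrite -[X in X * _ ^+ 2 + _]/(_ *: T) -[_ * T ^+ 2]/(mulmx _ (T ^+ 2)) -scalemxAl.
rewrite [T ^+ 2]expr2 -[T * T]/(mulmx T T) T3 -[T * c%:C%:M]/(mulmx _ _) mul_mx_scalar.
by rewrite scalerA -scalerDl !hornerE realCD realCM.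
Qed.

(** The matrix exchanges the middle coordinate with the outer pair, so the two conditions bound its
    two orthogonal rank-one pieces separately. *)
Lemma odd3_contraction (u v k : R) : 0 < u -> 0 < v -> 0 < k ->
  u ^+ 2 + v ^+ 2 <= k ^+ 2 -> u^-1 ^+ 2 + v^-1 ^+ 2 <= k ^+ 2 ->
  bdd2 (k^-1%:C *: odd3 u v) 1.
Proof.
move=> u0 v0 k0 h1 h2.
have -> : (1 : R) = sqn (k^-1%:C) * k ^+ 2.
  by rewrite sqn_real -exprMn mulVf ?expr1n // gt_eqF.
apply: bdd2Z; rewrite /odd3 tridiag3_mx3; apply: bdd2_mx3 => x y z.
rewrite !(mul0r, addr0, add0r) !sqnM !sqn_real.
have h3 : sqn (u^-1%:C * x + v^-1%:C * z) <= (u^-1 ^+ 2 + v^-1 ^+ 2) * (sqn x + sqn z).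
  case: x => a b; case: z => c d; rewrite /sqn /= !mul0r !subr0 !addr0.
  set U := u^-1; set V := v^-1.
  have := sqr_ge0 (U * c - V * a); have := sqr_ge0 (U * d - V * b); nra.
have := sqn_ge0 x; have := sqn_ge0 y; have := sqn_ge0 z.
move: h3; set X := sqn x; set Y := sqn y; set Z := sqn z; set W := sqn _ => h3 Z0 Y0 X0.
have h4 := ler_wpM2r Y0 h1; have h5 := ler_wpM2r (addr_ge0 X0 Z0) h2.
by lra.
Qed.

Lemma odd3_hermitian_specb (Om : set C) :
  Om 0 -> Om (Num.sqrt 2)%:C -> Om (- (Num.sqrt 2)%:C) -> specb Om (odd3 1 1) 1.
Proof.
move=> O0 Op On; set m : R := Num.sqrt 2.
have m2 : m * m = 2 by rewrite -expr2 sqr_sqrtr.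
pose l : 'rV[C]_3 := \row_i nth 0 [:: m%:C; 0; - m%:C] i.
pose U := mx3 (2^-1)%:C (m / 2)%:C (2^-1)%:C (m / 2)%:C 0 (- (m / 2))%:C
              (2^-1)%:C (- (m / 2))%:C (2^-1)%:C.
have dl : diag_mx l = dg3 m 0 (- m).
  by apply/matrixP; elim/ord3P; elim/ord3P; rewrite !mxE /= ?mulr1n ?mulr0n ?realCN.
have UA : adjointmx U = U by rewrite /U adjoint_mx3 !conjc_real ?conjc0.
have -> : odd3 1 1 = U *m diag_mx l *m adjointmx U.
  rewrite UA dl /U /dg3 /odd3 tridiag3_mx3 !mul_mx3 invr1.
  rewrite -![0 : C]/(0%:C) -!realCM -!realCD -!realCM -!realCD.
  by congr mx3; congr (_%:C); nra.
apply: specb_unitary => //.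
  rewrite UA /U mul_mx3 scalar_mx3 -![0 : C]/(0%:C) -[1 : C]/(1%:C) -!realCM -!realCD.
  by congr mx3; congr (_%:C); nra.
by apply: specb_diag_mx; elim/ord3P; rewrite !mxE.
Qed.

(** With middle coordinate 1/sqrt 2, the form is real-linear in the outer coordinates. These are the
    shortest solution for the prescribed real and imaginary parts, plus [t] times an orthogonal real
    vector that fills the norm up to 1. *)
Lemma odd3_numerical_range (u v : R) (z : C)
    (P := (u + u^-1) ^+ 2 + (v + v^-1) ^+ 2)
    (Q := (u^-1 - u) ^+ 2 + (v^-1 - v) ^+ 2) :
  0 < u -> 0 < v -> (Q = 0 -> complex.Im z = 0) ->
  4 * (complex.Re z ^+ 2 / P + complex.Im z ^+ 2 / Q) <= 1 ->
  numerical_range (odd3 u v) z.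
Proof.
move=> u0 v0; case: z => X Y /= Q0 hz.
have P0 : 0 < P.
  by rewrite /P ltr_wpDr ?sqr_ge0 // exprn_gt0 // addr_gt0 // invr_gt0.
set m : R := Num.sqrt 2.
have m2 : m * m = 2 by rewrite -expr2 sqr_sqrtr.
have m0 : m != 0 by rewrite gt_eqF // sqrtr_gt0.
pose w := 2^-1 - 2 * X ^+ 2 / P - 2 * Y ^+ 2 / Q.
have w0 : 0 <= w.
  have -> : w = 2^-1 - 2 * (X ^+ 2 / P) - 2 * (Y ^+ 2 / Q) by rewrite /w; ring.
  by move: hz; set a := X ^+ 2 / P; set b := Y ^+ 2 / Q; lra.
pose t := Num.sqrt (w / P).
have t2 : t ^+ 2 = w / P by rewrite sqr_sqrtr // divr_ge0 // ltW.
pose p0 := m * X / P; pose q0 := m * Y / Q.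
pose y1 : C := Complex (p0 * (u + u^-1) - t * (v + v^-1)) (q0 * (u^-1 - u)).
pose y2 : C := Complex (p0 * (v + v^-1) + t * (u + u^-1)) (q0 * (v^-1 - v)).
(* If [Q = 0], the range is a real segment and [Y = 0], so the default value of the quotient is the
   right one. *)
have YQ : Y / Q * Q = Y.
  by have [Qe|Qn] := eqVneq Q 0; [rewrite Q0 // !mul0r | rewrite divfK].
have n1 : sqn y1 + sqn (m / 2)%:C + sqn y2 = 1.
  rewrite sqn_real /sqn /=.
  transitivity (p0 ^+ 2 * P + t ^+ 2 * P + q0 ^+ 2 * Q + (m * m) / 4).
    by rewrite /P /Q; field; rewrite !gt_eqF.
  rewrite t2 m2 divfK ?gt_eqF //.
  have -> : p0 ^+ 2 * P = 2 * X ^+ 2 / P by rewrite /p0 -m2; field; rewrite gt_eqF.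
  have -> : q0 ^+ 2 * Q = 2 * Y ^+ 2 / Q.
    transitivity ((m * m) * (Y / Q) * (Y / Q * Q)); first by rewrite /q0; ring.
    by rewrite YQ m2; ring.
  by rewrite /w; set e1 := 2 * X ^+ 2 / P; set e2 := 2 * Y ^+ 2 / Q; lra.
have := @numerical_range_mx3 R (odd3 u v) _ _ _ n1.
rewrite /odd3 tridiag3_mx3 mul_mx3_cv3 dot_cv3; congr (numerical_range _ _).
have e1 : m / 2 * (p0 * P) = X.
  by transitivity ((m * m) / 2 * X); [rewrite /p0; field; rewrite gt_eqF | rewrite m2; field].
have e2 : m / 2 * (q0 * Q) = Y.
  transitivity ((m * m) / 2 * (Y / Q * Q)); first by rewrite /q0; ring.
  by rewrite YQ m2; field.
apply/eqP; rewrite eq_complex /=; apply/andP; split; apply/eqP.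
  by rewrite -[RHS]e1 /P; ring.
by rewrite -[RHS]e2 /Q; ring.
Qed.

(* Landen's transformation: [z |-> z^2 - 2 r], a Chebyshev polynomial up to
   scaling, maps the ellipse of semi-axes 1 + r, 1 - r onto the one of
   semi-axes 1 + r^2, 1 - r^2. *)
Lemma ellipse_of_square (r : R) (z : C) : 0 < r -> r < 1 ->
  Normc.normc (z ^+ 2) + Normc.normc (z ^+ 2 - (4 * r)%:C) <= 2 + 2 * r ^+ 2 ->
  complex.Re z ^+ 2 / (1 + r) ^+ 2 + complex.Im z ^+ 2 / (1 - r) ^+ 2 <= 1.
Proof.
move=> r0 r1; rewrite ncX normc_sqr => h.
have z0 := sqn_ge0 z.
have h2 : Normc.normc (z ^+ 2 - (4 * r)%:C) <= 2 + 2 * r ^+ 2 - sqn z by lra.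
have h3 : 0 <= 2 + 2 * r ^+ 2 - sqn z by apply: le_trans h2; apply: nc_ge0.
rewrite nc_le // in h2; move: h2; case: z {h h3 z0} => X Y; rewrite /sqn /= => h.
have p1 : 0 < (1 + r) ^+ 2 by rewrite exprn_gt0 //; lra.
have p2 : 0 < (1 - r) ^+ 2 by rewrite exprn_gt0 //; lra.
have -> : X ^+ 2 / (1 + r) ^+ 2 + Y ^+ 2 / (1 - r) ^+ 2 =
   (X ^+ 2 * (1 - r) ^+ 2 + Y ^+ 2 * (1 + r) ^+ 2) / ((1 + r) ^+ 2 * (1 - r) ^+ 2).
  by field; apply/andP; split; apply/eqP; lra.
rewrite (ler_pdivrMr _ _ (mulr_gt0 p1 p2)) mul1r.
by move: h; rewrite !subr0; nra.
Qed.

End OddCanonicalForm.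

(** * The spectral constant of the odd canonical form *)

Section OddSpectralConstant.
Variable R : realType.
Local Notation C := R[i].

(** [A], [B] stand for [u^2], [v^2], and [h1], [1], [h2] for the squared diagonal entries of the
    similarity. The bounds by [K] make the scaled matrix a contraction up to sqrt [K]; the others
    say that the condition number is at most 2. *)
Lemma balancing_weights_le (A B a : R) (S := A + A^-1 + (B + B^-1)) (K := a + a^-1) :
  0 < A -> 0 < B -> B <= A -> 0 < a -> a < 1 -> S = a + 4 / a ->
  exists h1 h2, [/\ 0 < h1, 0 < h2,
    h1 * A + h2 * B <= K /\ (h1 * A)^-1 + (h2 * B)^-1 <= K,
    [/\ 1 <= 4 * h1, h1 <= 4, 1 <= 4 * h2 & h2 <= 4] &
    h1 <= 4 * h2 /\ h2 <= 4 * h1].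
Proof.
move=> A0 B0 BA a0 a1 SE.
have iA0 : 0 < A^-1 by rewrite invr_gt0.
have iB0 : 0 < B^-1 by rewrite invr_gt0.
have ia0 : 0 < a^-1 by rewrite invr_gt0.
have AA : A * A^-1 = 1 by rewrite mulfV ?gt_eqF.
have BB : B * B^-1 = 1 by rewrite mulfV ?gt_eqF.
have aa : a * a^-1 = 1 by rewrite mulfV ?gt_eqF.
have A2 : 2 <= A + A^-1 by have := sqr_ge0 (A - 1); nra.
have B2 : 2 <= B + B^-1 by have := sqr_ge0 (B - 1); nra.
have Ale : A <= 4 / a by move: SE; rewrite /S; lra.
have iBle : B^-1 <= 4 / a by move: SE; rewrite /S; lra.
have K0 : 0 < K by rewrite addr_gt0.
have SK : S <= 4 * K by rewrite SE /K; lra.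
(* S factors as (A/B + 1) (B + 1/A) = (x + 1/x) (y + 1/y) with x^2 = A/B. *)
have ratio : A <= B * (4 * a^-1 ^+ 2).
  pose x := Num.sqrt (A / B); have x0 : 0 < x by rewrite sqrtr_gt0 divr_gt0.
  have x2 : x ^+ 2 = A / B by rewrite sqr_sqrtr // ltW // divr_gt0.
  have AE : A = x ^+ 2 * B by rewrite x2 divfK // gt_eqF.
  have ix0 : 0 < x^-1 by rewrite invr_gt0.
  have xx : x * x^-1 = 1 by rewrite mulfV // gt_eqF.
  pose w := x * B; have w0 : 0 < w by rewrite mulr_gt0.
  have ww : 2 <= w + w^-1.
    have iw : w * w^-1 = 1 by rewrite mulfV // gt_eqF.
    have : 0 < w^-1 by rewrite invr_gt0.
    by have := sqr_ge0 (w - 1); nra.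
  have Sx : S = (x + x^-1) * (w + w^-1).
    by rewrite /S {1 2}AE /w; field; rewrite !gt_eqF.
  have h : (x + x^-1) * 2 <= a + 4 / a.
    by rewrite -SE Sx ler_wpM2l // ltW // addr_gt0.
  have x1 : x <= 2 / a.
    rewrite leNgt; apply/negP => hx.
    have hx2 : x^-1 < a / 2.
      by rewrite -[a / 2]invrK ltf_pV2 ?posrE ?invr_gt0 ?divr_gt0 // invf_div.
    have : (x - 2 / a) * (x^-1 - a / 2) < 0 by nra.
    have : 0 < (x - 2 / a) * (1 - x^-1 * (a / 2)) by apply: mulr_gt0; nra.
    nra.
  rewrite AE mulrC ler_pM2l // -[4](_ : 2 ^+ 2 = _) -?exprMn; last by ring.
  by rewrite ler_sqr ?nnegrE ?(ltW x0) // mulr_ge0 // ltW.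
(* If q = A/B is at most a^-2, equal weights work: both bounds by [K] are compatible because 2 + q +
   1/q <= K^2 for 1 <= q <= a^-2. *)
have [hAB|hAB] := leP A (B * a^-1 ^+ 2).
  pose h := Num.min 4 (K / (A + B)).
  have AB0 : 0 < A + B by rewrite addr_gt0.
  have h0 : 0 < h by rewrite lt_min divr_gt0 // andbT.
  have h4 : h <= 4 by rewrite ge_min lexx.
  have h14 : 1 <= 4 * h.
    have : 4^-1 <= h.
      rewrite le_min ler_pdivlMr //; apply/andP; split; first by lra.
      by move: SK; rewrite /S; lra.
    by lra.
  have hK1 : h * (A + B) <= K by rewrite -ler_pdivlMr // ge_min lexx orbT.
  have hK2 : A^-1 + B^-1 <= h * K.
    rewrite /h minr_pMl ?(ltW K0) // le_min; apply/andP; split.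
      by move: SK; rewrite /S; lra.
    rewrite mulrAC ler_pdivlMr //.
    have -> : (A^-1 + B^-1) * (A + B) = 2 + A / B + B / A by field; rewrite !gt_eqF.
    pose q := A / B; have q1 : 1 <= q by rewrite ler_pdivlMr // mul1r.
    have q2 : q <= a^-1 ^+ 2 by rewrite ler_pdivrMr // mulrC.
    have -> : B / A = q^-1 by rewrite invf_div.
    have q0 : 0 < q by apply: lt_le_trans q1.
    have iq : q * q^-1 = 1 by rewrite mulfV // gt_eqF.
    have iq0 : 0 < q^-1 by rewrite invr_gt0.
    have e : (a^-1 ^+ 2) * (a ^+ 2) = 1 by rewrite -exprMn mulrC aa expr1n.
    have a2 : a ^+ 2 <= q^-1.
      rewrite -(ler_pM2l q0) iq; apply: le_trans (ler_wpM2r (sqr_ge0 a) q2) _.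
      by rewrite e.
    have : 0 <= (a^-1 ^+ 2 - q) * (1 - a ^+ 2 * q^-1).
      apply: mulr_ge0; first by lra.
      have : q^-1 <= 1 by rewrite invf_le1.
      have : a ^+ 2 <= 1 by rewrite expr_le1 // ltW.
      by have := sqr_ge0 a; nra.
    have -> : K * K = 2 + a ^+ 2 + a^-1 ^+ 2.
      by transitivity (2 * (a * a^-1) + a ^+ 2 + a^-1 ^+ 2); [rewrite /K; ring | rewrite aa mulr1].
    rewrite -/q; move: e iq; set b := a^-1 ^+ 2; set c := a ^+ 2; set d := q^-1.
    move=> e iq; have -> : (b - q) * (1 - c * d) = b - q - (b * c) * d + (q * d) * c by ring.
    by rewrite e iq; lra.
  exists h, h; split => //; last by lra.
  split; first by rewrite -mulrDr.
  by rewrite !invfM -mulrDr mulrC ler_pdivrMr // mulrC.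
(* Otherwise both sums are made equal to [K] by h1 A = 1/a and h2 B = a; [ratio] gives
   [h2 <= 4 h1]. *)
pose h1 := (a * A)^-1; pose h2 := a / B.
have h10 : 0 < h1 by rewrite invr_gt0 mulr_gt0.
have h20 : 0 < h2 by rewrite divr_gt0.
have g1 : h1 * A = a^-1 by rewrite /h1 invfM -mulrA mulVf ?mulr1 // gt_eqF.
have g2 : h2 * B = a by rewrite /h2 divfK // gt_eqF.
have h14 : 1 <= 4 * h1.
  rewrite /h1 ler_pdivlMr ?mulr_gt0 // mul1r.
  by have := ler_wpM2l (ltW a0) Ale; rewrite mulrCA aa mulr1.
have h24 : h2 <= 4.
  rewrite /h2; have := ler_wpM2l (ltW a0) iBle.
  by rewrite mulrCA aa mulr1.
have h12 : h1 <= h2.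
  rewrite /h1 /h2 invfM -(ler_pM2r A0) -mulrA mulVf ?mulr1 ?gt_eqF //.
  have := ler_wpM2l (ltW (mulr_gt0 a0 iB0)) (ltW hAB).
  have -> : a / B * (B * a^-1 ^+ 2) = a^-1 by field; rewrite !gt_eqF.
  by [].
have h21 : h2 <= 4 * h1.
  rewrite /h1 /h2 ler_pdivlMr ?mulr_gt0 //.
  have := ler_wpM2l (ltW (mulr_gt0 (exprn_gt0 2 a0) iB0)) ratio.
  have -> : a ^+ 2 / B * (B * (4 * a^-1 ^+ 2)) = 4 by field; rewrite !gt_eqF.
  by have -> : a ^+ 2 / B * A = a / B * (a * A) by ring.
exists h1, h2; split => //.
- by rewrite g1 g2 invrK /K addrC; split => //; rewrite addrC.
- by split => //; lra.
- by split => //; lra.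
Qed.

Lemma balancing_weights (A B a : R) (K := a + a^-1) :
  0 < A -> 0 < B -> 0 < a -> a < 1 -> A + A^-1 + (B + B^-1) = a + 4 / a ->
  exists h1 h2, [/\ 0 < h1, 0 < h2,
    h1 * A + h2 * B <= K /\ (h1 * A)^-1 + (h2 * B)^-1 <= K,
    [/\ 1 <= 4 * h1, h1 <= 4, 1 <= 4 * h2 & h2 <= 4] &
    h1 <= 4 * h2 /\ h2 <= 4 * h1].
Proof.
move=> A0 B0 a0 a1 SE; have [BA|/ltW AB] := leP B A.
  exact: balancing_weights_le.
have [|h1 [h2 [h10 h20 [e1 e2] [f1 f2 f3 f4] [k1 k2]]]] :=
  @balancing_weights_le B A a B0 A0 AB a0 a1; first by rewrite addrC.
by exists h2, h1; split => //; split => //; rewrite addrC.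
Qed.

(** The range contains the ellipse with semi-axes (1 + r)/sqrt(2 r) and (1 - r)/sqrt(2 r). For r >=
    1/2, [u] and [v] are close enough to 1 for a similarity of condition number 2 to the Hermitian
    [odd3 1 1], whose spectrum lies in the range; for r < 1/2 the polynomial map is available. *)
Lemma odd3_specb (u v r : R) : 0 < u -> 0 < v -> 0 < r -> r <= 1 ->
  u ^+ 2 + u^-1 ^+ 2 + (v ^+ 2 + v^-1 ^+ 2) = 2 * (r + r^-1) ->
  specb (numerical_range (odd3 u v)) (odd3 u v) 4.
Proof.
move=> u0 v0 r0 r1 SE; set Om := numerical_range _.
have un0 : u != 0 by rewrite gt_eqF.
have vn0 : v != 0 by rewrite gt_eqF.
have rn0 : r != 0 by rewrite gt_eqF.
have uu : u * u^-1 = 1 by rewrite mulfV.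
have vv : v * v^-1 = 1 by rewrite mulfV.
have PE : (u + u^-1) ^+ 2 + (v + v^-1) ^+ 2 = 2 * (1 + r) ^+ 2 / r.
  transitivity (u ^+ 2 + u^-1 ^+ 2 + (v ^+ 2 + v^-1 ^+ 2) + 2 * (u * u^-1) + 2 * (v * v^-1)).
    by ring.
  by rewrite SE uu vv; field.
have QE : (u^-1 - u) ^+ 2 + (v^-1 - v) ^+ 2 = 2 * (1 - r) ^+ 2 / r.
  transitivity (u ^+ 2 + u^-1 ^+ 2 + (v ^+ 2 + v^-1 ^+ 2) - 2 * (u * u^-1) - 2 * (v * v^-1)).
    by ring.
  by rewrite SE uu vv; field.
have p1 : 0 < (1 + r) ^+ 2 by rewrite exprn_gt0 //; lra.
have r1n : 1 + r != 0 by rewrite gt_eqF // addr_gt0.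
have [r2|r2] := leP (2^-1) r.
  have W (x : R) : x ^+ 2 <= 2 -> Om x%:C.
    move=> x2; rewrite /Om; apply: odd3_numerical_range => //=; rewrite PE expr0n /= mul0r addr0.
    have -> : 4 * (x ^+ 2 / (2 * (1 + r) ^+ 2 / r)) = 2 * r * x ^+ 2 / (1 + r) ^+ 2.
      by field; rewrite ?rn0 ?r1n.
    rewrite ler_pdivrMr // mul1r; have := sqr_ge0 (1 - r); nra.
  have b (x : R) : 0 < x -> x ^+ 2 + x^-1 ^+ 2 <= 3 -> (x <= 2) && (x^-1 <= 2).
    move=> x0 h; have xi : 0 < x^-1 by rewrite invr_gt0.
    by apply/andP; split; nra.
  have rr : r + r^-1 <= 5 / 2.
    have : r * r^-1 = 1 by rewrite mulfV.
    have : r^-1 <= 2 by rewrite -[2]invrK lef_pV2 ?posrE ?invr_gt0.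
    have : 0 < r^-1 by rewrite invr_gt0.
    nra.
  have sq2 (x : R) : 0 < x -> 2 <= x ^+ 2 + x^-1 ^+ 2.
    move=> x0; have xx : x * x^-1 = 1 by rewrite mulfV // gt_eqF.
    by have := sqr_ge0 (x - x^-1); nra.
  have /andP[ub uib] : (u <= 2) && (u^-1 <= 2) by apply: b => //; have := sq2 v v0; lra.
  have /andP[vb vib] : (v <= 2) && (v^-1 <= 2) by apply: b => //; have := sq2 u u0; lra.
  (* The sum factors as (q + 1/q)(w + 1/w) with q = y/x and w = x y, and q > 2 would push it above
     5. *)
  have ratio (x y : R) : 0 < x -> 0 < y ->
      x ^+ 2 + x^-1 ^+ 2 + (y ^+ 2 + y^-1 ^+ 2) <= 5 -> x^-1 <= 2 * y^-1.
    move=> x0 y0 h; have xi : 0 < x^-1 by rewrite invr_gt0.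
    have xx : x * x^-1 = 1 by rewrite mulfV // gt_eqF.
    have yy : y * y^-1 = 1 by rewrite mulfV // gt_eqF.
    rewrite leNgt; apply/negP => hx.
    have hq : 2 < y / x by rewrite ltr_pdivlMr //; nra.
    pose q := y / x; have q0 : 0 < q by apply: lt_trans hq.
    pose w := x * y; have w0 : 0 < w by rewrite mulr_gt0.
    have ww : 2 <= w + w^-1.
      have iw : w * w^-1 = 1 by rewrite mulfV // gt_eqF.
      have : 0 < w^-1 by rewrite invr_gt0.
      by have := sqr_ge0 (w - 1); nra.
    have E : x ^+ 2 + x^-1 ^+ 2 + (y ^+ 2 + y^-1 ^+ 2) = (q + q^-1) * (w + w^-1).
      by rewrite /q /w; field; rewrite !gt_eqF.
    have qq : q * q^-1 = 1 by rewrite mulfV // gt_eqF.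
    have q5 : 5 / 2 < q + q^-1.
      have : 0 < (q - 2) * (1 - q^-1 / 2).
        apply: mulr_gt0; first by rewrite subr_gt0.
        have : q^-1 < 2^-1 by rewrite ltf_pV2 ?posrE.
        by lra.
      by nra.
    by move: h; rewrite E; nra.
  have -> : odd3 u v = dg3 u^-1^-1 1^-1 v^-1^-1 *m odd3 (u^-1 * u) (v^-1 * v) *m dg3 u^-1 1 v^-1.
    by rewrite odd3_similar // invr_eq0.
  rewrite !mulVf //; apply: specb_dg3; rewrite ?invr_gt0 ?mulr1 //.
  - by apply: ratio => //; lra.
  - by rewrite -ler_pdivrMl // mulr1 -[leRHS]invrK lef_pV2 ?posrE ?invr_gt0 //; lra.
  - by rewrite -ler_pdivrMl // mulr1 -[leRHS]invrK lef_pV2 ?posrE ?invr_gt0 //; lra.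
  - by apply: ratio => //; lra.
  - apply: odd3_hermitian_specb.
    + by apply: (W 0); rewrite expr0n.
    + by apply: W; rewrite sqr_sqrtr.
    + by rewrite -realCN; apply: W; rewrite sqrrN sqr_sqrtr.
have r2n : 1 - r != 0 by rewrite gt_eqF //; lra.
pose a := 2 * r; have a0 : 0 < a by rewrite mulr_gt0.
have a1 : a < 1 by rewrite /a; lra.
have an0 : a != 0 by rewrite gt_eqF.
pose K := a + a^-1.
have K0 : 0 < K by rewrite addr_gt0 // invr_gt0.
have := @balancing_weights (u ^+ 2) (v ^+ 2) a; rewrite -!exprVn -/K.
case; rewrite ?exprn_gt0 //; first by rewrite SE /a; field.
move=> h1 [h2 [h10 h20 [K1 K2] [b1 b2 b3 b4] [b5 b6]]].
pose l1 := Num.sqrt h1; pose l2 := Num.sqrt h2.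
have l10 : 0 < l1 by rewrite sqrtr_gt0.
have l20 : 0 < l2 by rewrite sqrtr_gt0.
have l1E : l1 ^+ 2 = h1 by rewrite sqr_sqrtr // ltW.
have l2E : l2 ^+ 2 = h2 by rewrite sqr_sqrtr // ltW.
have -> : odd3 u v = dg3 l1^-1 1^-1 l2^-1 *m odd3 (l1 * u) (l2 * v) *m dg3 l1 1 l2.
  by rewrite odd3_similar // gt_eqF.
have le2 (x y : R) : 0 < x -> 0 < y -> x ^+ 2 <= 4 * y ^+ 2 -> x <= 2 * y.
  move=> x0 y0 h; rewrite -ler_sqr ?nnegrE ?mulr_ge0 ?(ltW x0) ?(ltW y0) //.
  by rewrite exprMn -natrX.
have l1b : l1 <= 2 * 1 by apply: le2 => //; rewrite l1E expr1n mulr1.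
have l2b : l2 <= 2 * 1 by apply: le2 => //; rewrite l2E expr1n mulr1.
apply: specb_dg3 => //; try by apply: le2 => //; rewrite ?l1E ?l2E ?expr1n.
set g1 := l1 * u; set g2 := l2 * v.
have g10 : 0 < g1 by rewrite mulr_gt0.
have g20 : 0 < g2 by rewrite mulr_gt0.
pose k := Num.sqrt K; have k0 : 0 < k by rewrite sqrtr_gt0.
have k2 : k ^+ 2 = K by rewrite sqr_sqrtr // ltW.
pose T := k^-1%:C *: odd3 g1 g2.
have T1 : bdd2 T 1.
  apply: odd3_contraction => //; rewrite k2 ?exprVn /g1 /g2 !exprMn l1E l2E //.
have vN := von_neumann T1.
have [q [qy hq hcirc]] := exists_square_root_poly a0 a1.
set y := 2 * a / (1 + a ^+ 2) in qy hq.
have a21 : 1 + a ^+ 2 != 0 by rewrite gt_eqF // ltr_pwDl // sqr_ge0.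
have yK : y * K = 2 by rewrite /y /K; field; rewrite a21 an0.
have y0 : 0 < y by rewrite -(pmulr_lgt0 _ K0) yK.
(* [t(T) = c q(y) T] has to equal [k T]. The bound on [q] becomes [c^2 a <= 1], which is what places
   [c] times the ellipse with semi-axes 1 + r, 1 - r inside the range. *)
pose c := k / q.[y].
have c0 : 0 < c by rewrite divr_gt0.
have ca : c ^+ 2 * a <= 1.
  rewrite /c expr_div_n k2 mulrAC ler_pdivrMr ?exprn_gt0 // mul1r.
  rewrite -(ler_pM2l (mulr_gt0 y0 (ltr0Sn R 1))).
  have -> : y * 2 * (K * a) = (y * K) * (2 * a) by ring.
  by rewrite yK; nra.
pose t : {poly C} := c%:C *: ('X * (map_poly (real_complex R) q \Po 'X^2)).
have tT : horner_mx T t = odd3 g1 g2.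
  have T3 : T *m (T *m T) = y%:C *: T.
    have cube (e : C) (S : 'M[C]_3) : (e *: S) *m ((e *: S) *m (e *: S)) =
        (e * e * e) *: (S *m (S *m S)).
      by rewrite -!scalemxAl -!scalemxAr !scalerA !mulrA.
    rewrite /T cube odd3_cube ?gt_eqF // !scalerA.
    congr (_ *: _); rewrite -!realCM; congr (_%:C).
    transitivity (k^-1 ^+ 2 * 2 * k^-1); first by ring.
    rewrite -yK -k2; field; by rewrite gt_eqF.
  rewrite linearZ /= (horner_mx_cube q T3) /T !scalerA -!realCM.
  have -> : c * q.[y] * k^-1 = 1.
    by rewrite /c; field; rewrite !gt_eqF.
  by rewrite scale1r.
rewrite -tT; apply: specb_comp vN _ => z /= z1.
pose z0 := z * evc q (z ^+ 2).
have -> : t.[z] = c%:C * z0.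
  by rewrite /t !hornerE horner_comp !hornerE.
have hz0 : complex.Re z0 ^+ 2 / (1 + r) ^+ 2 + complex.Im z0 ^+ 2 / (1 - r) ^+ 2 <= 1.
  apply: ellipse_of_square => //; first by lra.
  have z21 : sqn (z ^+ 2) = 1 by rewrite sqnX z1 expr1n.
  have := hcirc _ z21; rewrite -/(evc q _).
  have -> : z ^+ 2 * evc q (z ^+ 2) ^+ 2 = z0 ^+ 2 by rewrite /z0 exprMn.
  have -> : 2 * a = 4 * r by rewrite /a; ring.
  by have -> : 2 + a ^+ 2 / 2 = 2 + 2 * r ^+ 2 by rewrite /a; field.
have p2 : 0 < (1 - r) ^+ 2 by rewrite exprn_gt0 //; lra.
rewrite /Om; apply: odd3_numerical_range => //.
  by rewrite QE => /eqP; rewrite gt_eqF // divr_gt0 // mulr_gt0.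
rewrite PE QE; case: (z0) hz0 => X Y /= hz0; rewrite !mul0r subr0 addr0.
have -> : 4 * ((c * X) ^+ 2 / (2 * (1 + r) ^+ 2 / r) + (c * Y) ^+ 2 / (2 * (1 - r) ^+ 2 / r)) =
   c ^+ 2 * a * (X ^+ 2 / (1 + r) ^+ 2 + Y ^+ 2 / (1 - r) ^+ 2).
  by rewrite /a; field; rewrite ?rn0 ?r1n ?r2n.
by rewrite mulr_ile1 // ?addr_ge0 ?divr_ge0 ?sqr_ge0 ?ltW // mulr_gt0 // exprn_gt0.
Qed.

End OddSpectralConstant.

(** * Circular numerical ranges *)

Section DiscCase.
Variable R : realType.
Local Notation C := R[i].

Lemma sqn_orthogonal_columns (p q r s y z : C) : p * conjc q + r * conjc s = 0 ->
  sqn (p * y + q * z) + sqn (r * y + s * z) =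
  (sqn p + sqn r) * sqn y + (sqn q + sqn s) * sqn z.
Proof.
move=> h; have h' : conjc p * q + conjc r * s = 0.
  by rewrite -[RHS]conjc0 -h !conjcE.
apply: complexI.
have RD (t u : C) : (sqn t + sqn u)%:C = t * conjc t + u * conjc u.
  by rewrite realCD !sqnE.
rewrite RD [RHS]realCD [X in _ = X + _]realCM [X in _ = _ + X]realCM !RD !sqnE !conjcE.
transitivity ((p * conjc p + r * conjc r) * (y * conjc y) + (q * conjc q + s * conjc s) * (z * conjc z)
   + (p * conjc q + r * conjc s) * (y * conjc z) + (conjc p * q + conjc r * s) * (conjc y * z)).
  by ring.
by rewrite h h' !mul0r !addr0.
Qed.

Definition sandwich3 (a b mu c : C) := mx3 0 a b 0 mu c 0 0 0.

Lemma sandwich3_similar a b mu c (x y z : R) : x != 0 -> y != 0 -> z != 0 ->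
  dg3 x^-1 y^-1 z^-1 *m sandwich3 ((x / y)%:C * a) ((x / z)%:C * b) mu ((y / z)%:C * c) *m dg3 x y z =
  sandwich3 a b mu c.
Proof.
move=> x0 y0 z0; rewrite /sandwich3 /dg3 !mul_mx3 !(mul0r, mulr0, addr0, add0r).
have e (s t : R) w : s != 0 -> t != 0 -> (s^-1)%:C * ((s / t)%:C * w) * t%:C = w.
  move=> s0 t0; transitivity ((s^-1 * (s / t) * t)%:C * w); first by rewrite !realCM; ring.
  have -> : s^-1 * (s / t) * t = 1 by field; rewrite s0 t0.
  by rewrite mul1r.
rewrite !e //; congr mx3; rewrite [_ * mu]mulrC -mulrA -realCM mulVf //.
by rewrite mulr1.
Qed.

(** Conjugation by diag(1/sqrt 2, w, sqrt 2) halves [b]. The relation for [mu] makes the rows of the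
    block [[a, b], [mu, c]] orthogonal for one value of [w^2] and its columns for another; comparing
    |a| with |c| selects a value in [1/2, 2]. One row (column) then has norm 1. *)
Lemma disc_specb1 (Om : set C) (a b mu c : C) :
  sqn a + sqn b + sqn c = 4 -> sqn mu <= 1 ->
  (sqn a + sqn c)%:C * mu + a * c * conjc b = 0 ->
  (forall z, sqn z = 1 -> Om z) -> specb Om (sandwich3 a b mu c) 4.
Proof.
move=> n4 mu1 hmu circ.
set A := sqn a in n4 hmu *; set B := sqn c in n4 hmu *; set D := sqn b in n4 *.
have A0 : 0 <= A by apply: sqn_ge0.
have B0 : 0 <= B by apply: sqn_ge0.
have D0 : 0 <= D by apply: sqn_ge0.
pose m : R := Num.sqrt 2; have m0 : 0 < m by rewrite sqrtr_gt0.
have m2 : m ^+ 2 = 2 by rewrite sqr_sqrtr.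
have mn0 : m != 0 by rewrite gt_eqF.
suff [h [h1 h2 hT]] : exists h, [/\ 2^-1 <= h, h <= 2 &
    forall w, 0 < w -> w ^+ 2 = h ->
    bdd2 (sandwich3 ((m^-1 / w)%:C * a) ((m^-1 / m)%:C * b) mu ((w / m)%:C * c)) 1].
  have h0 : 0 < h by apply: lt_le_trans h1; rewrite invr_gt0.
  pose w := Num.sqrt h; have w0 : 0 < w by rewrite sqrtr_gt0.
  have w2 : w ^+ 2 = h by rewrite sqr_sqrtr // ltW.
  have le2 (x y : R) : 0 < x -> 0 < y -> x ^+ 2 <= 4 * y ^+ 2 -> x <= 2 * y.
    move=> x0 y0 hh; rewrite -ler_sqr ?nnegrE ?mulr_ge0 ?(ltW x0) ?(ltW y0) //.
    by rewrite exprMn -natrX.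
  rewrite -(@sandwich3_similar a b mu c m^-1 w m) ?invr_eq0 ?gt_eqF //.
  have im0 : 0 < m^-1 by rewrite invr_gt0.
  have im2 : m^-1 ^+ 2 = 2^-1 by rewrite exprVn m2.
  apply: specb_dg3 => //; try by apply: le2 => //; rewrite ?im2 ?m2 ?w2; lra.
  apply: specb_sub (von_neumann (hT _ w0 w2)) _ => z /= z1.
  exact: circ.
have mc w : w ^+ 2 != 0 -> sqn ((m^-1 / w)%:C * a) = A / (2 * w ^+ 2).
  move=> w0; rewrite sqnM sqn_real -/A -m2; field; rewrite mn0 andbT.
  by move: w0; rewrite sqrf_eq0.
have cc w : sqn ((w / m)%:C * c) = B * w ^+ 2 / 2.
  by rewrite sqnM sqn_real -/B -m2; field.
have bb : sqn ((m^-1 / m)%:C * b) = D / 4.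
  rewrite sqnM sqn_real -/D; have -> : m^-1 / m = 2^-1 by rewrite -m2; field.
  by field.
have [AB0|ABn] := eqVneq (A + B) 0.
  have a0 : a = 0 by apply/eqP; rewrite -sqn_eq0 -/A; apply/eqP; lra.
  have c0 : c = 0 by apply/eqP; rewrite -sqn_eq0 -/B; apply/eqP; lra.
  exists 1; split; [lra|lra|move=> w w0 w2].
  apply: bdd2_mx3 => x y z.
  rewrite a0 c0 !(mulr0, mul0r, addr0, add0r) sqn0 addr0 !sqnM -sqnM bb mul1r.
  have -> : D / 4 = 1 by lra.
  by have := ler_wpM2r (sqn_ge0 y) mu1; have := sqn_ge0 x; lra.
have AB : 0 < A + B by rewrite lt_neqAle eq_sym ABn addr_ge0.
have ABC : (A + B)%:C != 0 :> C by rewrite -sqn_eq0 sqn_real expf_neq0.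
have muE : mu = - (a * c * conjc b) / (A + B)%:C.
  by apply: (mulIf ABC); rewrite divfK // mulrC; apply/eqP; rewrite -addr_eq0 hmu.
have smu : sqn mu = A * B * D / (A + B) ^+ 2.
  by rewrite muE sqnM sqnV sqn_real sqnN !sqnM sqn_conj.
(* The squared norm of the other row or column; as A + B + D = 4, it is 4 A B / (A + B)^2. *)
have prod4 : A * B * D / (A + B) ^+ 2 + A * B / (A + B) <= 1.
  have -> : D = 4 - (A + B) by lra.
  have -> : A * B * (4 - (A + B)) / (A + B) ^+ 2 + A * B / (A + B) = 4 * A * B / (A + B) ^+ 2.
    by field.
  rewrite ler_pdivrMr ?exprn_gt0 // mul1r; have := sqr_ge0 (A - B); nra.
have aC : a * conjc a = A%:C by rewrite sqnE.
have cC : c * conjc c = B%:C by rewrite sqnE.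
have rw (w : R) : w != 0 -> w%:C != 0 :> C.
  by move=> w0; rewrite -sqn_eq0 sqn_real expf_neq0.
have [BA|/ltW BA] := leP B A.
  have Ap : 0 < A by lra.
  pose h := 2 * A / (A + B).
  have h0 : 0 < h by rewrite divr_gt0 // mulr_gt0.
  exists h; split.
  - by rewrite ler_pdivlMr //; lra.
  - by rewrite ler_pdivrMr //; lra.
  move=> w w0 w2; rewrite -[sandwich3 _ _ _ _]adjointmxK; apply: bdd2_adjoint.
  have wn0 : w != 0 by rewrite gt_eqF.
  have kk : (m^-1 / m * (w / m))%:C = (m^-1 / w)%:C * (a * conjc a) / (A + B)%:C.
    rewrite aC -realCM -realCV -realCM; congr (_%:C).
    transitivity (w ^+ 2 / (m ^+ 2 * m * w)); first by field; rewrite wn0 mn0.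
    by rewrite w2 m2 /h; field; rewrite ABn wn0 mn0.
  have w20 : w ^+ 2 != 0 by rewrite expf_neq0.
  have sa := mc _ w20; have sc := cc w; rewrite w2 in sa sc.
  move: kk sa sc bb; set k1 := m^-1 / w; set k2 := m^-1 / m; set k3 := w / m => kk sa sc bb.
  rewrite /sandwich3 adjoint_mx3 conjc0; apply: bdd2_mx3 => x y z.
  rewrite !(mul0r, addr0, add0r) sqn0 add0r sqn_orthogonal_columns; last first.
    rewrite !conjcK !conjcM !conjc_real.
    transitivity (k1%:C * conjc a * mu + (k2 * k3)%:C * (conjc b * c)).
      by rewrite realCM; ring.
    by rewrite kk muE; field; have := ABC; rewrite realCD.
  rewrite !sqn_conj sa sc bb smu mul1r.
  have e1 : A / (2 * h) + D / 4 = 1.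
    have -> : A / (2 * h) = (A + B) / 4 by rewrite /h; field; rewrite ABn (gt_eqF Ap).
    by lra.
  have e2 : A * B * D / (A + B) ^+ 2 + B * h / 2 <= 1.
    by have -> : B * h / 2 = A * B / (A + B) by rewrite /h; field.
  rewrite e1 mul1r; have := ler_wpM2r (sqn_ge0 y) e2; have := sqn_ge0 z; lra.
have Bp : 0 < B by lra.
have Bn0 : B != 0 by rewrite gt_eqF.
pose h := (A + B) / (2 * B).
have B2 : 0 < 2 * B by rewrite mulr_gt0.
exists h; split.
- by rewrite ler_pdivlMr //; lra.
- by rewrite ler_pdivrMr //; lra.
move=> w w0 w2.
have wn0 : w != 0 by rewrite gt_eqF.
have kk : (m^-1 / w * (m^-1 / m))%:C = (w / m)%:C * (c * conjc c) / (A + B)%:C.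
  rewrite cC -realCM -realCV -realCM; congr (_%:C).
  transitivity (w ^+ 2 * B / (w * m * (A + B))).
    by rewrite w2 /h -m2; field; rewrite ABn wn0 mn0 Bn0.
  by field; rewrite ABn wn0 mn0.
have w20 : w ^+ 2 != 0 by rewrite expf_neq0.
have sa := mc _ w20; have sc := cc w; rewrite w2 in sa sc.
move: kk sa sc bb; set k1 := m^-1 / w; set k2 := m^-1 / m; set k3 := w / m => kk sa sc bb.
apply: bdd2_mx3 => x y z.
rewrite !(mul0r, addr0, add0r) sqn0 addr0 sqn_orthogonal_columns; last first.
  rewrite !conjcM !conjc_real.
  transitivity ((k1 * k2)%:C * (a * conjc b) + k3%:C * mu * conjc c).
    by rewrite (realCM k1 k2); ring.
  by rewrite kk muE; field; have := ABC; rewrite realCD.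
rewrite sa sc bb smu mul1r.
have e1 : D / 4 + B * h / 2 = 1.
  have -> : B * h / 2 = (A + B) / 4 by rewrite /h; field.
  by lra.
have e2 : A / (2 * h) + A * B * D / (A + B) ^+ 2 <= 1.
  have -> : A / (2 * h) = A * B / (A + B) by rewrite /h; field; rewrite ABn Bn0.
  by rewrite addrC.
rewrite e1 mul1r; have := ler_wpM2r (sqn_ge0 y) e2; have := sqn_ge0 x; lra.
Qed.

Lemma disc_specb (Om : set C) (l : R) (a b mu c : C) : 0 < l ->
  sqn a + sqn b + sqn c = 4 * l ^+ 2 -> sqn mu <= l ^+ 2 ->
  (sqn a + sqn c)%:C * mu + a * c * conjc b = 0 ->
  (forall z, sqn z = l ^+ 2 -> Om z) -> specb Om (sandwich3 a b mu c) 4.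
Proof.
move=> l0 n4 mu1 hmu circ.
have ln0 : l != 0 by rewrite gt_eqF.
have lC : l%:C != 0 :> C by rewrite -sqn_eq0 sqn_real expf_neq0.
have l2 : 0 < l ^+ 2 by rewrite exprn_gt0.
have sc w : sqn (l^-1%:C * w) = sqn w / l ^+ 2.
  by rewrite sqnM sqn_real exprVn mulrC.
have -> : sandwich3 a b mu c = 0%:M + l%:C *:
    sandwich3 (l^-1%:C * a) (l^-1%:C * b) (l^-1%:C * mu) (l^-1%:C * c).
  have key w : l%:C * (l^-1%:C * w) = w by rewrite realCV mulVKf.
  by rewrite /sandwich3 scale_mx3 scalar_mx3 add_mx3 !key !mulr0 !add0r.
apply: (@specb_affine _ _ [set z | sqn z = 1]%classic); last first.
  by move=> z /= z1; rewrite add0r; apply: circ; rewrite sqnM sqn_real z1 mulr1.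
apply: disc_specb1 => //.
- by rewrite !sc -!mulrDl n4 mulfK // gt_eqF.
- by rewrite sc ler_pdivrMr // mul1r.
- rewrite !sc -mulrDl realCM conjcM conjc_real !realCV realCX.
  transitivity (l%:C^-1 ^+ 3 * ((sqn a + sqn c)%:C * mu + a * c * conjc b)).
    by field.
  by rewrite hmu mulr0.
Qed.

End DiscCase.

(** * Reduction of tridiagonal matrices *)

Section Tridiagonal.
Variable R : realType.
Local Notation C := R[i].

Definition specb_W (M : 'M[C]_3) := specb (numerical_range M) M 4.

Lemma specb_W_unitary (M U : 'M[C]_3) : adjointmx U *m U = 1%:M ->
  specb_W M -> specb_W (U *m M *m adjointmx U).
Proof.
move=> UU spM; apply: specb_sub (specb_unitary (ler0n _ 4) UU spM) _.
exact: numerical_range_unitary.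
Qed.

Lemma specb_W_affine (M : 'M[C]_3) a s : specb_W M -> specb_W (a%:M + s *: M).
Proof. by move=> spM; apply: specb_affine spM _ => z; apply: numerical_range_affine. Qed.

Lemma specb_W0 : specb_W 0.
Proof.
rewrite /specb_W.
have W0 : numerical_range (0 : 'M[C]_3) 0.
  have := @numerical_range_mx3 R 0 1 0 0; rewrite mul0mx mulmx0 mxE; apply.
  by rewrite sqn1 !sqn0 !addr0.
have -> : (0 : 'M[C]_3) = diag_mx 0.
  by apply/matrixP => i j; rewrite !mxE mul0rn.
move=> m n N Cf c c0 Cc X.
have W0' : forall j, numerical_range (diag_mx 0 : 'M[C]_3) ((0 : 'rV[C]_3) 0 j).
  move=> j; rewrite mxE; have -> : diag_mx (0 : 'rV[C]_3) = 0; last exact: W0.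
  by apply/matrixP => i k; rewrite !mxE mul0rn.
apply: le_trans (specb_diag_mx W0' c0 Cc X) _.
apply: ler_wpM2r; first exact: frob2_ge0.
by apply: ler_wpM2r => //; rewrite ler1n.
Qed.

(* Conjugation by a unitary of the form Q (+) 1, with 1 acting on the middle
   coordinate and (p, q) the first column of Q. *)
Lemma tridiag3_rotate (p q b1 b2 c1 c2 : C) : sqn p + sqn q = 1 ->
  specb_W (tridiag3 0 (conjc p * b1 + conjc q * c2) (- c1 * conjc q + b2 * conjc p)
                      (c1 * p + b2 * q) (- q * b1 + p * c2)) ->
  specb_W (tridiag3 0 b1 b2 c1 c2).
Proof.
move=> pq sp.
have pqC : p * conjc p + q * conjc q = 1 by rewrite -!sqnE -realCD pq.
pose U := mx3 p 0 (- conjc q) 0 1 0 q 0 (conjc p).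
have UU : adjointmx U *m U = 1%:M.
  rewrite /U adjoint_mx3 !conjcE mul_mx3 scalar_mx3.
  rewrite !(mul0r, mulr0, addr0, add0r, mul1r) -pqC; congr mx3; ring.
have := specb_W_unitary UU sp; congr specb_W.
have -> : tridiag3 0 (conjc p * b1 + conjc q * c2) (- c1 * conjc q + b2 * conjc p)
      (c1 * p + b2 * q) (- q * b1 + p * c2) = adjointmx U *m tridiag3 0 b1 b2 c1 c2 *m U.
  rewrite /U adjoint_mx3 !conjcE !tridiag3_mx3 !mul_mx3.
  by rewrite !(mul0r, mulr0, addr0, add0r, mul1r, mulr1); congr mx3; ring.
have UU' : U *m adjointmx U = 1%:M by apply: mulmx1C.
by rewrite !mulmxA UU' mul1mx -mulmxA UU' mulmx1.
Qed.

Lemma normalize_pair (x y : C) : (x, y) != (0, 0) ->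
  exists2 k : R, 0 < k & k ^+ 2 * (sqn x + sqn y) = 1.
Proof.
move=> xy; have s0 : 0 < sqn x + sqn y.
  rewrite lt_neqAle eq_sym addr_ge0 ?sqn_ge0 // andbT paddr_eq0 ?sqn_ge0 //.
  by rewrite !sqn_eq0; apply: contra xy => /andP[/eqP -> /eqP ->].
exists (Num.sqrt (sqn x + sqn y)^-1); first by rewrite sqrtr_gt0 invr_gt0.
by rewrite sqr_sqrtr ?invr_ge0 ?(ltW s0) // mulVf // gt_eqF.
Qed.

Lemma tridiag3_nilpotent_specb (u w : C) : specb_W (tridiag3 0 u w 0 0).
Proof.
pose l := Num.sqrt ((sqn u + sqn w) / 4).
have s0 : 0 <= sqn u + sqn w by rewrite addr_ge0 ?sqn_ge0.
have l2 : l ^+ 2 = (sqn u + sqn w) / 4 by rewrite sqr_sqrtr // divr_ge0.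
have := sqrtr_ge0 ((sqn u + sqn w) / 4); rewrite -/l le_eqVlt => /predU1P[l0|l0].
  have : sqn u + sqn w = 0 by move: l2; rewrite -l0 expr0n /=; lra.
  move/eqP; rewrite paddr_eq0 ?sqn_ge0 // !sqn_eq0 => /andP[/eqP -> /eqP ->].
  suff -> : tridiag3 0 0 0 0 0 = 0 :> 'M[C]_3 by apply: specb_W0.
  by rewrite tridiag3_mx3 -scalar_mx3 raddf0.
have -> : tridiag3 0 u w 0 0 = sandwich3 u 0 0 w by [].
apply: (@disc_specb _ _ l) => //.
- by rewrite sqn0 addr0 l2; field.
- by rewrite sqn0 sqr_ge0.
- by rewrite mulr0 conjc0 mulr0 addr0.
move=> z zl; pose m : R := Num.sqrt 2; have m2 : m ^+ 2 = 2 by rewrite sqr_sqrtr.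
have m0 : m != 0 by rewrite gt_eqF // sqrtr_gt0.
have ln0 : l != 0 by rewrite gt_eqF.
pose k := m / (4 * l ^+ 2).
have n1 : sqn (k%:C * (conjc z * u)) + sqn (m / 2)%:C + sqn (k%:C * (z * conjc w)) = 1.
  rewrite !sqnM !sqn_conj !sqn_real zl.
  transitivity (k ^+ 2 * l ^+ 2 * (sqn u + sqn w) + m ^+ 2 / 4); first by field.
  have -> : sqn u + sqn w = 4 * l ^+ 2 by rewrite l2; field.
  by rewrite /k expr_div_n m2; field.
have := @numerical_range_mx3 R (sandwich3 u 0 0 w) _ _ _ n1.
rewrite /sandwich3 mul_mx3_cv3 dot_cv3; congr (numerical_range _ _).
rewrite !(mul0r, add0r, addr0, mulr0) !conjcE.
transitivity (k%:C * (m / 2)%:C * z * ((sqn u)%:C + (sqn w)%:C)).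
  by rewrite !sqnE; ring.
rewrite -realCD -realCM mulrAC -realCM.
have -> : sqn u + sqn w = 4 * l ^+ 2 by rewrite l2; field.
have -> : k * (m / 2) * (4 * l ^+ 2) = 1.
  by transitivity (m ^+ 2 / 2); [rewrite /k; field | rewrite m2; field].
by rewrite mul1r.
Qed.

Lemma tridiag3_real_moduli (u w : C) : u != 0 -> w != 0 ->
  specb_W (tridiag3 0 u w^-1 u^-1 w).
Proof.
move=> u0 w0; pose s := Num.sqrt (sqn u); pose t := Num.sqrt (sqn w).
have s0 : 0 < s by rewrite sqrtr_gt0 lt_neqAle eq_sym sqn_eq0 u0 sqn_ge0.
have t0 : 0 < t by rewrite sqrtr_gt0 lt_neqAle eq_sym sqn_eq0 w0 sqn_ge0.
have s2 : s ^+ 2 = sqn u by rewrite sqr_sqrtr // sqn_ge0.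
have t2 : t ^+ 2 = sqn w by rewrite sqr_sqrtr // sqn_ge0.
have rC (x : R) : 0 < x -> x%:C != 0 :> C.
  by move=> x0; rewrite -sqn_eq0 sqn_real expf_neq0 // gt_eqF.
pose p := u / s%:C; pose q := w / t%:C.
have pp : conjc p * p = 1.
  by rewrite mulrC -sqnE /p sqnM sqnV sqn_real s2 mulfV // sqn_eq0.
have qq : conjc q * q = 1.
  by rewrite mulrC -sqnE /q sqnM sqnV sqn_real t2 mulfV // sqn_eq0.
pose U := mx3 p 0 0 0 1 0 0 0 q.
have UU : adjointmx U *m U = 1%:M.
  rewrite /U adjoint_mx3 conjc0 conjc1 mul_mx3 scalar_mx3.
  by rewrite !(mul0r, mulr0, addr0, add0r, mul1r) pp qq.
have -> : tridiag3 0 u w^-1 u^-1 w = U *m odd3 s t *m adjointmx U.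
  rewrite /U adjoint_mx3 conjc0 conjc1 /odd3 !tridiag3_mx3 !mul_mx3.
  rewrite !(mul0r, mulr0, addr0, add0r, mul1r, mulr1) !realCV.
  have cp : conjc p = p^-1.
    by apply: (mulIf (_ : p != 0)); rewrite ?pp ?mulVf // mulf_neq0 // invr_eq0 rC.
  have cq : conjc q = q^-1.
    by apply: (mulIf (_ : q != 0)); rewrite ?qq ?mulVf // mulf_neq0 // invr_eq0 rC.
  rewrite cp cq /p /q !divfK ?rC // !invfM !invrK.
  by congr mx3; field; rewrite ?u0 ?w0 ?rC.
apply: specb_W_unitary => //.
pose S := s ^+ 2 + s^-1 ^+ 2 + (t ^+ 2 + t^-1 ^+ 2).
have sq2 (x : R) : 0 < x -> 2 <= x ^+ 2 + x^-1 ^+ 2.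
  move=> x0; have xx : x * x^-1 = 1 by rewrite mulfV // gt_eqF.
  by have := sqr_ge0 (x - x^-1); nra.
have S4 : 4 <= S by have := sq2 _ s0; have := sq2 _ t0; rewrite /S; lra.
(* [r] is the smaller root of r + 1/r = S/2, real since [S >= 4]. *)
pose D := Num.sqrt (S ^+ 2 / 16 - 1).
have D2 : D ^+ 2 = S ^+ 2 / 16 - 1 by rewrite sqr_sqrtr //; nra.
have D0 : 0 <= D by apply: sqrtr_ge0.
pose r := S / 4 - D.
have rr : r * (S / 4 + D) = 1.
  by transitivity (S ^+ 2 / 16 - D ^+ 2); [rewrite /r; field | rewrite D2; ring].
have r0 : 0 < r by rewrite -(pmulr_lgt0 _ (_ : 0 < S / 4 + D)) ?rr //; lra.
have r1 : r <= 1 by rewrite -rr ler_peMr ?(ltW r0) //; lra.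
apply: (@odd3_specb _ s t r) => //.
have -> : r^-1 = S / 4 + D by apply: (mulfI (lt0r_neq0 r0)); rewrite mulfV ?rr // gt_eqF.
by rewrite -/S /r; field.
Qed.

(** The characteristic polynomial is x^3 - (b1 c1 + b2 c2) x, so a vanishing sum is the nilpotent
    case. Otherwise the sum is scaled to 2, and a rotation of the outer coordinates, which preserves
    it, splits it as 1 + 1. *)
Lemma tridiag3_zero_diag (b1 b2 c1 c2 : C) : specb_W (tridiag3 0 b1 b2 c1 c2).
Proof.
have [d0|dn] := eqVneq (b1 * c1 + b2 * c2) 0.
  (* The two linear equations are dependent precisely because the sum vanishes. *)
  suff [p [q [pq e1 e2]]] : exists p q, [/\ sqn p + sqn q = 1,
      c1 * p + b2 * q = 0 & - q * b1 + p * c2 = 0].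
    apply: (tridiag3_rotate pq); rewrite e1 e2; exact: tridiag3_nilpotent_specb.
  have [[x1 x2]|] := eqVneq (b1, c2) (0, 0); last first.
    move=> /normalize_pair[k k0 kE]; exists (k%:C * b1), (k%:C * c2); split.
    - by rewrite !sqnM !sqn_real -mulrDr.
    - by rewrite -[RHS](mulr0 k%:C) -d0; ring.
    - by ring.
  have [[y1 y2]|] := eqVneq (b2, c1) (0, 0).
    by exists 1, 0; rewrite sqn1 sqn0 x1 x2 y1 y2 addr0; split; ring.
  move=> /normalize_pair[k k0 kE]; exists (k%:C * b2), (- (k%:C * c1)); split.
  - by rewrite sqnN !sqnM !sqn_real -mulrDr.
  - by ring.
  - by rewrite x1 x2; ring.
pose sg := sqrtc ((b1 * c1 + b2 * c2) / 2%:C).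
have sg2 : sg ^+ 2 = (b1 * c1 + b2 * c2) / 2%:C by rewrite sqr_sqrtc.
have two : 2%:C != 0 :> C by rewrite -sqn_eq0 sqn_real expf_neq0 // pnatr_eq0.
have sg0 : sg != 0.
  by rewrite -sqrf_eq0 sg2 mulf_neq0 // invr_eq0.
have -> : tridiag3 0 b1 b2 c1 c2 =
    0%:M + sg *: tridiag3 0 (b1 / sg) (b2 / sg) (c1 / sg) (c2 / sg).
  rewrite !tridiag3_mx3 scale_mx3 scalar_mx3 add_mx3 !mulr0 !addr0 !add0r.
  by congr mx3; rewrite mulrCA mulfV // mulr1.
apply: specb_W_affine.
have : (b1 / sg) * (c1 / sg) + (b2 / sg) * (c2 / sg) = 2%:C.
  transitivity ((b1 * c1 + b2 * c2) / sg ^+ 2); first by field.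
  by rewrite sg2 invf_div mulrC divfK.
move: (b1 / sg) (b2 / sg) (c1 / sg) (c2 / sg) => {dn sg sg2 sg0 b1 b2 c1 c2} b1 b2 c1 c2 dE.
have un : (b1, c2) != (0, 0).
  apply/eqP => -[x1 x2]; move: two; rewrite -dE x1 x2 mul0r mulr0 addr0.
  by rewrite eqxx.
have [k k0 kE] := normalize_pair un.
(* At this unit vector the second product is 0 and the first is 2; at an orthogonal one the first is
   0. In between it takes the value 1, and the phase [ep] keeps it real along the way. *)
have [p0 p0E] : exists p0, p0 = k%:C * b1 by eexists.
have [q0 q0E] : exists q0, q0 = k%:C * c2 by eexists.
have pq0 : sqn p0 + sqn q0 = 1 by rewrite p0E q0E !sqnM !sqn_real -mulrDr.
have pq0C : p0 * conjc p0 + q0 * conjc q0 = 1 by rewrite -!sqnE -realCD pq0.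
have kC : k%:C != 0 :> C by rewrite -sqn_eq0 sqn_real expf_neq0 // gt_eqF.
pose ka := - c1 * conjc q0 + b2 * conjc p0.
pose K := Num.sqrt (sqn ka).
have K0 : 0 <= K by apply: sqrtr_ge0.
have K2 : K ^+ 2 = sqn ka by rewrite sqr_sqrtr // sqn_ge0.
have [ep ep1 epK] : exists2 ep, sqn ep = 1 & ep * ka = K%:C.
  have [ka0|kan] := eqVneq ka 0.
    by exists 1; rewrite ?sqn1 // mul1r /K ka0 sqn0 sqrtr0.
  have Kp : 0 < K by rewrite sqrtr_gt0 lt_neqAle eq_sym sqn_eq0 kan sqn_ge0.
  have KC : K%:C != 0 :> C by rewrite -sqn_eq0 sqn_real expf_neq0 // gt_eqF.
  exists (conjc ka / K%:C).
    by rewrite sqnM sqnV sqn_real sqn_conj K2 mulfV // sqn_eq0.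
  by rewrite mulrAC [_ * ka]mulrC -sqnE -K2 realCX expr2 mulfK.
have epC : ep * conjc ep = 1 by rewrite -sqnE ep1.
(* cos and sin of an angle t with cos 2t + w sin 2t = 0 *)
pose w := K / (2 * k); pose h := Num.sqrt (1 + w ^+ 2).
have w0 : 0 <= w by rewrite divr_ge0 // mulr_ge0 // ltW.
have h2 : h ^+ 2 = 1 + w ^+ 2 by rewrite sqr_sqrtr // addr_ge0 // sqr_ge0.
have h0 : 0 < h by rewrite sqrtr_gt0 ltr_pwDl // sqr_ge0.
have wh : w <= h by rewrite -ler_sqr ?nnegrE ?(ltW h0) // h2 lerDr.
pose x := Num.sqrt ((1 - w / h) / 2); pose y := Num.sqrt ((1 + w / h) / 2).
have whh : w / h <= 1 by rewrite ler_pdivrMr // mul1r.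
have wh0 : 0 <= w / h by rewrite divr_ge0 // ltW.
have x2 : x ^+ 2 = (1 - w / h) / 2 by rewrite sqr_sqrtr //; lra.
have y2 : y ^+ 2 = (1 + w / h) / 2 by rewrite sqr_sqrtr //; lra.
have xy : x * y = (2 * h)^-1.
  rewrite -sqrtrM; last by lra.
  have -> : (1 - w / h) / 2 * ((1 + w / h) / 2) = (2 * h)^-1 ^+ 2.
    transitivity ((h ^+ 2 - w ^+ 2) / (4 * h ^+ 2)); first by field; rewrite gt_eqF.
    have -> : h ^+ 2 - w ^+ 2 = 1 by rewrite h2; ring.
    by field; rewrite gt_eqF.
  by rewrite sqrtr_sqr ger0_norm // invr_ge0 mulr_ge0 // ltW.
have key : x ^+ 2 + w * (x * y) = 2^-1 by rewrite x2 xy; field; rewrite gt_eqF.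
pose p := x%:C * p0 - y%:C * ep * conjc q0.
pose q := x%:C * q0 + y%:C * ep * conjc p0.
have pq : sqn p + sqn q = 1.
  apply: complexI; rewrite realCD !sqnE /p /q !conjcE.
  transitivity ((x%:C ^+ 2 + y%:C ^+ 2 * (ep * conjc ep)) * (p0 * conjc p0 + q0 * conjc q0)).
    by ring.
  rewrite epC pq0C !mulr1 -!realCX -realCD x2 y2; congr (_%:C); by field; rewrite gt_eqF.
apply: (tridiag3_rotate pq).
set u1 := conjc p * b1 + conjc q * c2; set w1 := c1 * p + b2 * q.
set w2 := - c1 * conjc q + b2 * conjc p; set u2 := - q * b1 + p * c2.
have u1E : u1 = (x / k)%:C.
  have b1E : b1 = p0 / k%:C by rewrite p0E mulrAC mulfV // mul1r.
  have c2E : c2 = q0 / k%:C by rewrite q0E mulrAC mulfV // mul1r.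
  rewrite /u1 /p /q !conjcE b1E c2E realCM realCV.
  transitivity (x%:C / k%:C * (p0 * conjc p0 + q0 * conjc q0)); first by ring.
  by rewrite pq0C mulr1.
have w1E : w1 = (2 * k * x + y * K)%:C.
  transitivity (x%:C * (c1 * p0 + b2 * q0) + y%:C * (ep * ka)).
    by rewrite /w1 /p /q /ka; ring.
  rewrite epK; have -> : c1 * p0 + b2 * q0 = k%:C * 2%:C by rewrite -dE p0E q0E; ring.
  by rewrite (realCD (2 * k * x)) (realCM (2 * k)) (realCM 2) (realCM y); ring.
have uw1 : u1 * w1 = 1.
  rewrite u1E w1E -realCM.
  have -> : x / k * (2 * k * x + y * K) = 2 * (x ^+ 2 + w * (x * y)).
    by rewrite /w; field; rewrite gt_eqF.
  by rewrite key mulfV // pnatr_eq0.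
have uw2 : u2 * w2 = 1.
  have pqC : p * conjc p + q * conjc q = 1 by rewrite -!sqnE -realCD pq.
  have tr : u1 * w1 + u2 * w2 = 2%:C.
    transitivity ((p * conjc p + q * conjc q) * (b1 * c1 + b2 * c2)); last by rewrite pqC dE mul1r.
    by rewrite /u1 /w1 /u2 /w2; ring.
  apply: (addrI (u1 * w1)); rewrite tr uw1; apply/eqP; rewrite eq_complex /=.
  by apply/andP; split; apply/eqP; ring.
have u10 : u1 != 0 by apply/eqP => e; move/eqP: uw1; rewrite e mul0r eq_sym oner_eq0.
have u20 : u2 != 0 by apply/eqP => e; move/eqP: uw2; rewrite e mul0r eq_sym oner_eq0.
have -> : w1 = u1^-1 by apply: (mulfI u10); rewrite uw1 mulfV.
have -> : w2 = u2^-1 by apply: (mulfI u20); rewrite uw2 mulfV.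
exact: tridiag3_real_moduli.
Qed.

Lemma tridiag3_specb a b1 b2 c1 c2 : specb_W (tridiag3 a b1 b2 c1 c2).
Proof.
have -> : tridiag3 a b1 b2 c1 c2 = a%:M + 1 *: tridiag3 0 b1 b2 c1 c2.
  by rewrite scale1r scalar_mx3 !tridiag3_mx3 add_mx3 !addr0 !add0r.
by apply: specb_W_affine; apply: tridiag3_zero_diag.
Qed.

End Tridiagonal.

(** * Elliptic numerical ranges *)

Section Determinant.
Variable R : realType.
Local Notation C := R[i].

Lemma det_mx3 (a b c d e f g h k : C) : \det (mx3 a b c d e f g h k) =
  a * (e * k - f * h) - b * (d * k - f * g) + c * (d * h - e * g).
Proof.
have det2 (N : 'M[C]_2) : \det N = N 0 0 * N 1 1 - N 0 1 * N 1 0.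
  rewrite (expand_det_row _ 0) !big_ord_recr big_ord0 /= add0r /cofactor !det_mx11 !mxE /=.
  rewrite !addn0 expr0 expr1 mul1r mulN1r mulrN.
  by congr (N _ _ * N _ _ - N _ _ * N _ _); apply: val_inj.
rewrite (expand_det_row _ 0) sum3 /cofactor !det2 !mxE /=.
by rewrite /bump /= !addn0 ?add0n expr0 expr1 sqrrN expr1n; ring.
Qed.

Definition minors2 (M : 'M[C]_3) : C :=
  (M 0 0 * M 1 1 - M 0 1 * M 1 0) + (M 0 0 * M 2%:R 2%:R - M 0 2%:R * M 2%:R 0) +
  (M 1 1 * M 2%:R 2%:R - M 1 2%:R * M 2%:R 1).

Lemma minors2_mx3 (a b c d e f g h k : C) : minors2 (mx3 a b c d e f g h k) =
  (a * e - b * d) + (a * k - c * g) + (e * k - f * h).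
Proof. by rewrite /minors2 !mxE. Qed.

Lemma mxtrace_mx3 (a b c d e f g h k : C) : \tr (mx3 a b c d e f g h k) = a + e + k.
Proof. by rewrite /mxtrace sum3 !mxE. Qed.

Lemma minors2_trace (M : 'M[C]_3) : 2%:R * minors2 M = \tr M ^+ 2 - \tr (M *m M).
Proof.
rewrite (mx3P M); move: (M 0 0) (M 0 1) (M 0 2%:R) (M 1 0) (M 1 1) (M 1 2%:R)
  (M 2%:R 0) (M 2%:R 1) (M 2%:R 2%:R) => a b c d e f g h k.
by rewrite minors2_mx3 mul_mx3 !mxtrace_mx3; ring.
Qed.

Lemma char_poly_mx3 (x : C) (M : 'M[C]_3) :
  \det (x%:M - M) = x ^+ 3 - x ^+ 2 * \tr M + x * minors2 M - \det M.
Proof.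
rewrite (mx3P M); move: (M 0 0) (M 0 1) (M 0 2%:R) (M 1 0) (M 1 1) (M 1 2%:R)
  (M 2%:R 0) (M 2%:R 1) (M 2%:R 2%:R) => a b c d e f g h k.
rewrite minors2_mx3 mxtrace_mx3 scalar_mx3 -scaleN1r scale_mx3 add_mx3 !det_mx3; ring.
Qed.

Lemma minors2_pencil (A B : 'M[C]_3) (t : C) : t ^+ 2 = -1 ->
  minors2 (A + t *: B) =
  minors2 A - minors2 B + t * (minors2 (A + B) - minors2 A - minors2 B).
Proof. by move=> t2; rewrite /minors2 !mxE; ring: t2. Qed.

(** A cubic in [t], recovered from its values at 0, 1, -1 and its leading coefficient. *)
Lemma det_line (A B : 'M[C]_3) (t : C) :
  2%:R * \det (A + t *: B) = 2%:R * \det A +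
    t * (\det (A + B) - \det (A - B) - 2%:R * \det B) +
    t ^+ 2 * (\det (A + B) + \det (A - B) - 2%:R * \det A) + 2%:R * t ^+ 2 * t * \det B.
Proof.
rewrite (mx3P A) (mx3P B).
move: (A 0 0) (A 0 1) (A 0 2%:R) (A 1 0) (A 1 1) (A 1 2%:R)
  (A 2%:R 0) (A 2%:R 1) (A 2%:R 2%:R) => a b c d e f g h k.
move: (B 0 0) (B 0 1) (B 0 2%:R) (B 1 0) (B 1 1) (B 1 2%:R)
  (B 2%:R 0) (B 2%:R 1) (B 2%:R 2%:R) => a' b' c' d' e' f' g' h' k'.
by rewrite -(scaleN1r (mx3 _ _ _ _ _ _ _ _ _)) !scale_mx3 !add_mx3 !det_mx3; ring.
Qed.

Lemma det_pencil (A B : 'M[C]_3) (t : C) : t ^+ 2 = -1 ->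
  2%:R * \det (A + t *: B) = 4%:R * \det A - (\det (A + B) + \det (A - B)) +
    t * (\det (A + B) - \det (A - B) - 4%:R * \det B).
Proof. by move=> t2; rewrite det_line t2; ring. Qed.

(** Moving from [x0] by [- e G x0] changes the form by [-2 e |G x0|^2] to first order, which would
    make it negative if [G x0] were nonzero. *)
Lemma hermitian_kernel (G : 'M[C]_3) (x0 : 'cV[C]_3) :
  adjointmx G = G ->
  (forall x : 'cV[C]_3, frob2 x = 1 -> 0 <= complex.Re ((adjointmx x *m G *m x) 0 0)) ->
  (adjointmx x0 *m G *m x0) 0 0 = 0 -> G *m x0 = 0.
Proof.
move=> GG pos null; set y := G *m x0.
pose g (x : 'cV[C]_3) := complex.Re ((adjointmx x *m G *m x) 0 0).
have g_scale a x : g (a%:C *: x) = a ^+ 2 * g x.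
  rewrite /g adjointmxZ conjc_real -!scalemxAl -scalemxAr scalerA [X in complex.Re X]mxE.
  by case: (_ 0 0) => u v /=; ring.
have g_ge0 x : 0 <= g x.
  have [->|xn] := eqVneq x 0; first by rewrite /g mulmx0 mxE.
  have fx : 0 < frob2 x.
    rewrite lt_neqAle frob2_ge0 andbT eq_sym; apply: contra xn => /eqP /frob2_eq0 ->.
    by [].
  pose k := Num.sqrt (frob2 x)^-1.
  have k2 : k ^+ 2 = (frob2 x)^-1 by rewrite sqr_sqrtr // invr_ge0 ltW.
  have := pos (k%:C *: x); rewrite frob2Z sqn_real k2 mulVf ?gt_eqF // => /(_ erefl).
  by rewrite -/(g _) g_scale k2 pmulr_rge0 // invr_gt0.
apply: frob2_eq0; apply/eqP; rewrite -[_ == _]negbK; apply/negP => yn.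
have y0 : 0 < frob2 y by rewrite lt_neqAle frob2_ge0 andbT eq_sym.
have expand e : g (x0 + (- e)%:C *: y) = - (2 * e * frob2 y) + e ^+ 2 * g y.
  have yy : (adjointmx y *m y) 0 0 = (frob2 y)%:C by apply: frob2_dot.
  have e1 : adjointmx x0 *m G *m y = adjointmx y *m y.
    by rewrite {3}/y /y adjointmxM GG.
  have e2 : adjointmx y *m G *m x0 = adjointmx y *m y by rewrite -mulmxA.
  rewrite /g adjointmxD adjointmxZ conjc_real !mulmxDl !mulmxDr.
  rewrite -!scalemxAl -!scalemxAr e1 e2 scalerA.
  rewrite [X in complex.Re X]mxE [X in complex.Re (X + _)]mxE null add0r.
  rewrite [X in complex.Re (_ + X)]mxE [X in complex.Re (X + _)]mxE yy.
  rewrite [X in complex.Re (_ + (X + _))]mxE yy [X in complex.Re (_ + (_ + X))]mxE.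
  by case: ((adjointmx y *m G *m y) 0 0) => u v /=; ring.
pose e := frob2 y / (g y + 1).
have gy := g_ge0 y.
have e0 : 0 < e by rewrite divr_gt0 // ltr_wpDl.
have eg : e * (g y + 1) = frob2 y by rewrite divfK // gt_eqF // ltr_wpDl.
have := g_ge0 (x0 + (- e)%:C *: y); rewrite expand.
have : 0 < e * frob2 y by rewrite mulr_gt0.
have : e * (e * (g y + 1)) = e * frob2 y by rewrite eg.
have := sqr_ge0 e; move: (frob2 y) (g y) => N gg; nra.
Qed.

Lemma det_hermitian_kernel (G : 'M[C]_3) (x0 : 'cV[C]_3) :
  adjointmx G = G -> G *m x0 = 0 -> frob2 x0 = 1 -> \det G = 0.
Proof.
move=> GG Gx x1; apply/eqP/det0P; exists (adjointmx x0).
  apply/eqP => e; move/eqP: x1; rewrite -frob2_adj e frob2_0 eq_sym oner_eq0.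
  by [].
by rewrite -[G]GG -adjointmxM Gx; apply/matrixP => i j; rewrite !mxE rmorph0.
Qed.

End Determinant.

(** * Support function and Hermitian parts *)

Section EllipticRange.
Variable R : realType.
Local Notation C := R[i].
Local Notation nc := (@Normc.normc R).

Definition hpart (M : 'M[C]_3) (d : C) : 'M[C]_3 :=
  (2^-1)%:C *: (d *: M + conjc d *: adjointmx M).

Lemma hpart_adjoint M d : adjointmx (hpart M d) = hpart M d.
Proof.
by rewrite /hpart adjointmxZ adjointmxD !adjointmxZ adjointmxK conjc_real conjcK addrC.
Qed.

Lemma adjointmxB m n (A B : 'M[C]_(m, n)) : adjointmx (A - B) = adjointmx A - adjointmx B.
Proof. by rewrite adjointmxD -scaleN1r adjointmxZ conjcN conjc1 scaleN1r. Qed.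

Lemma adjointmx_real n (x : R) : adjointmx (x%:C%:M : 'M[C]_n) = x%:C%:M.
Proof.
apply/matrixP => i j; rewrite !mxE eq_sym.
by case: (_ == _); rewrite ?mulr1n ?mulr0n ?rmorph0 // conjE conjc_real.
Qed.

Lemma scale_involution_sub n (a b : C) (X : 'M[C]_n) : a * a = 1 ->
  (a * b)%:M - X = a *: (b%:M - a *: X).
Proof. by move=> aa; rewrite scalerBr scale_scalar_mx scalerA aa scale1r. Qed.

Lemma hpart_form (M : 'M[C]_3) d (x : 'cV[C]_3) :
  (adjointmx x *m hpart M d *m x) 0 0 =
  (complex.Re (d * (adjointmx x *m M *m x) 0 0))%:C.
Proof.
set z := (adjointmx x *m M *m x) 0 0.
have zz : (adjointmx x *m adjointmx M *m x) 0 0 = conjc z.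
  have -> : adjointmx x *m adjointmx M *m x = adjointmx (adjointmx x *m M *m x).
    by rewrite !adjointmxM adjointmxK mulmxA.
  by rewrite /z; move: (adjointmx x *m M *m x) => Y; rewrite !mxE conjE.
have -> : adjointmx x *m hpart M d *m x = (2^-1)%:C *:
   (d *: (adjointmx x *m M *m x) + conjc d *: (adjointmx x *m adjointmx M *m x)).
  by rewrite /hpart -scalemxAr mulmxDr -!scalemxAr -scalemxAl mulmxDl -!scalemxAl.
rewrite mxE [X in _ * X]mxE [X in _ * (X + _)]mxE [X in _ * (_ + X)]mxE zz -/z.
case: d z {zz} => a b [u v]; apply/eqP; rewrite eq_complex /=.
by apply/andP; split; apply/eqP; field.
Qed.

Lemma hermitian_form_eq0 (G : 'M[C]_3) : adjointmx G = G ->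
  (forall x : 'cV[C]_3, frob2 x = 1 -> (adjointmx x *m G *m x) 0 0 = 0) -> G = 0.
Proof.
move=> GG form; apply/matrixP => i j; rewrite [RHS]mxE.
have d1 : frob2 (delta_mx j 0 : 'cV[C]_3) = 1.
  rewrite /frob2 (bigD1 j) //= big_ord1 mxE !eqxx sqn1 big1 ?addr0 // => k kj.
  by rewrite big_ord1 mxE (negbTE kj) sqn0.
have /colP/(_ i) : G *m (delta_mx j 0 : 'cV[C]_3) = 0.
  by apply: (hermitian_kernel GG) => [x x1|]; rewrite form.
by rewrite -colE [LHS]mxE [RHS]mxE.
Qed.

Section Ellipse.
Variables (f p : R).
Hypotheses (f0 : 0 <= f) (fp : f <= p).
Let q2 := p ^+ 2 - f ^+ 2.

Let p0 : 0 <= p. Proof. exact: le_trans f0 fp. Qed.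
Let q20 : 0 <= q2. Proof. by rewrite subr_ge0 ler_sqr. Qed.

(** The bound on [sqn z] is recorded as well because for a segment, [q2 = 0], the quadratic
    inequality leaves the real part free. *)
Lemma ellipse_quadratic (z : C) : nc (z - f%:C) + nc (z + f%:C) <= 2 * p ->
  q2 * complex.Re z ^+ 2 + p ^+ 2 * complex.Im z ^+ 2 <= p ^+ 2 * q2 /\ sqn z <= p ^+ 2.
Proof.
move=> h; have zp : nc z <= p.
  have e : nc (z - f%:C + (z + f%:C)) = 2 * nc z.
    have -> : z - f%:C + (z + f%:C) = (1 + 1)%:C * z by rewrite realCD; ring.
    by rewrite ncM nc_pos ?addr_ge0 ?ler01.
  by rewrite -(ler_pM2l (ltr0n R 2)) -e; apply: le_trans (ncD _ _) h.
split; last by rewrite -normc_sqr ler_sqr ?nnegrE ?nc_ge0.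
have e1 := normc_sqr (z - f%:C); have e2 := normc_sqr (z + f%:C).
have n1 := nc_ge0 (z - f%:C); have n2 := nc_ge0 (z + f%:C).
set d1 := nc (z - f%:C) in h e1 n1; set d2 := nc (z + f%:C) in h e2 n2.
have lz : sqn z <= p ^+ 2 by rewrite -normc_sqr ler_sqr ?nnegrE ?nc_ge0.
clearbody d1 d2; move: e1 e2 lz; rewrite /q2; case: z {zp} => X Y; rewrite /sqn /= => e1 e2 lz.
have d12 : 2 * (d1 * d2) <= 4 * p ^+ 2 - 2 * (X ^+ 2 + Y ^+ 2) - 2 * f ^+ 2.
  have : (d1 + d2) ^+ 2 <= (2 * p) ^+ 2.
    by rewrite ler_sqr // nnegrE ?addr_ge0 // mulr_ge0.
  by move: e1 e2; rewrite subr0 addr0 => e1 e2; nra.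
have d120 : 0 <= d1 * d2 by rewrite mulr_ge0.
have : (d1 * d2) ^+ 2 <= (2 * p ^+ 2 - (X ^+ 2 + Y ^+ 2) - f ^+ 2) ^+ 2.
  by rewrite ler_sqr ?nnegrE //; lra.
rewrite exprMn e1 e2 subr0 addr0.
have -> : ((X - f) ^+ 2 + Y ^+ 2) * ((X + f) ^+ 2 + Y ^+ 2) =
   (X ^+ 2 + Y ^+ 2 + f ^+ 2) ^+ 2 - 4 * f ^+ 2 * X ^+ 2 by ring.
by nra.
Qed.

Lemma ellipse_mem (z : C) :
  q2 * complex.Re z ^+ 2 + p ^+ 2 * complex.Im z ^+ 2 <= p ^+ 2 * q2 -> sqn z <= p ^+ 2 ->
  nc (z - f%:C) + nc (z + f%:C) <= 2 * p.
Proof.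
case: z => X Y; rewrite {1}/sqn [complex.Re _]/= [complex.Im _]/= => h lz.
have ff : f ^+ 2 <= p ^+ 2 by move: q20; rewrite subr_ge0.
apply: (@nc_add_le _ _ _ p (2 * p ^+ 2 - f ^+ 2 - (X ^+ 2 + Y ^+ 2))) => //; first by lra.
  rewrite /sqn /= subr0 addr0.
  have -> : ((X - f) ^+ 2 + Y ^+ 2) * ((X + f) ^+ 2 + Y ^+ 2) =
     (X ^+ 2 + Y ^+ 2 + f ^+ 2) ^+ 2 - 4 * f ^+ 2 * X ^+ 2 by ring.
  by move: h; rewrite /q2; set X2 := X ^+ 2; set Y2 := Y ^+ 2; nra.
rewrite /sqn /= subr0 addr0; have -> : (X - f) ^+ 2 + Y ^+ 2 + ((X + f) ^+ 2 + Y ^+ 2) =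
  2 * (X ^+ 2 + Y ^+ 2) + 2 * f ^+ 2 by ring.
by nra.
Qed.

Let support_ge0 c s : 0 <= p ^+ 2 * c ^+ 2 + q2 * s ^+ 2.
Proof.
apply: addr_ge0; first by rewrite mulr_ge0 ?sqr_ge0.
by apply: mulr_ge0 => //; apply: sqr_ge0.
Qed.

Lemma ellipse_support (z : C) (c s : R) : nc (z - f%:C) + nc (z + f%:C) <= 2 * p ->
  c * complex.Re z + s * complex.Im z <= Num.sqrt (p ^+ 2 * c ^+ 2 + q2 * s ^+ 2).
Proof.
move=> /ellipse_quadratic[]; case: z => X Y; rewrite /sqn /= => h lz.
apply: le_trans (ler_norm _) _; rewrite -sqrtr_sqr ler_wsqrtr //.
have [p00|pn] := eqVneq p 0.
  have X0 : X = 0 by apply/eqP; rewrite -sqrf_eq0; apply/eqP; move: lz; rewrite p00; nra.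
  have Y0 : Y = 0 by apply/eqP; rewrite -sqrf_eq0; apply/eqP; move: lz; rewrite p00; nra.
  by rewrite X0 Y0 !mulr0 addr0 expr0n addr_ge0 // mulr_ge0 ?sqr_ge0.
have pp : 0 < p ^+ 2 by rewrite exprn_gt0 // lt_neqAle eq_sym pn.
have [q0|qn] := eqVneq q2 0.
  have Y0 : Y = 0.
    apply/eqP; rewrite -sqrf_eq0; apply/eqP; move: h; rewrite q0 mul0r mulr0 add0r => h.
    by apply: le_anti; rewrite sqr_ge0 andbT -(ler_pM2l pp) mulr0.
  rewrite Y0 mulr0 addr0 q0 mul0r addr0 exprMn mulrC ler_wpM2r ?sqr_ge0 //.
  by move: lz; rewrite Y0; lra.
have qp : 0 < q2 by rewrite lt_neqAle eq_sym qn.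
rewrite -(ler_pM2l (mulr_gt0 pp qp)).
have : 0 <= (c * p ^+ 2 * Y - s * q2 * X) ^+ 2 by apply: sqr_ge0.
have H0 : 0 <= p ^+ 2 * c ^+ 2 + q2 * s ^+ 2 := support_ge0 c s.
move: (ler_wpM2l H0 h) => {H0}; move: (q2) => Q.
set P := p ^+ 2 => h1 h2.
have e : (P * c ^+ 2 + Q * s ^+ 2) * (Q * X ^+ 2 + P * Y ^+ 2) =
   P * Q * (c * X + s * Y) ^+ 2 + (c * P * Y - s * Q * X) ^+ 2 by ring.
rewrite e in h1; lra.
Qed.

Variable M : 'M[C]_3.
Hypothesis WM : forall z, numerical_range M z <-> nc (z - f%:C) + nc (z + f%:C) <= 2 * p.

(** The form of [X] is c Re z + s Im z, with extreme values [h] and [-h] attained on the ellipse, so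
    both are eigenvalues. The sum and the difference of the two characteristic equations give the
    two identities. *)
Lemma hpart_invariants (c s : R) (X := hpart M (Complex c (- s)))
    (h2 := p ^+ 2 * c ^+ 2 + q2 * s ^+ 2) :
  minors2 X = - h2%:C /\ \det X = - (h2%:C * \tr X).
Proof.
have XX : adjointmx X = X by apply: hpart_adjoint.
have h20 : 0 <= h2 := support_ge0 c s.
pose h := Num.sqrt h2.
have hE : h ^+ 2 = h2 by rewrite sqr_sqrtr.
have h0 : 0 <= h by apply: sqrtr_ge0.
pose zx (x : 'cV[C]_3) := (adjointmx x *m M *m x) 0 0.
have form x : (adjointmx x *m X *m x) 0 0 =
    (c * complex.Re (zx x) + s * complex.Im (zx x))%:C.
  by rewrite hpart_form -/(zx x); case: (zx x) => u v /=; congr (_%:C); ring.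
have Wx (x : 'cV[C]_3) : frob2 x = 1 -> nc (zx x - f%:C) + nc (zx x + f%:C) <= 2 * p.
  by move=> x1; apply/WM; exists x => //=; rewrite frob2_dot x1.
have upper (x : 'cV[C]_3) : frob2 x = 1 -> c * complex.Re (zx x) + s * complex.Im (zx x) <= h.
  by move=> /Wx; apply: ellipse_support.
have lower (x : 'cV[C]_3) : frob2 x = 1 -> - h <= c * complex.Re (zx x) + s * complex.Im (zx x).
  move=> /Wx /(ellipse_support (- c) (- s)); rewrite !sqrrN -/h2 -/h; lra.
have [h00|hn] := eqVneq h 0.
  have X0 : X = 0.
    apply: (hermitian_form_eq0 XX) => x x1; rewrite form; congr (_%:C).
    have := upper _ x1; have := lower _ x1; rewrite h00 oppr0 => h1 h3.
    by apply: le_anti; rewrite h1 h3.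
  have -> : h2 = 0 by rewrite -hE h00 expr0n.
  by rewrite X0 det0 /minors2 !mxE !(mul0r, subr0, addr0, oppr0).
have hp : 0 < h by rewrite lt_neqAle eq_sym hn.
have hC : h%:C != 0 :> C by rewrite -sqn_eq0 sqn_real expf_neq0.
(* The point where the ellipse touches its supporting line in direction (c, s). *)
pose z0 := Complex (p ^+ 2 * c / h) (q2 * s / h).
have h2n : h2 != 0 by rewrite -hE expf_neq0.
have q2p : q2 <= p ^+ 2 by rewrite /q2 lerBlDr lerDl sqr_ge0.
have z0E : nc (z0 - f%:C) + nc (z0 + f%:C) <= 2 * p.
  apply: ellipse_mem; rewrite /= ?/sqn /=.
    have -> : q2 * (p ^+ 2 * c / h) ^+ 2 + p ^+ 2 * (q2 * s / h) ^+ 2 = p ^+ 2 * q2 * h2 / h ^+ 2.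
      by rewrite /h2; field.
    by rewrite hE mulfK.
  have -> : (p ^+ 2 * c / h) ^+ 2 + (q2 * s / h) ^+ 2 =
     (p ^+ 2 * (p ^+ 2 * c ^+ 2) + q2 * (q2 * s ^+ 2)) / h ^+ 2 by field.
  rewrite hE ler_pdivrMr; last by rewrite lt_neqAle eq_sym h2n.
  rewrite (_ : p ^+ 2 * h2 = p ^+ 2 * (p ^+ 2 * c ^+ 2) + p ^+ 2 * (q2 * s ^+ 2)).
    by rewrite lerD2l ler_wpM2r // mulr_ge0 // sqr_ge0.
  by rewrite /h2; ring.
have sgn (e : R) : e ^+ 2 = 1 -> e = 1 \/ e = -1.
  by move/eqP; rewrite sqrf_eq1 => /orP[]/eqP; [left|right].
have attained (e : R) : e ^+ 2 = 1 -> exists2 x : 'cV[C]_3, frob2 x = 1 &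
    c * complex.Re (zx x) + s * complex.Im (zx x) = e * h.
  move=> e1; have ez : nc (e%:C * z0 - f%:C) + nc (e%:C * z0 + f%:C) <= 2 * p.
    have [->|->] := sgn e e1.
    - by rewrite mul1r.
    - by rewrite realCN mulN1r -opprD ncN [- z0 + _]addrC -opprB ncN addrC.
  move/WM: ez => [x /= x1 xz]; exists x.
    by apply: complexI; rewrite -frob2_dot x1.
  rewrite /zx xz /=; transitivity (e * (h2 / h)); first by rewrite /h2; field.
  by rewrite -hE; field.
have detz (e : R) : e ^+ 2 = 1 -> \det ((e * h)%:C%:M - X) = 0.
  move=> e1; have [x x1 xz] := attained e e1.
  have eC : e%:C * e%:C = 1 :> C by rewrite -realCM -expr2 e1.
  have GG : adjointmx ((h%:C)%:M - e%:C *: X) = (h%:C)%:M - e%:C *: X.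
    by rewrite adjointmxB adjointmx_real adjointmxZ XX conjc_real.
  rewrite realCM (scale_involution_sub _ _ eC).
  have formG y : (adjointmx y *m ((h%:C)%:M - e%:C *: X) *m y) 0 0 =
      (h * frob2 y - e * (c * complex.Re (zx y) + s * complex.Im (zx y)))%:C.
    have -> : adjointmx y *m ((h%:C)%:M - e%:C *: X) *m y =
        h%:C *: (adjointmx y *m y) - e%:C *: (adjointmx y *m X *m y).
      by rewrite mulmxBr mulmxBl mul_mx_scalar -scalemxAr -!scalemxAl.
    rewrite mxE [X in X + _]mxE [X in _ + X]mxE [X in _ - X]mxE frob2_dot form.
    by rewrite -!realCM -realCB.
  rewrite detZ (det_hermitian_kernel GG _ x1) ?mulr0 //.
  apply: (hermitian_kernel GG).
  - move=> y y1; rewrite formG /= y1 mulr1 subr_ge0.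
    have [->|->] := sgn e e1.
      by rewrite mul1r upper.
    by rewrite mulN1r lerNl lower.
  - by rewrite formG x1 xz mulrA -expr2 e1 mul1r mulr1 subrr.
have d1 := detz 1 (expr1n _ _); have d2 := detz (-1) (etrans (sqrrN 1) (expr1n _ _)).
rewrite mul1r char_poly_mx3 in d1; rewrite mulN1r realCN char_poly_mx3 in d2.
rewrite -hE realCX.
move: d1 d2; set H := h%:C in hC *; set t := \tr X; set e2 := minors2 X; set D := \det X.
clearbody H t e2 D; move=> d1 d2; have two : 2%:R != 0 :> C by rewrite pnatr_eq0.
split.
  apply/eqP; rewrite -addr_eq0; apply/eqP; apply: (mulfI hC); apply: (mulfI two); rewrite !mulr0.
  by rewrite -[RHS]subr0 -{1}d1 -d2; ring.
apply/eqP; rewrite -addr_eq0; apply/eqP; apply: (mulfI two); rewrite mulr0.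
by apply/eqP; rewrite -oppr_eq0; apply/eqP; rewrite -[RHS]addr0 -{1}d1 -d2; ring.
Qed.

End Ellipse.
End EllipticRange.

Section EllipticInvariants.
Variable R : realType.
Local Notation C := R[i].
Local Notation nc := (@Normc.normc R).

Lemma numerical_range_conj (M U : 'M[C]_3) z : adjointmx U *m U = 1%:M ->
  numerical_range (adjointmx U *m M *m U) z <-> numerical_range M z.
Proof.
move=> UU; have UU' : U *m adjointmx U = 1%:M by apply: mulmx1C.
split=> [/(numerical_range_unitary UU)|].
  by rewrite !mulmxA UU' mul1mx -mulmxA UU' mulmx1.
by move/(@numerical_range_unitary _ _ M (adjointmx U)); rewrite adjointmxK; apply.
Qed.

Lemma specb_W_conj (M U : 'M[C]_3) : adjointmx U *m U = 1%:M ->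
  specb_W (adjointmx U *m M *m U) -> specb_W M.
Proof.
move=> UU; have UU' : U *m adjointmx U = 1%:M by apply: mulmx1C.
move/(specb_W_unitary UU).
by rewrite !mulmxA UU' mul1mx -mulmxA UU' mulmx1.
Qed.

Lemma minors2_conj (M U : 'M[C]_3) : adjointmx U *m U = 1%:M ->
  minors2 (adjointmx U *m M *m U) = minors2 M.
Proof.
move=> UU; have UU' : U *m adjointmx U = 1%:M by apply: mulmx1C.
have two : 2%:R != 0 :> C by rewrite pnatr_eq0.
apply: (mulfI two); rewrite !minors2_trace.
have tr (N : 'M[C]_3) : \tr (adjointmx U *m N *m U) = \tr N.
  by rewrite mxtrace_mulC mulmxA UU' mul1mx.
rewrite tr; congr (_ - _); rewrite -[RHS]tr; congr (\tr _).
by rewrite -!mulmxA (mulmxA U (adjointmx U)) UU' mul1mx.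
Qed.

Lemma hpart_conj (M U : 'M[C]_3) d :
  hpart (adjointmx U *m M *m U) d = adjointmx U *m hpart M d *m U.
Proof.
rewrite /hpart !adjointmxM adjointmxK -scalemxAr mulmxDr -!scalemxAr.
by rewrite -scalemxAl mulmxDl -!scalemxAl mulmxA.
Qed.

Definition elliptic_range (f p : R) (M : 'M[C]_3) := forall z,
  numerical_range M z <-> nc (z - f%:C) + nc (z + f%:C) <= 2 * p.

Lemma elliptic_range_conj f p (M U : 'M[C]_3) : adjointmx U *m U = 1%:M ->
  elliptic_range f p M -> elliptic_range f p (adjointmx U *m M *m U).
Proof. by move=> UU WM z; rewrite (numerical_range_conj M z UU); apply: WM. Qed.

Lemma hpartD (M : 'M[C]_3) d d' : hpart M (d + d') = hpart M d + hpart M d'.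
Proof. by rewrite /hpart conjcD !scalerDl addrACA scalerDr. Qed.

Lemma hpartN (M : 'M[C]_3) d : hpart M (- d) = - hpart M d.
Proof. by rewrite /hpart conjcN !scaleNr -opprD scalerN. Qed.

Lemma hpart_decomp (M : 'M[C]_3) :
  M = hpart M (Complex 1 (- 0)) + 'i *: hpart M (Complex 0 (- 1)).
Proof.
apply/matrixP => i j; rewrite !mxE conjE; move: (M i j) (M j i) => [a b] [u v].
by apply/eqP; rewrite eq_complex /=; apply/andP; split; apply/eqP; field.
Qed.

(** M = A + i B, and polarisation recovers the quadratic [minors2] and the cubic determinant at [i]
    from A, B, A + B and A - B; the contributions of [p] cancel. *)
Lemma elliptic_range_invariants f p (M : 'M[C]_3) : 0 <= f -> f <= p ->
  elliptic_range f p M ->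
  minors2 M = - (f ^+ 2)%:C /\ \det M = - ((f ^+ 2)%:C * \tr M).
Proof.
move=> f0 fp WM; have inv := hpart_invariants f0 fp WM.
set A := hpart M (Complex 1 (- 0)); set B := hpart M (Complex 0 (- 1)).
have ME : M = A + 'i *: B := hpart_decomp M.
have [eA dA] : minors2 A = - (p ^+ 2)%:C /\ \det A = - ((p ^+ 2)%:C * \tr A).
  by have := inv 1 0; rewrite expr1n expr0n mulr1 mulr0 addr0.
have [eB dB] : minors2 B = - (p ^+ 2 - f ^+ 2)%:C /\ \det B = - ((p ^+ 2 - f ^+ 2)%:C * \tr B).
  by have := inv 0 1; rewrite expr1n expr0n mulr1 mulr0 add0r.
have e1 : hpart M (Complex 1 (- 1)) = A + B.
    rewrite -hpartD; congr hpart; apply/eqP.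
    by rewrite eq_complex /= oppr0 addr0 add0r !eqxx.
have e2 : hpart M (Complex 1 (- - 1)) = A - B.
    rewrite -hpartN -hpartD; congr hpart; apply/eqP.
    by rewrite eq_complex /= !oppr0 addr0 add0r !eqxx.
have [eS dS] := inv 1 1; have [_ dD] := inv 1 (-1).
move: eS dS dD; rewrite e1 e2 sqrrN expr1n !mulr1 mxtraceD raddfB.
clearbody A B => eS dS dD.
have i2 : ('i : C) ^+ 2 = -1 by rewrite sqr_i.
move: eA eB eS dA dB dS dD; rewrite realCB (realCD (p ^+ 2)) realCB; set P := (p ^+ 2)%:C; set F := (f ^+ 2)%:C.
move=> eA eB eS dA dB dS dD; rewrite ME.
split; first by rewrite minors2_pencil // eA eB eS; ring.
have two : 2%:R != 0 :> C by rewrite pnatr_eq0.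
by apply: (mulfI two); rewrite det_pencil // dA dB dS dD mxtraceD mxtraceZ; ring.
Qed.

Lemma unitary_last_column (x y z : C) : sqn x + sqn y + sqn z = 1 ->
  exists2 U : 'M[C]_3, adjointmx U *m U = 1%:M & exists a b c d e f, U = mx3 a b x c d y e f z.
Proof.
move=> n1; have [[x0 y0]|] := eqVneq (x, y) (0, 0).
  exists (mx3 1 0 0 0 1 0 0 0 z); last by exists 1, 0, 0, 1, 0, 0; rewrite x0 y0.
  rewrite adjoint_mx3 mul_mx3 scalar_mx3 conjc0 conjc1 !(mul0r, mulr0, addr0, add0r, mul1r).
  by rewrite [conjc z * z]mulrC -sqnE; rewrite x0 y0 sqn0 !add0r in n1; rewrite n1.
move=> /normalize_pair[k k0 kE].
pose U := mx3 (- (k%:C * conjc y)) (k%:C * (x * conjc z)) x (k%:C * conjc x) (k%:C * (y * conjc z)) y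
   0 (- (k^-1)%:C) z.
exists U; last by do 6 eexists.
have kC : k%:C != 0 by rewrite -sqn_eq0 sqn_real expf_neq0 // gt_eqF.
have KE : k%:C ^+ 2 * (x * conjc x + y * conjc y) = 1.
  by rewrite -!sqnE -realCD -realCX -realCM kE.
have nE : x * conjc x + y * conjc y + z * conjc z = 1.
  by rewrite -!sqnE -!realCD n1.
have N : x * conjc x + y * conjc y = (k%:C^-1) ^+ 2.
  by apply: (mulfI (expf_neq0 2 kC)); rewrite KE -exprMn mulfV ?expr1n.
have Z : z * conjc z = 1 - (k%:C^-1) ^+ 2 by rewrite -N -nE; ring.
rewrite /U adjoint_mx3 mul_mx3 scalar_mx3 !conjcE realCV; congr mx3.
- by rewrite -KE; ring.
- by ring.
- by ring.
- by ring.
- transitivity (k%:C ^+ 2 * (x * conjc x + y * conjc y) * (z * conjc z) + (k%:C^-1) ^+ 2); first by ring.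
  by rewrite KE Z mul1r subrK.
- transitivity (k%:C * z * (x * conjc x + y * conjc y) - k%:C^-1 * z); first by ring.
  by rewrite N; field.
- by ring.
- transitivity (k%:C * conjc z * (x * conjc x + y * conjc y) - k%:C^-1 * conjc z); first by ring.
  by rewrite N; field.
- by rewrite -nE; ring.
Qed.

Lemma singular_block_null (a b c d : C) : a * d = b * c ->
  exists p q, [/\ sqn p + sqn q = 1, a * p + b * q = 0 & c * p + d * q = 0].
Proof.
move=> h; have [[a0 b0]|] := eqVneq (a, b) (0, 0); last first.
  move=> /normalize_pair[k k0 kE]; exists (k%:C * b), (- (k%:C * a)); split.
  - by rewrite sqnN !sqnM !sqn_real -mulrDr addrC.
  - by ring.
  - by transitivity (k%:C * (b * c - a * d)); [ring | rewrite h subrr mulr0].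
have [[c0 d0]|] := eqVneq (c, d) (0, 0).
  by exists 1, 0; rewrite sqn1 sqn0 a0 b0 c0 d0 addr0; split; ring.
move=> /normalize_pair[k k0 kE]; exists (k%:C * d), (- (k%:C * c)); split.
- by rewrite sqnN !sqnM !sqn_real -mulrDr addrC.
- by rewrite a0 b0; ring.
- by ring.
Qed.

(** For the direction 1, [minors2] gives the sum of squares; the determinants for 1 and -i give the
    real and imaginary parts of the relation for [mu]. Being a diagonal entry, [mu] lies in the
    range. *)
Lemma specb_W_sandwich (l : R) (a b mu c : C) : 0 < l ->
  elliptic_range 0 l (sandwich3 a b mu c) -> specb_W (sandwich3 a b mu c).
Proof.
move=> l0 WM; have inv := hpart_invariants (lexx 0) (ltW l0) WM.
have WE z : numerical_range (sandwich3 a b mu c) z <-> sqn z <= l ^+ 2.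
  rewrite (WM z) subr0 addr0 -nc_le ?(ltW l0) //.
  have -> : nc z + nc z = 2 * nc z by ring.
  by rewrite ler_pM2l ?ltr0n.
have hE d : hpart (sandwich3 a b mu c) d = mx3
   0 ((2^-1)%:C * (d * a)) ((2^-1)%:C * (d * b))
   ((2^-1)%:C * (conjc d * conjc a)) ((2^-1)%:C * (d * mu + conjc d * conjc mu)) ((2^-1)%:C * (d * c))
   ((2^-1)%:C * (conjc d * conjc b)) ((2^-1)%:C * (conjc d * conjc c)) 0.
  rewrite /hpart /sandwich3 adjoint_mx3 !scale_mx3 add_mx3 scale_mx3 conjc0.
  by rewrite !(mulr0, addr0, add0r).
have D1 : Complex 1 (- 0) = 1 :> C by rewrite oppr0.
have D2 : Complex 0 (- 1) = - 'i :> C by apply/eqP; rewrite eq_complex /= oppr0 !eqxx.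
have [n2 d1] := inv 1 0; have [_ d2] := inv 0 1.
move: n2 d1 d2; rewrite !hE minors2_mx3 !det_mx3 !mxtrace_mx3 D1 D2.
rewrite expr1n !expr0n !mulr1 !mulr0 addr0 add0r subr0.
move=> n2 d1 d2.
have ci : conjc ('i : C) = - 'i by apply/eqP; rewrite eq_complex /= oppr0 !eqxx.
have i2 : ('i : C) ^+ 2 = -1 by rewrite sqr_i.
have H2 : (2^-1)%:C = 2%:R^-1 :> C by rewrite realCV -[in RHS](rmorph_nat (real_complex R)).
move: n2 d1 d2; rewrite H2 !conjcN conjc1 ci.
have four : (4 * l ^+ 2)%:C = 4%:R * (l ^+ 2)%:C :> C.
  by rewrite realCM -[in RHS](rmorph_nat (real_complex R)).
have two : 2%:R != 0 :> C by rewrite pnatr_eq0.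
have sumE : (sqn a + sqn b + sqn c)%:C = a * conjc a + b * conjc b + c * conjc c.
  by rewrite (realCD (_ + _)) (realCD (sqn a)) !sqnE.
have sumE' : (sqn a + sqn c)%:C = a * conjc a + c * conjc c.
  by rewrite (realCD (sqn a)) !sqnE.
rewrite add0r; move: four; set L := (l ^+ 2)%:C => four n2 d1 d2.
have key : a * conjc a + b * conjc b + c * conjc c = 4%:R * L.
  by apply/eqP; rewrite -subr_eq0 -[L]opprK -n2; apply/eqP; field.
pose T := (sqn a + sqn c)%:C * mu + a * c * conjc b.
pose T' := (sqn a + sqn c)%:C * conjc mu + conjc a * conjc c * b.
have sumT : T + T' = 0.
  move/eqP: d1; rewrite -subr_eq0 => /eqP d1; rewrite /T /T' sumE'.
  rewrite -[RHS](mulr0 8%:R) -d1.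
  have -> : a * conjc a + c * conjc c = 4%:R * L - b * conjc b by rewrite -key; ring.
  by field.
have difT : T - T' = 0.
  move/eqP: d2; rewrite -subr_eq0 => /eqP d2; rewrite /T /T' sumE'.
  rewrite -[RHS](mulr0 (8%:R * 'i)) -d2.
  have -> : a * conjc a + c * conjc c = 4%:R * L - b * conjc b by rewrite -key; ring.
  by field: i2.
apply: (@disc_specb _ _ l) => //.
- by apply: complexI; rewrite sumE key.
- apply/WE; have n1 : sqn 0 + sqn 1 + sqn 0 = 1 :> R by rewrite sqn1 !sqn0 add0r addr0.
  have := numerical_range_mx3 (sandwich3 a b mu c) n1.
  rewrite /sandwich3 mul_mx3_cv3 dot_cv3 conjc0 conjc1.
  by rewrite !(mul0r, mulr0, addr0, add0r, mul1r, mulr1).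
- by apply: (mulfI two); rewrite -/T mulr0 -[RHS]addr0 -{1}sumT -difT; ring.
- by move=> z zl; apply/WE; rewrite zl.
Qed.

End EllipticInvariants.

Section EllipseCases.
Variable R : realType.
Local Notation C := R[i].
Local Notation nc := (@Normc.normc R).

Lemma elliptic_range00 (M : 'M[C]_3) : elliptic_range 0 0 M -> M = 0.
Proof.
move=> WM; have z0 (x : 'cV[C]_3) : frob2 x = 1 -> (adjointmx x *m M *m x) 0 0 = 0.
  move=> x1; set z := (_ : 'M_1) 0 0.
  have /WM : numerical_range M z by exists x => //=; rewrite frob2_dot x1.
  rewrite mulr0 subr0 addr0 => h; apply/eqP; rewrite -sqn_eq0 -normc_sqr sqrf_eq0.
  by apply/eqP; apply: le_anti; rewrite nc_ge0 andbT; have := nc_ge0 z; lra.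
have h0 d : hpart M d = 0.
  by apply: hermitian_form_eq0 (hpart_adjoint _ _) _ => x x1; rewrite hpart_form z0 // mulr0.
by rewrite (hpart_decomp M) !h0 scaler0 addr0.
Qed.

(* Rotating a left null vector of [M] to the last coordinate leaves a singular
   upper left block, because the second elementary symmetric function of the
   eigenvalues vanishes. *)
Lemma unitary_sandwich (M : 'M[C]_3) : eigenvalue M 0 -> minors2 M = 0 ->
  exists2 U : 'M[C]_3, adjointmx U *m U = 1%:M &
    exists a b mu c, adjointmx U *m M *m U = sandwich3 a b mu c.
Proof.
move=> /eigenvalueP[v vM vn] e2; rewrite scale0r in vM.
have fv : 0 < frob2 v.
  by rewrite lt_neqAle frob2_ge0 andbT eq_sym; apply: contra vn => /eqP /frob2_eq0 ->.
pose r := Num.sqrt (frob2 v)^-1; pose y := adjointmx (r%:C *: v).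
have yM : adjointmx y *m M = 0 by rewrite adjointmxK -scalemxAl vM scaler0.
have : frob2 y = 1.
  by rewrite frob2_adj frob2Z sqn_real sqr_sqrtr ?invr_ge0 ?(ltW fv) // mulVf ?gt_eqF.
move: yM; rewrite (cv3P y); move: (y 0 0) (y 1 0) (y 2%:R 0) => y0 y1 y2.
rewrite frob2_cv3 => yM /unitary_last_column[U UU [a [b [c [d [e [f UE]]]]]]].
have colU : U *m cv3 0 0 1 = cv3 y0 y1 y2.
  by rewrite UE mul_mx3_cv3 !(mulr0, mulr1, add0r).
have last : adjointmx (cv3 0 0 1) *m (adjointmx U *m M *m U) = 0.
  by rewrite !mulmxA -adjointmxM colU yM mul0mx.
have m0 : minors2 (adjointmx U *m M *m U) = 0 by rewrite minors2_conj.
move: last m0; set N := adjointmx U *m M *m U; have NE := mx3P N; rewrite NE.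
move: (N 0 0) (N 0 1) (N 0 2%:R) (N 1 0) (N 1 1) (N 1 2%:R)
  (N 2%:R 0) (N 2%:R 1) (N 2%:R 2%:R) NE => n0 n1 n2 n3 n4 n5 n6 n7 n8 NE.
move=> last; have r2 j : (adjointmx (cv3 0 0 1) *m mx3 n0 n1 n2 n3 n4 n5 n6 n7 n8) 0 j = 0.
  by rewrite last mxE.
have [n60 n70 n80] : [/\ n6 = 0, n7 = 0 & n8 = 0].
  by split; [have := r2 0 | have := r2 1 | have := r2 2%:R];
    rewrite mxE sum3 !mxE /= !conjE conjc0 conjc1 !mul0r !add0r mul1r.
rewrite minors2_mx3 n60 n70 n80 !mulr0 !subr0 !addr0 => /eqP; rewrite subr_eq0 => /eqP det0.
have [p [q [pq e3 e4]]] := singular_block_null det0.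
have pqC : p * conjc p + q * conjc q = 1 by rewrite -!sqnE -realCD pq.
pose V := mx3 p (- conjc q) 0 q (conjc p) 0 0 0 1.
have VV : adjointmx V *m V = 1%:M.
  rewrite /V adjoint_mx3 !conjcE mul_mx3 scalar_mx3.
  by rewrite !(mul0r, mulr0, addr0, add0r, mul1r) -pqC; congr mx3; ring.
exists (U *m V).
  by rewrite adjointmxM -mulmxA (mulmxA _ U) UU mul1mx.
have -> : adjointmx (U *m V) *m M *m (U *m V) = adjointmx V *m N *m V.
  by rewrite /N adjointmxM !mulmxA.
rewrite NE n60 n70 n80 /V adjoint_mx3 !mul_mx3 !conjcE.
do 4 eexists; rewrite /sandwich3; congr mx3; try reflexivity.
- by transitivity (conjc p * (n0 * p + n1 * q) + conjc q * (n3 * p + n4 * q)); [ring | rewrite e3 e4; ring].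
- by transitivity (p * (n3 * p + n4 * q) - q * (n0 * p + n1 * q)); [ring | rewrite e3 e4; ring].
- by ring.
- by ring.
- by ring.
Qed.

Lemma specb_W_disc (l : R) (M : 'M[C]_3) : 0 <= l -> eigenvalue M 0 ->
  elliptic_range 0 l M -> specb_W M.
Proof.
rewrite le_eqVlt => /predU1P[<- _ /elliptic_range00 ->|l0 ev WM]; first exact: specb_W0.
have [e2 _] := elliptic_range_invariants (lexx 0) (ltW l0) WM.
rewrite expr0n oppr0 in e2.
have [U UU [a [b [mu [c UE]]]]] := unitary_sandwich ev e2.
apply: (specb_W_conj UU); have := elliptic_range_conj UU WM.
by rewrite UE; apply: specb_W_sandwich.
Qed.

End EllipseCases.

(** * Ellipses with distinct foci *)

Section ProperEllipse.
Variable R : realType.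
Local Notation C := R[i].
Local Notation nc := (@Normc.normc R).

Lemma mxtrace_hpart (M : 'M[C]_3) d : \tr M = 0 -> \tr (hpart M d) = 0.
Proof.
move=> t0; rewrite /hpart mxtraceZ mxtraceD !mxtraceZ t0 mulr0 add0r.
have -> : \tr (adjointmx M) = conjc (\tr M).
  by rewrite /mxtrace !sum3 !mxE !conjE !conjcD.
by rewrite t0 conjc0 !mulr0.
Qed.

Lemma hermitian_traceless_singular (A : 'M[C]_3) : adjointmx A = A -> \tr A = 0 -> \det A = 0 ->
  exists2 U : 'M[C]_3, adjointmx U *m U = 1%:M &
    exists d, adjointmx U *m A *m U = mx3 d 0 0 0 0 0 0 0 (- d).
Proof.
move=> AA tA dA.
have An : A \is normalmx by apply/normalmxP; rewrite -/(adjointmx A) AA.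
have Pu : spectralmx A \is unitarymx by apply: spectral_unitarymx.
have PP : spectralmx A *m adjointmx (spectralmx A) = 1%:M by apply/unitarymxP.
have := orthomx_spectralP An; rewrite invmx_unitary // => AE.
set P := spectralmx A in Pu PP AE; set D := spectral_diag A in AE.
have AE' : A = adjointmx P *m diag_mx D *m P by [].
have DE : diag_mx D = mx3 (D 0 0) 0 0 0 (D 0 1) 0 0 0 (D 0 2%:R).
  by apply/matrixP; elim/ord3P; elim/ord3P; rewrite !mxE.
have PAP : P *m A *m adjointmx P = diag_mx D.
  by rewrite AE' !mulmxA PP mul1mx -mulmxA PP mulmx1.
have key (V : 'M[C]_3) d : adjointmx V *m V = 1%:M ->
    adjointmx V *m diag_mx D *m V = mx3 d 0 0 0 0 0 0 0 (- d) ->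
    exists2 U : 'M[C]_3, adjointmx U *m U = 1%:M &
      exists d, adjointmx U *m A *m U = mx3 d 0 0 0 0 0 0 0 (- d).
  move=> VV VD; exists (adjointmx P *m V).
    by rewrite adjointmxM adjointmxK -mulmxA (mulmxA P) PP mul1mx.
  by exists d; rewrite -VD -PAP adjointmxM adjointmxK !mulmxA.
have PP' : adjointmx P *m P = 1%:M by apply: mulmx1C.
have tD : \tr (diag_mx D) = 0 by rewrite -PAP mxtrace_mulC mulmxA PP' mul1mx.
have dD : \det (diag_mx D) = 0 by rewrite -PAP !det_mulmx dA mulr0 mul0r.
move: tD dD key; rewrite DE mxtrace_mx3 det_mx3; move: (D 0 0) (D 0 1) (D 0 2%:R) => x y z t0 d0 key.
have : x * y * z = 0 by rewrite -d0; ring.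
move/eqP; rewrite !mulf_eq0 -orbA => /or3P[] /eqP e0.
- apply: (key (mx3 0 1 0 1 0 0 0 0 1) y).
    by rewrite adjoint_mx3 !conjcE mul_mx3 scalar_mx3; congr mx3; ring.
  have -> : z = - y by apply/eqP; rewrite -addr_eq0 -t0 e0; apply/eqP; ring.
  by rewrite adjoint_mx3 !conjcE !mul_mx3 e0; congr mx3; ring.
- apply: (key 1%:M x); first by rewrite adjointmx1 mulmx1.
  have -> : z = - x by apply/eqP; rewrite -addr_eq0 -t0 e0; apply/eqP; ring.
  by rewrite adjointmx1 mul1mx mulmx1 e0.
- apply: (key (mx3 1 0 0 0 0 1 0 1 0) x).
    by rewrite adjoint_mx3 !conjcE mul_mx3 scalar_mx3; congr mx3; ring.
  have -> : y = - x by apply/eqP; rewrite -addr_eq0 -t0 e0; apply/eqP; ring.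
  by rewrite adjoint_mx3 !conjcE !mul_mx3 e0; congr mx3; ring.
Qed.

(** For nonzero [s], [k] is forced to be [- p / conjc s] and the hypothesis is the last equation;
    for [s = 0] a square root of [- q / conjc q] solves it. *)
Lemma exists_phase (p q s : C) : sqn p = sqn s ->
  p * s * conjc q + conjc p * conjc s * q = 0 ->
  exists k, [/\ sqn k = 1, k * conjc s = - p & k * conjc q + conjc k * q = 0].
Proof.
move=> ps h; have [s0|sn] := eqVneq s 0.
  have p0 : p = 0 by apply/eqP; rewrite -sqn_eq0 ps s0 sqn0.
  have [->|qn] := eqVneq q 0.
    by exists 1; rewrite sqn1 s0 p0 !conjc0 !mulr0 addr0 oppr0.
  have qc : conjc q != 0 by rewrite -sqn_eq0 sqn_conj sqn_eq0.
  pose k := sqrtc (- (q / conjc q)).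
  have k2 : k ^+ 2 = - (q / conjc q) by rewrite sqr_sqrtc.
  have k1 : sqn k = 1.
    have := sqnX k 2; rewrite k2 sqnN sqnM sqnV sqn_conj mulfV ?sqn_eq0 // => /esym/eqP.
    rewrite sqrf_eq1 => /orP[/eqP //|/eqP e]; have := sqn_ge0 k; rewrite e; lra.
  have kn : k != 0 by rewrite -sqn_eq0 k1 oner_eq0.
  have kk : k * conjc k = 1 by rewrite -sqnE k1.
  exists k; rewrite s0 p0 conjc0 mulr0 oppr0; split => //.
  apply: (mulfI kn); transitivity (k ^+ 2 * conjc q + k * conjc k * q); first by ring.
  by rewrite k2 kk; field.
have sc : conjc s != 0 by rewrite -sqn_eq0 sqn_conj sqn_eq0.
exists (- (p / conjc s)).
have ppC : p * conjc p = s * conjc s by rewrite -!sqnE ps.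
split.
- by rewrite sqnN sqnM sqnV sqn_conj ps mulfV // sqn_eq0.
- by field.
- have cV : conjc (conjc s)^-1 = s^-1.
    by apply: (mulfI sn); rewrite mulfV // -[s in s * _]conjcK -conjcM mulfV // conjc1.
  rewrite !conjcE cV; rewrite -[LHS]opprK; apply/eqP; rewrite oppr_eq0; apply/eqP.
  transitivity ((p * s * conjc q + conjc p * conjc s * q) / (s * conjc s)); first by field; rewrite sn sc.
  by rewrite h mul0r.
Qed.

Lemma specb_W_traceless (M : 'M[C]_3) (d b p q s : C) : 
  sqn p = sqn s -> p * s * conjc q + conjc p * conjc s * q = 0 ->
  M = mx3 (d + 'i * b) ('i * p) ('i * q) ('i * conjc p) 0 ('i * s)
          ('i * conjc q) ('i * conjc s) (- (d + 'i * b)) ->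
  specb_W M.
Proof.
move=> ps h ME; have [k [k1 ks kq]] := exists_phase ps h.
have [m [cm mm]] : exists m : C, conjc m = m /\ m * m + m * m = 1.
  exists (Num.sqrt 2^-1)%:C; split; first by rewrite conjc_real.
  rewrite -realCM -realCD -!expr2 sqr_sqrtr ?invr_ge0 ?ler0n //.
  by congr (_%:C); field.
have kk : k * conjc k = 1 by rewrite -sqnE k1.
(* Columns e2 and (e1 -+ conjc k e3)/sqrt 2. The last property of [k] makes the diagonal vanish, and
   [k * conjc s = - p] decouples e2 from the third column. *)
pose U := mx3 0 m m 1 0 0 0 (- (m * conjc k)) (m * conjc k).
have UU : adjointmx U *m U = 1%:M.
  rewrite /U adjoint_mx3 !conjcE cm mul_mx3 scalar_mx3; congr mx3; try ring.
  - by rewrite -mm; transitivity (m * m + m * m * (k * conjc k)); [ring | rewrite kk mulr1].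
  - by transitivity (m * m - m * m * (k * conjc k)); [ring | rewrite kk mulr1 subrr].
  - by transitivity (m * m - m * m * (k * conjc k)); [ring | rewrite kk mulr1 subrr].
  - by rewrite -mm; transitivity (m * m + m * m * (k * conjc k)); [ring | rewrite kk mulr1].
apply: (specb_W_conj UU).
have ks' : conjc k * s = - conjc p by rewrite -conjcN -ks !conjcE.
have [x [y [z [w ->]]]] : exists x y z w, adjointmx U *m M *m U = tridiag3 0 x y z w; last first.
  exact: tridiag3_zero_diag.
rewrite ME /U adjoint_mx3 conjc0 conjc1 !conjcE cm !mul_mx3.
do 4 eexists; rewrite tridiag3_mx3; congr mx3; try reflexivity.
- by ring.
- by transitivity ('i * m * (conjc p + conjc k * s)); [ring | rewrite ks' subrr mulr0].
- transitivity (m * m * ((d + 'i * b) * (1 - k * conjc k) - 'i * (k * conjc q + conjc k * q))); first by ring.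
  by rewrite kk kq subrr !mulr0 subrr mulr0.
- by transitivity ('i * m * (p + k * conjc s)); [ring | rewrite ks subrr mulr0].
- transitivity (m * m * ((d + 'i * b) * (1 - k * conjc k) + 'i * (k * conjc q + conjc k * q))); first by ring.
  by rewrite kk kq subrr !mulr0 addr0 mulr0.
Qed.

Lemma specb_W_proper_ellipse f p (M : 'M[C]_3) : 0 < f -> f <= p ->
  eigenvalue M 0 -> elliptic_range f p M -> specb_W M.
Proof.
move=> f0 fp ev WM; have p0 : 0 < p := lt_le_trans f0 fp.
have [_ dM] := elliptic_range_invariants (ltW f0) fp WM.
have dM0 : \det M = 0.
  have /eigenvalueP[v vM vn] := ev; apply/eqP/det0P; exists v => //.
  by rewrite vM scale0r.
have fC : (f ^+ 2)%:C != 0 :> C by rewrite -sqn_eq0 sqn_real !expf_neq0 // gt_eqF.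
have tM : \tr M = 0.
  by apply: (mulfI fC); rewrite mulr0; apply: oppr_inj; rewrite -dM dM0 oppr0.
have tr0 d : \tr (hpart M d) = 0 by apply: mxtrace_hpart.
have inv c s : \det (hpart M (Complex c (- s))) = 0.
  by have [_ ->] := hpart_invariants (ltW f0) fp WM c s; rewrite tr0 mulr0 oppr0.
have D1 : Complex 1 (- 0) = 1 :> C by rewrite oppr0.
have D2 : Complex 0 (- 1) = - 'i :> C by apply/eqP; rewrite eq_complex /= oppr0 !eqxx.
have [U UU [d AE]] := hermitian_traceless_singular (hpart_adjoint M 1) (tr0 1)
  (etrans (congr1 (fun x => \det (hpart M x)) (esym D1)) (inv 1 0)).
apply: (specb_W_conj UU).
have WN := elliptic_range_conj UU WM.
rewrite -hpart_conj in AE.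
have UU' : U *m adjointmx U = 1%:M by apply: mulmx1C.
have trN e : \tr (hpart (adjointmx U *m M *m U) e) = 0.
  by rewrite hpart_conj mxtrace_mulC mulmxA UU' mul1mx tr0.
move: WN AE trN; set N := adjointmx U *m M *m U => WN AE trN.
have invN := hpart_invariants (ltW f0) fp WN.
have detN c s : \det (hpart N (Complex c (- s))) = 0.
  by have [_ ->] := invN c s; rewrite trN mulr0 oppr0.
have d2 : d * d = (p ^+ 2)%:C.
  have pE : p ^+ 2 * 1 ^+ 2 + (p ^+ 2 - f ^+ 2) * 0 ^+ 2 = p ^+ 2 by ring.
  have [+ _] := invN 1 0; rewrite D1 AE minors2_mx3 pE => e.
  by apply: oppr_inj; rewrite -e; ring.
have dn : d != 0.
  apply/eqP => d0; move: d2; rewrite d0 mulr0 => /esym /eqP.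
  by rewrite -sqn_eq0 sqn_real !expf_eq0 /= gt_eqF.
have e1 : Complex 1 (- 1) = 1 + - 'i :> C by apply/eqP; rewrite eq_complex /= oppr0 addr0 add0r !eqxx.
have e2 : Complex 1 (- - 1) = 1 + - - 'i :> C by apply/eqP; rewrite eq_complex /= opprK addr0 add0r opprK !eqxx.
have dB := detN 0 1; have dS := detN 1 1; have dD := detN 1 (-1).
rewrite D2 in dB; rewrite e1 hpartD AE in dS; rewrite e2 hpartD (hpartN _ (- 'i)) AE in dD.
have NE : N = hpart N 1 + 'i *: hpart N (- 'i) by rewrite -D1 -D2; apply: hpart_decomp.
move: NE (hpart_adjoint N (- 'i)) (trN (- 'i)) dB dS dD; rewrite AE.
move: (hpart N (- 'i)) => B NE BB tB dB dS dD.
have BC i j : conjc (B j i) = B i j by rewrite -[in RHS]BB !mxE conjE.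
have BE := mx3P B; rewrite -(BC 1 0) -(BC 2%:R 0) -(BC 2%:R 1) in BE.
move: (B 0 0) (B 0 1) (B 0 2%:R) (B 1 1) (B 1 2%:R) (B 2%:R 2%:R) BE => b x q e s t BE.
move: tB dB dS dD; rewrite BE -(scaleN1r (mx3 b _ _ _ _ _ _ _ _)) scale_mx3 !add_mx3 !det_mx3 mxtrace_mx3 => tB dB dS dD.
have two : 2%:R != 0 :> C by rewrite pnatr_eq0.
(* With A = diag(d, 0, -d), det(A - B) - det(A + B) + 2 det B isolates 2 d^2 e; the sum of the first
   two determinants then compares |x| with |s|. *)
have e0 : e = 0.
  apply: (mulfI (mulf_neq0 two (mulf_neq0 dn dn))); rewrite mulr0.
  have lin (u v w : C) : u = 0 -> v = 0 -> w = 0 -> u - v + 2%:R * w = 0.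
    by move=> -> -> ->; rewrite subrr mulr0 addr0.
  by rewrite -[RHS](lin _ _ _ dD dS dB); ring.
have tE : t = - b by apply/eqP; rewrite -addr_eq0 -tB e0; apply/eqP; ring.
rewrite e0 tE in dB dS dD BE.
have xs : sqn x = sqn s.
  apply: complexI; rewrite !sqnE; apply: (mulfI (mulf_neq0 two dn)).
  apply/eqP; rewrite -subr_eq0; apply/eqP.
  have lin (u v : C) : u = 0 -> v = 0 -> u + v = 0 by move=> -> ->; rewrite addr0.
  by rewrite -[RHS](lin _ _ dD dS); ring.
apply: (specb_W_traceless (d := d) (b := b) (q := q) xs); last first.
  by rewrite NE BE scale_mx3 add_mx3; congr mx3; ring.
have xsC : x * conjc x = s * conjc s by rewrite -!sqnE xs.
rewrite -dB; transitivity (x * s * conjc q + conjc x * conjc s * q + b * (x * conjc x - s * conjc s)); last by ring.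
by rewrite xsC subrr mulr0 addr0.
Qed.

End ProperEllipse.

Section GeneralEllipse.
Variable R : realType.
Local Notation C := R[i].
Local Notation nc := (@Normc.normc R).

Lemma specb_W_centered_ellipse f p (M : 'M[C]_3) : 0 <= f -> f <= p ->
  eigenvalue M 0 -> elliptic_range f p M -> specb_W M.
Proof.
rewrite le_eqVlt => /predU1P[<-|f0]; first exact: specb_W_disc.
exact: specb_W_proper_ellipse.
Qed.

Lemma specb_W_ellipse (M : 'M[C]_3) (f1 f2 : C) (L : R) :
  nc (f1 - f2) <= L -> numerical_range M = ellipse f1 f2 L ->
  eigenvalue M ((f1 + f2) / 2%:R) -> specb_W M.
Proof.
move=> fL WM ev; have two : 2%:R != 0 :> C by rewrite pnatr_eq0.
have [c cE] : exists c, c = (f1 + f2) / 2%:R by eexists.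
have [g gE] : exists g, g = (f1 - f2) / 2%:R by eexists.
have f1E : f1 = c + g by rewrite cE gE; field.
have f2E : f2 = c - g by rewrite cE gE; field.
rewrite -cE in ev.
(* The rotation that puts the foci on the real axis, symmetric about 0 after translation. *)
have [s [s1 sg]] : exists s, nc s = 1 /\ s * g = (nc g)%:C.
  have [->|gn] := eqVneq g 0; first by exists 1; rewrite nc1 mulr0 nc0.
  have gn' : (nc g)%:C != 0 :> C by rewrite -sqn_eq0 sqn_real normc_sqr sqn_eq0.
  exists (conjc g / (nc g)%:C); split.
    by apply: sqn_nc1; rewrite sqnM sqnV sqn_real sqn_conj normc_sqr mulfV // sqn_eq0.
  transitivity ((nc g ^+ 2)%:C / (nc g)%:C); last by rewrite realCX expr2 mulfK.
  by rewrite normc_sqr sqnE; ring.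
have sn : s != 0.
  by apply/eqP => s0; move/eqP: s1; rewrite s0 nc0 eq_sym oner_eq0.
pose M1 := (- (s * c))%:M + s *: M.
have ME : M = c%:M + s^-1 *: M1.
  rewrite /M1 scalerDr scalerA mulVf // scale1r scale_scalar_mx addrA -raddfD /=.
  by rewrite mulrN mulrA mulVf // mul1r subrr raddf0 add0r.
have W1 z : numerical_range M1 z <-> numerical_range M (c + s^-1 * z).
  split=> [h|/(@numerical_range_affine _ _ _ (- (s * c)) s)].
    by rewrite ME; apply: numerical_range_affine.
  by rewrite -/M1; congr numerical_range; field.
have e2 : nc (2%:R : C) = 2%:R by rewrite -[RHS](@nc_pos R) ?ler0n // -[in LHS](rmorph_nat (real_complex R)).
rewrite ME; apply: specb_W_affine; apply: (@specb_W_centered_ellipse (nc g) (L / 2%:R)).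
- exact: nc_ge0.
- by rewrite gE ncM ncV e2 ler_pM2r // invr_gt0 ltr0n.
- have /eigenvalueP[v vM vn] := ev; apply/eigenvalueP; exists v => //.
  by rewrite /M1 mulmxDr mul_mx_scalar -scalemxAr vM scalerA -scalerDl addNr.
move=> z; rewrite (W1 z) WM /ellipse /= f1E f2E -sg.
have -> : c + s^-1 * z - (c + g) = s^-1 * (z - s * g) by field.
have -> : c + s^-1 * z - (c - g) = s^-1 * (z + s * g) by field.
rewrite !ncM ncV s1 invr1 !mul1r.
by have -> : 2 * (L / 2) = L by field.
Qed.

End GeneralEllipse.

Theorem mainTheorem2 (R : realType) :
  (forall a b1 b2 c1 c2 : R[i], mvpoly_bound2 (tridiag3 a b1 b2 c1 c2)) /\
  (forall (M : 'M[R[i]]_3) (f1 f2 : R[i]) (L : R),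
     Normc.normc (f1 - f2) <= L ->
     numerical_range M = ellipse f1 f2 L ->
     eigenvalue M ((f1 + f2) / 2) ->
     mvpoly_bound2 M).
Proof.
split=> [a b1 b2 c1 c2|M f1 f2 L fL WM ev]; apply: mvpoly_bound2_specb.
  exact: tridiag3_specb.
exact: specb_W_ellipse fL WM ev.
Qed.
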